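(* Let $X$ be an infinite-dimensional complex Banach space and let $T\in L(X)$. (1) If $\mathbf{R}\in\{\mathbf{R}_1,\mathbf{R}_2,\mathbf{R}_3,\mathbf{R}_4,\mathbf{R}_5,\mathcal{W}_-(X)\}$, then the following three conditions are equivalent: (i) $T\in\mathbf{BR}$; (ii) $T$ is quasi-Fredholm and $0\notin\operatorname{acc}\sigma_{\mathbf{R}}(T)$; (iii) $T$ is quasi-Fredholm and $0\notin\operatorname{int}\sigma_{\mathbf{R}}(T)$. If $\mathbf{R}\in\{\mathbf{R}_6,\mathbf{R}_7,\mathbf{R}_8,\mathbf{R}_9,\mathbf{R}_{10},\mathbf{R}_4^a,\mathbf{R}_5^a,\mathcal{W}_+(X),\mathcal{W}(X),\Phi(X),\mathcal{B}(X),L(X)^{-1}\}$, then the following three conditions are equivalent: (i) $T\in\mathbf{BR}$; (ii) $T$ has TUD and $0\notin\operatorname{acc}\sigma_{\mathbf{R}}(T)$; (iii) $T$ has TUD and $0\notin\operatorname{int}\sigma_{\mathbf{R}}(T)$. (2) If $\mathbf{R}\in\{\mathbf{R}_1,\mathbf{R}_2,\mathbf{R}_4,\mathbf{R}_6,\mathbf{R}_7,\mathbf{R}_9\}\cup\{\mathcal{W}_+(X),\mathcal{W}_-(X),\mathcal{W}(X),\Phi(X),\mathcal{B}(X),L(X)^{-1}\}$, then $$\operatorname{int}\sigma_{\mathbf{R}}(T)=\operatorname{int}\sigma_{\mathbf{BR}}(T),\qquad \partial\sigma_{\mathbf{BR}}(T)\subset\partial\sigma_{\mathbf{R}}(T),$$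 and $\sigma_{\mathbf{R}}(T)\setminus\sigma_{\mathbf{BR}}(T)$ consists of at most countably many isolated points.
   Context: For a complex Banach space $Y$, $L(Y)$ is the algebra of bounded linear operators on $Y$ and $L(Y)^{-1}$ the group of invertible ones. For $S\in L(Y)$: $N(S)$ is the null space, $R(S)$ the range, $\alpha(S)=\dim N(S)$, $\beta(S)=\operatorname{codim}R(S)$, $S^0=I$. With $\inf\emptyset=\infty$ and $n$ ranging over $\mathbb{N}_0=\{0,1,2,\dots\}$: ascent $a(S)=\inf\{n: N(S^n)=N(S^{n+1})\}$; descent $\delta(S)=\inf\{n:R(S^n)=R(S^{n+1})\}$; essential ascent $a_e(S)=\inf\{n:\dim N(S^{n+1})/N(S^n)<\infty\}$; essential descent $\delta_e(S)=\inf\{n:\dim R(S^n)/R(S^{n+1})<\infty\}$. Classes of operators (each defined on every complex Banach space $Y$; written here for $Y=X$): - $\Phi_+(X)$: $\alpha(S)<\infty$ and $R(S)$ closed (upper semi-Fredholm); $\Phi_-(X)$: $\beta(S)<\infty$ (lower semi-Fredholm); $\Phi(X)=\Phi_+(X)\cap\Phi_-(X)$ (Fredholm); $\operatorname{ind}(S)=\alpha(S)-\beta(S)$ for $S\in\Phi_+(X)\cup\Phi_-(X)$. - $\mathcal{W}_+(X)=\{S\in\Phi_+(X):\operatorname{ind}(S)\le0\}$, $\mathcal{W}_-(X)=\{S\in\Phi_-(X):\operatorname{ind}(S)\ge0\}$, $\mathcal{W}(X)=\{S\in\Phi(X):\operatorname{ind}(S)=0\}$. - $\mathcal{B}_+(X)=\{S\in\Phi_+(X):a(S)<\infty\}$,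 $\mathcal{B}_-(X)=\{S\in\Phi_-(X):\delta(S)<\infty\}$, $\mathcal{B}(X)=\mathcal{B}_+(X)\cap\mathcal{B}_-(X)$. - $LD(X)$: $a(S)<\infty$ and $R(S^{a(S)+1})$ closed; $RD(X)$: $\delta(S)<\infty$ and $R(S^{\delta(S)})$ closed; $LD^e(X)$: $a_e(S)<\infty$ and $R(S^{a_e(S)+1})$ closed; $RD^e(X)$: $\delta_e(S)<\infty$ and $R(S^{\delta_e(S)})$ closed. - $\mathbf{R}_1$ = surjective operators; $\mathbf{R}_2=\mathcal{B}_-(X)$; $\mathbf{R}_3=RD(X)$; $\mathbf{R}_4=\Phi_-(X)$; $\mathbf{R}_5=RD^e(X)$; $\mathbf{R}_6$ = bounded below operators; $\mathbf{R}_7=\mathcal{B}_+(X)$; $\mathbf{R}_8=LD(X)$; $\mathbf{R}_9=\Phi_+(X)$; $\mathbf{R}_{10}=LD^e(X)$; $\mathbf{R}_4^a=\{S:\delta(S)<\infty\}$; $\mathbf{R}_5^a=\{S:\delta_e(S)<\infty\}$. For $T\in L(X)$ and $n\in\mathbb{N}_0$, $T_n$ is the restriction of $T$ to $R(T^n)$ viewed as a map $R(T^n)\to R(T^n)$ (so $T_0=T$). For each class $\mathbf{R}$, $T\in\mathbf{BR}$ means that there is $n\in\mathbb{N}_0$ such that $R(T^n)$ is closed and $T_n$ belongs to the class $\mathbf{R}$ (on the Banach space $R(T^n)$). $\sigma_{\mathbf{R}}(T)=\{\lambda\in\mathbb{C}:T-\lambda I\notin\mathbf{R}\}$, $\sigma_{\mathbf{BR}}(T)=\{\lambda\in\mathbb{C}:T-\lambda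 I\notin\mathbf{BR}\}$. Let $k_n(T)=\dim (R(T^n)\cap N(T))/(R(T^{n+1})\cap N(T))$. $T$ is quasi-Fredholm if there is $d\in\mathbb{N}_0$ with $k_n(T)=0$ for all $n\ge d$ and $R(T^{d+1})$ closed. On $R(T^d)$ the operator range topology is given by the norm $\|y\|_d=\inf\{\|x\|:x\in X,\ y=T^dx\}$. $T$ has topological uniform descent (TUD) for $n\ge d$ if $k_n(T)=0$ for all $n\ge d$ and $R(T^n)$ is closed in the operator range topology of $R(T^d)$ for all $n\ge d$; $T$ has TUD if this holds for some $d\in\mathbb{N}_0$. For $K\subset\mathbb{C}$: $\operatorname{acc}K$, $\operatorname{int}K$, $\partial K$ denote the sets of accumulation points, interior points, and boundary points of $K$ in $\mathbb{C}$. *)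

(* Defs.v *)
From HB Require Import structures.
From mathcomp Require Import all_boot all_order all_algebra.
From mathcomp Require Import complex.
From mathcomp Require Import all_classical all_reals all_analysis.

Set Implicit Arguments.
Unset Strict Implicit.
Unset Printing Implicit Defensive.

Import Order.TTheory GRing.Theory Num.Theory.
Import numFieldNormedType.Exports.

Local Open Scope classical_set_scope.
Local Open Scope ring_scope.
Local Open Scope complex_scope.

(* The structures on R[i]^o (topology of the modulus) are not inferred on the
   concrete type R[i]. *)
HB.instance Definition _ (R : realType) := PseudoPointedMetric.copy R[i] R[i]^o.

Definition boundary (T : topologicalType) (A : set T) : set T :=
  closure A `\` interior A.

Section ClosedSubspace.
Context (K : numFieldType) (Y : completeNormedModType K).

Record closedSubspace := ClosedSubspace {
  cs_set :> set Y ;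
  cs_linear : submod_closed (mem cs_set) ;
  cs_closed : closed cs_set }.

Variable M : closedSubspace.

Definition cs_pred : {pred Y} := mem (cs_set M).

HB.instance Definition _ :=
  GRing.isSubmodClosed.Build K Y cs_pred (@cs_linear M).

(* A closed subspace is itself a Banach space for the restricted norm. *)
Record csub := CSub { csub_val : Y ; csub_valP : csub_val \in cs_pred }.

HB.instance Definition _ := [isSub for csub_val].
HB.instance Definition _ := [Choice of csub by <:].
HB.instance Definition _ := [SubChoice_isSubLmodule of csub by <:].

Let csub_norm (x : csub) : K := `|csub_val x|.

Let csub_ler_normD x y : csub_norm (x + y) <= csub_norm x + csub_norm y.
Proof. exact: ler_normD. Qed.

Let csub_normrZ (a : K) x : csub_norm (a *: x) = `|a| * csub_norm x.
Proof. exact: normrZ. Qed.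

Let csub_normr0_eq0 x : csub_norm x = 0 -> x = 0.
Proof. by move=> /normr0_eq0 x0; apply: val_inj. Qed.

HB.instance Definition _ := Lmodule_isNormed.Build K csub
  csub_ler_normD csub_normrZ csub_normr0_eq0.

Let csub_complete (F : set_system csub) : ProperFilter F -> cauchy F -> cvg F.
Proof.
move=> FF /cauchy_ballP Fc.
have GF : ProperFilter (csub_val @ F) by exact: fmap_proper_filter.
have : cvg (csub_val @ F).
  apply: cauchy_cvg; apply/cauchy_ballP => e e0; have := Fc e e0.
  rewrite !near_simpl => -[[A B] /= [FA FB] AB].
  exists (csub_val @` A, csub_val @` B) => /=.
    by split; [apply: filterS FA|apply: filterS FB] => x ?; exists x.
  move=> [_ _] /= [[x Ax <-] [y By <-]].
  by have := AB (x, y) (conj Ax By); rewrite -!ball_normE.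
move=> /cvg_ex[l Fl].
have Ml : cs_set M l.
  apply: (@closed_cvg _ _ F _ csub_val (cs_set M) (@cs_closed M) _ l Fl).
  by apply: nearW => x; exact/set_mem/(csub_valP x).
apply/cvg_ex; exists (CSub (mem_set Ml)).
apply/cvgrPdist_lt => e e0; move/cvgrPdist_lt : Fl => /(_ e e0).
by apply: filterS => x.
Qed.

HB.instance Definition _ := Uniform_isComplete.Build csub csub_complete.

End ClosedSubspace.

Record boundedOp (R : realType) (Y : completeNormedModType R[i]) := BoundedOp {
  bop_fun :> {linear Y -> Y} ;
  bop_bounded : exists c : R, forall x, `|bop_fun x| <= c%:C * `|x| }.

Section Shift.
Context (R : realType) (Y : completeNormedModType R[i]).
Variables (T : boundedOp Y) (l : R[i]).

Definition shift_fun (x : Y) : Y := T x - l *: x.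

Let shift_linear : linear shift_fun.
Proof.
move=> a x y; rewrite /shift_fun linearP scalerDr opprD scalerBr !scalerA.
by rewrite (mulrC a l) addrACA.
Qed.

HB.instance Definition _ := GRing.isLinear.Build _ _ _ _ shift_fun shift_linear.

Let shift_bounded : exists c : R, forall x, `|shift_fun x| <= c%:C * `|x|.
Proof.
have [c Tc] := bop_bounded T; exists (c + complex.Re `|l|) => x.
have Rel : (complex.Re `|l|)%:C = `|l| by rewrite RRe_real ?normr_real.
rewrite rmorphD /= Rel mulrDl.
by rewrite (le_trans (ler_normB _ _))// lerD// normrZ.
Qed.

Definition op_shift : boundedOp Y := BoundedOp shift_bounded.

End Shift.

Section Restriction.
Context (R : realType) (Y : completeNormedModType R[i]).
Variables (T : boundedOp Y) (n : nat).

Let iter_linear : linear (iter n T).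
Proof. by move=> a x y; elim: n => //= m ->; rewrite linearP. Qed.

Let range_linear : submod_closed (mem (range (iter n T))).
Proof.
split=> [|a _ _ /set_mem[x _ <-] /set_mem[y _ <-]]; apply/mem_set.
  by exists 0 => //; elim: n => //= m ->; rewrite linear0.
by exists (a *: x + y) => //; rewrite iter_linear.
Qed.

Hypothesis cl : closed (range (iter n T)).

Definition range_subspace : closedSubspace Y := ClosedSubspace range_linear cl.

Let restr_subproof (x : csub range_subspace) :
  T (csub_val x) \in cs_pred range_subspace.
Proof.
case: x => _ /= /set_mem[x _ <-]; apply/mem_set.
by exists (T x) => //; rewrite -iterSr.
Qed.

Definition restr_fun (x : csub range_subspace) : csub range_subspace :=
  CSub (restr_subproof x).

Let restr_linear : linear restr_fun.
Proof. by move=> a x y; apply: val_inj; rewrite /= linearP. Qed.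

HB.instance Definition _ := GRing.isLinear.Build _ _ _ _ restr_fun restr_linear.

Let restr_bounded : exists c : R, forall x, `|restr_fun x| <= c%:C * `|x|.
Proof. by have [c Tc] := bop_bounded T; exists c => x; exact: Tc. Qed.

Definition restr : boundedOp (csub range_subspace) := BoundedOp restr_bounded.

End Restriction.

(* ereal_inf set0 = +oo, so this is the infimum in N u {+oo}. *)
Definition infn (R : realType) (A : set nat) : \bar R :=
  ereal_inf [set n%:R%:E | n in A].

Section Dimension.
Context (R : realType) (Y : completeNormedModType R[i]).

(* The classes of the v i form a basis of A / B, for subspaces B `<=` A. *)
Definition quot_basis (A B : set Y) (n : nat) (v : 'I_n -> Y) : Prop :=
  [/\ forall i, A (v i),
      forall c : 'I_n -> R[i], B (\sum_(i < n) c i *: v i) -> forall i, c i = 0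
    & forall x, A x -> exists c : 'I_n -> R[i], B (x - \sum_(i < n) c i *: v i)].

Definition quot_dim (A B : set Y) : \bar R :=
  infn R [set n | exists v : 'I_n -> Y, quot_basis A B v].

Definition subspace_dim (A : set Y) : \bar R := quot_dim A [set 0].
Definition subspace_codim (A : set Y) : \bar R := quot_dim setT A.

End Dimension.

Section OperatorNotions.
Context (R : realType) (Y : completeNormedModType R[i]).
Implicit Types (S T : boundedOp Y) (n d : nat).

Definition null_space (f : Y -> Y) : set Y := [set x | f x = 0].

Definition nullity S : \bar R := subspace_dim (null_space S).
Definition deficiency S : \bar R := subspace_codim (range S).
(* Meaningful when nullity S or deficiency S is finite. *)
Definition fredholm_index S : \bar R := (nullity S - deficiency S)%E.

Definition ascent S : \bar R :=
  infn R [set n | null_space (iter n S) = null_space (iter n.+1 S)].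
Definition descent S : \bar R :=
  infn R [set n | range (iter n S) = range (iter n.+1 S)].
Definition ess_ascent S : \bar R :=
  infn R [set n |
    (quot_dim (null_space (iter n.+1 S)) (null_space (iter n S)) < +oo)%E].
Definition ess_descent S : \bar R :=
  infn R [set n |
    (quot_dim (range (iter n S)) (range (iter n.+1 S)) < +oo)%E].

Definition k_dim T n : \bar R :=
  quot_dim (range (iter n T) `&` null_space T)
           (range (iter n.+1 T) `&` null_space T).

Definition quasi_fredholm T : Prop :=
  exists d, (forall n, (d <= n)%N -> k_dim T n = 0%E) /\
            closed (range (iter d.+1 T)).

(* The norm of R(T^d) defining its operator range topology. *)
Definition range_norm T d (y : Y) : R :=
  inf [set complex.Re `|x| | x in [set x | y = iter d T x]].

(* A is closed in R(T^d) for the operator range topology: its complement in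
   R(T^d) is open. *)
Definition range_closed T d (A : set Y) : Prop :=
  forall y, range (iter d T) y -> ~ A y ->
    exists2 e : R, 0 < e &
      forall z, range (iter d T) z -> range_norm T d (z - y) < e -> ~ A z.

Definition uniform_descent_from T d : Prop :=
  forall n, (d <= n)%N -> k_dim T n = 0%E /\ range_closed T d (range (iter n T)).

Definition TUD T : Prop := exists d, uniform_descent_from T d.

End OperatorNotions.

(* A class is given on every Banach space at once, so that it can be applied
   both to T and to its restriction to R(T^n). *)
Definition opclass (R : realType) :=
  forall Y : completeNormedModType R[i], set (boundedOp Y).

Section Classes.
Context (R : realType).

Definition invertible : opclass R := fun Y S =>
  exists S' : boundedOp Y, cancel S S' /\ cancel S' S.

Definition onto : opclass R := fun Y S => range S = setT.
Definition bounded_below : opclass R := fun Y S =>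
  exists2 c : R, 0 < c & forall x, c%:C * `|x| <= `|S x|.

Definition upper_fredholm : opclass R := fun Y S =>
  (nullity S < +oo)%E /\ closed (range S).
(* A bounded operator with range of finite codimension has closed range. *)
Definition lower_fredholm : opclass R := fun Y S => (deficiency S < +oo)%E.
Definition fredholm : opclass R := fun Y S =>
  upper_fredholm S /\ lower_fredholm S.

Definition upper_weyl : opclass R := fun Y S =>
  upper_fredholm S /\ (fredholm_index S <= 0)%E.
Definition lower_weyl : opclass R := fun Y S =>
  lower_fredholm S /\ (0 <= fredholm_index S)%E.
Definition weyl : opclass R := fun Y S => fredholm S /\ fredholm_index S = 0%E.

Definition upper_browder : opclass R := fun Y S =>
  upper_fredholm S /\ (ascent S < +oo)%E.
Definition lower_browder : opclass R := fun Y S =>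
  lower_fredholm S /\ (descent S < +oo)%E.
Definition browder : opclass R := fun Y S =>
  upper_browder S /\ lower_browder S.

(* In the next four classes n is the (finite) value of the infimum. *)
Definition left_drazin : opclass R := fun Y S =>
  exists2 n, ascent S = n%:R%:E & closed (range (iter n.+1 S)).
Definition right_drazin : opclass R := fun Y S =>
  exists2 n, descent S = n%:R%:E & closed (range (iter n S)).
Definition ess_left_drazin : opclass R := fun Y S =>
  exists2 n, ess_ascent S = n%:R%:E & closed (range (iter n.+1 S)).
Definition ess_right_drazin : opclass R := fun Y S =>
  exists2 n, ess_descent S = n%:R%:E & closed (range (iter n S)).

Definition finite_descent : opclass R := fun Y S => (descent S < +oo)%E.
Definition finite_ess_descent : opclass R := fun Y S =>
  (ess_descent S < +oo)%E.

Definition Bclass (C : opclass R) : opclass R := fun Y T =>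
  exists n, exists cl : closed (range (iter n T)), C _ (restr cl).

Definition class_spectrum (C : opclass R) (Y : completeNormedModType R[i])
    (T : boundedOp Y) : set R[i] :=
  [set l | ~ C Y (op_shift T l)].

End Classes.

(* Main.v *)
From HB Require Import structures.
Require Import Defs.
From Stdlib Require List.
From mathcomp Require Import all_boot all_order all_algebra.
From mathcomp Require Import complex ring lra zify.
From mathcomp Require Import all_classical all_reals all_analysis.
Import Order.TTheory GRing.Theory Num.Theory.
Import numFieldNormedType.Exports.
Local Open Scope classical_set_scope.
Local Open Scope ring_scope.
Local Open Scope complex_scope.

Set Implicit Arguments.
Unset Strict Implicit.
Unset Printing Implicit Defensive.

                                                                                
                                                                           
                                                                             
                                                                             
                                                   

                                                                            
                                                                                 
                                                                                  
                                                                          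
                                                                     
                                                                             
                                                                                  
                                                                                   
                                   

                                                                                 
                                                                                  
                                                                                  
                                                                                   
                                                                                  
                                                                                
                                                                              
                                                                                
                                                                             
                                                                               
                                                                                 
                                                                          

                                                                                 
                                                                                
                                                            

                                     

Section AbelianGroupIdentities.

Inductive zterm := Zvar of nat | Zzero | Zadd of zterm & zterm | Zopp of zterm.

Fixpoint zeval (V : zmodType) (env : seq V) (e : zterm) : V :=
  match e with
  | Zvar n => nth 0 env n
  | Zzero => 0
  | Zadd a b => zeval env a + zeval env b
  | Zopp a => - zeval env a
  end.

Fixpoint zcoef (e : zterm) (n : nat) : int :=
  match e with
  | Zvar m => (m == n)%:R
  | Zzero => 0
  | Zadd a b => zcoef a n + zcoef b n
  | Zopp a => - zcoef a n
  end.

Lemma zevalE (V : zmodType) (env : seq V) e :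
  zeval env e = \sum_(i < size env) nth 0 env i *~ zcoef e i.
Proof.
elim: e => /= [n||a -> b ->|a ->].
- have [nlt|nge] := ltnP n (size env); last first.
    rewrite nth_default// big1// => i _.
    by rewrite gtn_eqF// (leq_trans (ltn_ord i)).
  rewrite (bigD1 (Ordinal nlt))//= eqxx big1 ?addr0// => i.
  by rewrite -val_eqE/= eq_sym => /negPf->.
- by rewrite big1.
- by rewrite -big_split/=; apply: eq_bigr => i _; rewrite mulrzDr.
- by rewrite -sumrN; apply: eq_bigr => i _; rewrite mulrNz.
Qed.

Lemma zeval_eq (V : zmodType) (env : seq V) e1 e2 :
  all (fun i => zcoef e1 i == zcoef e2 i) (iota 0 (size env)) ->
  zeval env e1 = zeval env e2.
Proof.
move=> /allP h; rewrite !zevalE; apply: eq_bigr => i _; congr (_ *~ _).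
by apply/eqP/h; rewrite mem_iota/=.
Qed.

End AbelianGroupIdentities.

                                                                          
                                                          
Ltac zmem x l := match l with
  | nil => constr:(false)
  | ?y :: _ => let u := constr:(erefl x : x = y) in constr:(true)
  | _ :: ?t => zmem x t end.
Ltac zatoms e l := lazymatch e with
  | (?a + ?b)%R => let l' := zatoms a l in zatoms b l'
  | (- ?a)%R => zatoms a l
  | 0%R => l
  | _ => lazymatch zmem e l with true => l | false => constr:(e :: l) end end.
Ltac zindex x l := match l with
  | ?y :: _ => let u := constr:(erefl x : x = y) in constr:(0%N)
  | _ :: ?t => let n := zindex x t in constr:(S n) end.
Ltac zreify e l := lazymatch e with
  | (?a + ?b)%R => let a' := zreify a l in let b' := zreify b l in constr:(Zadd a' b')
  | (- ?a)%R => let a' := zreify a l in constr:(Zopp a')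
  | 0%R => constr:(Zzero)
  | _ => let n := zindex e l in constr:(Zvar n) end.

                                                                              
                                                          
Ltac abelian_group := lazymatch goal with |- @eq ?T ?a ?b =>
  let l0 := zatoms a (@nil T) in let l := zatoms b l0 in
  let ea := zreify a l in let eb := zreify b l in
  exact: (@zeval_eq _ l ea eb isT) end.

                                           

Section RealNorm.
Context (R : realType).

                                                                              
                                                                          
Definition cabs (a : R[i]) : R := complex.Re `|a|.

Lemma cabsE (a : R[i]) : (cabs a)%:C = `|a|.
Proof. by rewrite /cabs RRe_real ?normr_real. Qed.

Lemma cabs_ge0 a : 0 <= cabs a.
Proof. by rewrite -lecR cabsE normr_ge0. Qed.
Lemma cabs0 : cabs 0 = 0. Proof. by rewrite /cabs normr0. Qed.
Lemma cabs1 : cabs 1 = 1. Proof. by rewrite /cabs normr1. Qed.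
Lemma cabs_eq0 a : cabs a = 0 -> a = 0.
Proof. by move=> a0; apply/eqP; rewrite -normr_eq0 -cabsE a0. Qed.
Lemma cabs_gt0 a : a != 0 -> 0 < cabs a.
Proof. by move=> a0; rewrite -ltcR cabsE normr_gt0. Qed.
Lemma cabsN a : cabs (- a) = cabs a. Proof. by rewrite /cabs normrN. Qed.
Lemma cabsD a b : cabs (a + b) <= cabs a + cabs b.
Proof. by rewrite -lecR rmorphD /= !cabsE ler_normD. Qed.
Lemma cabsM a b : cabs (a * b) = cabs a * cabs b.
Proof. by apply: complexI; rewrite rmorphM /= !cabsE normrM. Qed.
Lemma cabsV a : cabs a^-1 = (cabs a)^-1.
Proof.
have [->|a0] := eqVneq a 0; first by rewrite invr0 cabs0 invr0.
have c0 : cabs a != 0 by rewrite gt_eqF// cabs_gt0.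
by apply: (mulfI c0); rewrite -cabsM !divff// cabs1.
Qed.
Lemma cabs_real (x : R) : 0 <= x -> cabs x%:C = x.
Proof. by move=> x0; apply: complexI; rewrite cabsE ger0_norm // lecR. Qed.
Lemma cabs_ge_Re a : `|complex.Re a| <= cabs a.
Proof. by rewrite -lecR cabsE normc_ge_Re. Qed.
Lemma cabs_ge_Im a : `|complex.Im a| <= cabs a.
Proof.
rewrite -lecR cabsE; case: a => a b; rewrite normc_def lecR/=.
rewrite -[leLHS]ger0_norm// -sqrtr_sqr ler_wsqrtr// real_normK ?num_real// ler_wpDl//.
exact: sqr_ge0.
Qed.
Lemma cabs_le_ReIm a : cabs a <= `|complex.Re a| + `|complex.Im a|.
Proof.
case: a => a b /=.
have -> : a +i* b = a%:C + 'i%C * b%:C by simpc.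
rewrite (le_trans (cabsD _ _))// cabsM.
have -> : cabs 'i%C = 1.
  by apply: complexI; rewrite cabsE normc_def/= expr0n/= add0r expr1n sqrtr1.
rewrite mul1r lerD// -lecR cabsE normc_def/= expr0n/= addr0 sqrtr_sqr//.
Qed.

Context (V : normedModType R[i]).
Implicit Types (x y z : V).

Definition nrm x : R := complex.Re `|x|.

Lemma nrmE x : (nrm x)%:C = `|x|.
Proof. by rewrite /nrm RRe_real ?normr_real. Qed.
Lemma nrm_ge0 x : 0 <= nrm x. Proof. by rewrite -lecR nrmE normr_ge0. Qed.
Lemma nrm0 : nrm 0 = 0. Proof. by rewrite /nrm normr0. Qed.
Lemma nrm_eq0 x : nrm x = 0 -> x = 0.
Proof. by move=> x0; apply/eqP; rewrite -normr_eq0 -nrmE x0. Qed.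
Lemma nrm_gt0 x : x != 0 -> 0 < nrm x.
Proof. by move=> x0; rewrite -ltcR nrmE normr_gt0. Qed.
Lemma nrmN x : nrm (- x) = nrm x. Proof. by rewrite /nrm normrN. Qed.
Lemma nrmB x y : nrm (x - y) = nrm (y - x). Proof. by rewrite /nrm distrC. Qed.
Lemma nrmD x y : nrm (x + y) <= nrm x + nrm y.
Proof. by rewrite -lecR rmorphD /= !nrmE ler_normD. Qed.
Lemma nrmBD x y : nrm (x - y) <= nrm x + nrm y.
Proof. by rewrite (le_trans (nrmD _ _))// nrmN. Qed.
Lemma nrmBB x y z : nrm (x - z) <= nrm (x - y) + nrm (y - z).
Proof. by rewrite -(subrKA y) nrmD. Qed.
Lemma nrmZ a x : nrm (a *: x) = cabs a * nrm x.
Proof. by apply: complexI; rewrite rmorphM /= nrmE cabsE nrmE normrZ. Qed.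
Lemma nrm_sum n (F : 'I_n -> V) : nrm (\sum_i F i) <= \sum_i nrm (F i).
Proof.
elim/big_ind2 : _ => //; first by rewrite nrm0.
by move=> x1 x2 y1 y2 h1 h2; rewrite (le_trans (nrmD _ _))// lerD.
Qed.
Lemma nrm_le0 x : (forall e : R, 0 < e -> nrm x <= e) -> x = 0.
Proof.
move=> h; apply: nrm_eq0; apply/eqP; rewrite eq_le nrm_ge0 andbT.
by apply/ler_addgt0Pr => e e0; rewrite add0r h.
Qed.

Definition adherent (A : set V) x :=
  forall e : R, 0 < e -> exists2 a, A a & nrm (x - a) < e.

Lemma closed_adherentP (A : set V) : closed A <-> forall x, adherent A x -> A x.
Proof.
split=> [cA x xA|h].
- apply: cA => B /nbhs_ballP[e e0 eB].
  have er : (complex.Re e)%:C = e by rewrite RRe_real// realE ltW.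
  have [|a Aa xa] := xA (complex.Re e); first by rewrite -ltcR er.
  exists a; split => //; apply: eB; rewrite -ball_normE /ball_/=.
  by rewrite -nrmE -er ltcR.
- move=> x clx; apply: h => e e0.
  have := clx (ball x e%:C); case; first by apply: nbhsx_ballx; rewrite ltcR.
  move=> a [Aa]; rewrite -ball_normE /ball_/= -nrmE ltcR => xa.
  by exists a.
Qed.

End RealNorm.

Lemma half_pow_lt (R : realType) (C e : R) : 0 < e -> exists n, C * 2^-1 ^+ n < e.
Proof.
move=> e0; have := @cvg_geometric R C (2^-1); rewrite ger0_norm// invf_lt1// ltr1n => /(_ isT).
move=> /cvgrPdist_lt/(_ _ e0)[N _ h]; exists N.
by have := h N (leqnn _); rewrite sub0r normrN => /(le_lt_trans (ler_norm _)).
Qed.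

Section Completeness.
Context (R : realType).

Lemma geometric_sum_bound (K : numFieldType) (V : normedModType K) (u : nat -> V)
    (C : K) : 0 <= C -> (forall k, `|u k| <= C * 2^-1 ^+ k) ->
  forall n m, `|\sum_(k < n + m) u k - \sum_(k < n) u k| <= C * 2 * 2^-1 ^+ n.
Proof.
move=> C0 h n m.
suff : `|\sum_(k < n + m) u k - \sum_(k < n) u k| <=
    C * 2 * (2^-1 ^+ n - 2^-1 ^+ (n + m)).
  move=> /le_trans; apply; rewrite ler_wpM2l ?mulr_ge0// gerBl exprn_ge0//.
elim: m => [|m IH]; first by rewrite addn0 !subrr normr0 mulr0.
rewrite addnS big_ord_recr/= -addrAC (le_trans (ler_normD _ _))//.
apply: le_trans (lerD IH (h _)) _.
rewrite exprS le_eqVlt; apply/orP; left; apply/eqP.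
by rewrite !mulrBr -!mulrA (mulrA 2 2^-1) mulfV ?pnatr_eq0//; ring.
Qed.

                                                                         
                                                                   
Lemma complete_series (V : completeNormedModType R[i]) (u : nat -> V) (C : R) :
  (forall k, nrm (u k) <= C * 2^-1 ^+ k) ->
  exists s, forall n, nrm (s - \sum_(k < n) u k) <= C * 2 * 2^-1 ^+ n.
Proof.
move=> h.
have C0 : 0 <= C by have := h 0; rewrite expr0 mulr1; exact/le_trans/nrm_ge0.
have C0' : 0 <= C%:C by rewrite lecR.
have hb : forall n m, nrm (\sum_(k < n + m) u k - \sum_(k < n) u k) <= C * 2 * 2^-1 ^+ n.
  move=> n m; rewrite -lecR nrmE.
  have := geometric_sum_bound (u := u) C0' => /(_ _ n m) hh.
  rewrite !rmorphM/= rmorphXn/= fmorphV/= !rmorph_nat.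
  apply: hh => k; rewrite -nrmE; have := h k; rewrite -lecR.
  by rewrite !rmorphM/= rmorphXn/= fmorphV/= rmorph_nat.
pose S n : V := \sum_(k < n) u k.
have : cvg (S @ \oo).
  apply: cauchy_cvg; apply: cauchy_exP => e e0.
  have er : (complex.Re e)%:C = e by rewrite RRe_real// realE ltW.
  have [|N hN] := @half_pow_lt R (C * 2) (complex.Re e); first by rewrite -ltcR er.
  exists (S N); exists N => //= n /= Nn; rewrite -ball_normE /ball_/=.
  rewrite -nrmE -er ltcR nrmB; apply: le_lt_trans hN.
  by rewrite -(subnKC Nn) hb.
move=> /cvg_ex[s /cvgrPdist_lt Ss]; exists s => n.
apply/ler_addgt0Pr => e e0; have [|N _ hN] := Ss e%:C; first by rewrite ltcR.
have := hN (N + n)%N (leq_addr _ _); rewrite -nrmE ltcR => h1.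
rewrite [leRHS]addrC; apply: le_trans (nrmBB _ (S (N + n)%N) _) _.
by apply: lerD; [exact: ltW|rewrite addnC hb].
Qed.

Lemma complete_series_complex (z : nat -> R[i]) (C : R) :
  (forall k, cabs (z k) <= C * 2^-1 ^+ k) ->
  exists s, forall n, cabs (s - \sum_(k < n) z k) <= C * 4 * 2^-1 ^+ n.
Proof.
move=> h.
have real_series (u : nat -> R) : (forall k, `|u k| <= C * 2^-1 ^+ k) ->
    exists s, forall n, `|s - \sum_(k < n) u k| <= C * 2 * 2^-1 ^+ n.
  move=> hu.
  have C0 : 0 <= C by have := hu 0; rewrite expr0 mulr1; exact/le_trans.
  have hb := @geometric_sum_bound R R^o u C C0 hu.
  pose S n : R^o := \sum_(k < n) u k.
  have : cvg (S @ \oo).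
    apply: cauchy_cvg; apply: cauchy_exP => e e0.
    have [N hN] := @half_pow_lt R (C * 2) e e0.
    exists (S N); exists N => //= n /= Nn; rewrite -ball_normE /ball_/=.
    by rewrite distrC; apply: le_lt_trans hN; rewrite -(subnKC Nn) hb.
  move=> /cvg_ex[s /cvgrPdist_lt Ss]; exists s => n.
  apply/ler_addgt0Pr => e e0; have [//|N _ hN] := Ss e.
  have h1 := hN (N + n)%N (leq_addr _ _).
  rewrite [leRHS]addrC; apply: le_trans (ler_distD (S (N + n)%N) _ _) _.
  by apply: lerD; [exact: ltW|rewrite addnC; exact: hb].
have [a ha] := real_series (fun k => complex.Re (z k))
  (fun k => le_trans (cabs_ge_Re _) (h k)).
have [b hb] := real_series (fun k => complex.Im (z k))
  (fun k => le_trans (cabs_ge_Im _) (h k)).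
exists (a +i* b) => n; rewrite (le_trans (cabs_le_ReIm _))//.
have -> : C * 4 * 2^-1 ^+ n = C * 2 * 2^-1 ^+ n + C * 2 * 2^-1 ^+ n by ring.
rewrite lerD//; [apply: le_trans (ha n)|apply: le_trans (hb n)].
- by rewrite raddfB/= raddf_sum.
- by rewrite raddfB/= raddf_sum.
Qed.

End Completeness.

                                             

Section QuotientDimension.
Context (F : fieldType) (V : lmodType F).
Implicit Types (A B C : set V) (x y : V).

Definition linsub A := A 0 /\ forall a x y, A x -> A y -> A (a *: x + y).

Lemma subspace0 A : linsub A -> A 0. Proof. by case. Qed.
Lemma subspaceD A x y : linsub A -> A x -> A y -> A (x + y).
Proof. by move=> [_ h] Ax Ay; have := h 1 x y Ax Ay; rewrite scale1r. Qed.
Lemma subspaceZ A a x : linsub A -> A x -> A (a *: x).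
Proof. by move=> [A0 h] Ax; have := h a x 0 Ax A0; rewrite addr0. Qed.
Lemma subspaceN A x : linsub A -> A x -> A (- x).
Proof. by move=> sA Ax; rewrite -scaleN1r; exact: subspaceZ. Qed.
Lemma subspaceB A x y : linsub A -> A x -> A y -> A (x - y).
Proof. by move=> sA Ax Ay; apply: subspaceD => //; exact: subspaceN. Qed.
Lemma subspace_addr A x y : linsub A -> A y -> A (x + y) -> A x.
Proof. by move=> sA Ay /(subspaceB sA)/(_ Ay); rewrite addrK. Qed.
Lemma subspace_scaler A a x : linsub A -> a != 0 -> A (a *: x) -> A x.
Proof. by move=> sA a0 /(subspaceZ a^-1 sA); rewrite scalerA mulVf// scale1r. Qed.
Lemma subspace_sum A (I : finType) (v : I -> V) :
  linsub A -> (forall i, A (v i)) -> A (\sum_i v i).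
Proof.
move=> sA Av; elim/big_ind : _ => //; first exact: subspace0.
by move=> x y; exact: subspaceD.
Qed.
Lemma subspace_comb A (I : finType) (c : I -> F) (v : I -> V) :
  linsub A -> (forall i, A (v i)) -> A (\sum_i c i *: v i).
Proof. by move=> sA Av; apply: subspace_sum => // i; exact: subspaceZ. Qed.
Lemma subspace_set0 : linsub [set 0].
Proof. by split=> // a x y /= -> ->; rewrite scaler0 addr0. Qed.
Lemma subspaceI A B : linsub A -> linsub B -> linsub (A `&` B).
Proof.
move=> [A0 hA] [B0 hB]; split=> // a x y [? ?] [? ?].
by split; [exact: hA|exact: hB].
Qed.

Definition sum_set A B : set V := [set x | exists2 a, A a & B (x - a)].

Lemma subspace_sum_set A B : linsub A -> linsub B -> linsub (sum_set A B).
Proof.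
move=> sA sB; split; first by exists 0; [exact: sA.1|rewrite subr0; exact: sB.1].
move=> c x y [a Aa Bx] [a' Aa' By]; exists (c *: a + a'); first exact: sA.2.
have -> : c *: x + y - (c *: a + a') = c *: (x - a) + (y - a').
  by rewrite opprD addrACA scalerBr.
exact: sB.2.
Qed.

                                                                        
                                                          
Definition dim_ge A B (m : nat) := exists v : 'I_m -> V, (forall i, A (v i)) /\
  forall c : 'I_m -> F, B (\sum_i c i *: v i) -> forall i, c i = 0.

Definition spanned A B (m : nat) := exists v : 'I_m -> V,
  forall x, A x -> exists c : 'I_m -> F, B (x - \sum_i c i *: v i).

Lemma dim_ge0 A B : dim_ge A B 0.
Proof. by exists (fun=> 0); split=> [|c _] []. Qed.

Lemma dim_geW A B m n : (m <= n)%N -> dim_ge A B n -> dim_ge A B m.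
Proof.
move=> /subnKC <-; elim: (n - m)%N => [|k IH]; first by rewrite addn0.
rewrite addnS => -[v [Av vB]]; apply: IH; exists (v \o lift ord0); split=> [i|c Bc i].
  exact: Av.
have := vB (fun j => oapp c 0 (unlift ord0 j)) _ (lift ord0 i).
rewrite liftK; apply; rewrite big_ord_recl unlift_none /= scale0r add0r.
by under eq_bigr do rewrite liftK /=.
Qed.

Lemma dim_ge_sub A B A' B' m : A `<=` A' -> B' `<=` B -> dim_ge A B m -> dim_ge A' B' m.
Proof. by move=> sA sB [v [Av vB]]; exists v; split=> [i|c /sB]; [exact: sA|exact: vB]. Qed.

                                                                         
                                                          
Lemma dim_ge_spanned A B n m : linsub B -> dim_ge A B n -> spanned A B m -> (n <= m)%N.
Proof.
move=> sB [v [Av vB]] [w hw].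
have /choice[c hc] : forall i, exists c : 'I_m -> F, B (v i - \sum_j c j *: w j).
  by move=> i; exact/hw/Av.
pose M : 'M[F]_(n, m) := \matrix_(i, j) c i j.
rewrite leqNgt; apply/negP => mn.
have : kermx M != 0.
  by rewrite kermx_eq0 /row_free neq_ltn (leq_ltn_trans (rank_leq_col _) mn).
move=> /rowV0Pn[r /sub_kermxP rM r0].
case/negP: r0; apply/eqP/rowP => i; rewrite mxE.
apply: (vB (fun i => r 0 i)).
have -> : \sum_i r 0 i *: v i = \sum_i r 0 i *: (v i - \sum_j c i j *: w j).
  rewrite [RHS](eq_bigr (fun i => r 0 i *: v i - r 0 i *: \sum_j c i j *: w j)); last first.
    by move=> k _; rewrite scalerBr.
  rewrite big_split/= sumrN.
  suff -> : \sum_i r 0 i *: (\sum_j c i j *: w j) = 0 by rewrite subr0.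
  under eq_bigr do rewrite scaler_sumr.
  rewrite exchange_big/= big1// => j _.
  under eq_bigr do rewrite scalerA.
  rewrite -scaler_suml; have := congr1 (fun N : 'rV_m => N 0 j) rM.
  rewrite !mxE => h; rewrite -[X in X *: _]/(\sum_i r 0 i * c i j).
  have -> : \sum_i r 0 i * c i j = 0; last by rewrite scale0r.
  by rewrite -[RHS]h; apply: eq_bigr => k _; rewrite mxE.
by apply: subspace_comb.
Qed.

Lemma dim_ge_basis A B n : linsub B -> dim_ge A B n -> ~ dim_ge A B n.+1 ->
  exists v : 'I_n -> V, [/\ forall i, A (v i),
   forall c : 'I_n -> F, B (\sum_i c i *: v i) -> forall i, c i = 0 &
   forall x, A x -> exists c : 'I_n -> F, B (x - \sum_i c i *: v i)].
Proof.
move=> sB [v [Av vB]] nge; exists v; split=> // x Ax.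
apply: contrapT => nex; apply: nge.
exists (fun i => oapp v x (unlift ord0 i)); split=> [i|c].
  by case: unliftP => [j|] _ //=; exact: Av.
rewrite big_ord_recl unlift_none/=; under eq_bigr do rewrite liftK/=.
have [c0|c0] := eqVneq (c ord0) 0; last first.
  move=> Bc; exfalso; apply: nex; exists (fun i => - (c ord0)^-1 * c (lift ord0 i)).
  apply: (subspace_scaler sB c0); rewrite scalerBr scaler_sumr -sumrN.
  under eq_bigr do rewrite scalerA mulrA mulrN mulfV// mulN1r scaleNr opprK.
  exact: Bc.
rewrite c0 scale0r add0r => /vB h i.
by case: (unliftP ord0 i) => [j|] ->.
Qed.

Lemma not_dim_ge_basis A B n : linsub B -> ~ dim_ge A B n -> exists2 m, (m < n)%N &
   dim_ge A B m /\ ~ dim_ge A B m.+1.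
Proof.
elim: n => [sB []|n IH sB h]; first exact: dim_ge0.
have [hn|/(IH sB)[m mn hm]] := pselect (dim_ge A B n); first by exists n.
by exists m => //; exact: ltnW.
Qed.

Lemma not_dim_ge_spanned A B n : linsub B -> ~ dim_ge A B n ->
  exists2 m, (m < n)%N & spanned A B m.
Proof.
move=> sB /(not_dim_ge_basis sB)[m mn [hm hm']]; exists m => //.
by have [v [_ _ hv]] := dim_ge_basis sB hm hm'; exists v.
Qed.

Lemma dim_ge_cons A B C m x : linsub B -> C `<=` B -> B `<=` A -> A x -> ~ B x ->
  dim_ge B C m -> dim_ge A C m.+1.
Proof.
move=> sB CB BA Ax nBx [v [Bv vC]]; exists (fun i => oapp v x (unlift ord0 i)).
split=> [i|c].
  by case: unliftP => [j|] _ //=; exact/BA/Bv.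
rewrite big_ord_recl unlift_none/=; under eq_bigr do rewrite liftK/=.
have [c0|c0] := eqVneq (c ord0) 0; last first.
  by move=> /CB/(subspace_addr sB (subspace_comb _ sB Bv))/(subspace_scaler sB c0).
rewrite c0 scale0r add0r => /vC h i.
by case: (unliftP ord0 i) => [j|] ->.
Qed.

Lemma dim_ge_cat A B C m k : linsub B -> B `<=` A -> C `<=` B ->
  dim_ge A B m -> dim_ge B C k -> dim_ge A C (m + k).
Proof.
move=> sB BA CB [v [Av vB]] [w [Bw wC]].
exists (fun i : 'I_(_ + _) => match fintype.split i with inl j => v j | inr j => w j end).
split=> [i|c].
  by case: fintype.split => j; [exact: Av|exact/BA/Bw].
rewrite big_split_ord/=.
under eq_bigr do rewrite -[lshift _ _]/(unsplit (inl _)) unsplitK.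
under [X in _ + X]eq_bigr do rewrite -[rshift _ _]/(unsplit (inr _)) unsplitK.
move=> h; have cl : forall j, c (lshift k j) = 0.
  apply: (vB (fun j => c (lshift k j))).
  exact: (subspace_addr sB (subspace_comb (fun j => c (rshift m j)) sB Bw) (CB _ h)).
move: h; rewrite big1 ?add0r => [h|j _]; last by rewrite cl scale0r.
have cr := wC (fun j => c (rshift m j)) h.
by move=> i; rewrite -(splitK i); case: (fintype.split i) => j; [exact: cl|exact: cr].
Qed.

Lemma spanned_cat A B C p q : linsub C -> spanned A B p -> spanned B C q ->
  spanned A C (p + q).
Proof.
move=> sC [v hv] [w hw].
exists (fun i : 'I_(_ + _) =>
  match fintype.split i with inl j => v j | inr j => w j end) => x Ax.
have [c Bc] := hv x Ax; have [c' Cc] := hw _ Bc.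
exists (fun i : 'I_(_ + _) => match fintype.split i with inl j => c j | inr j => c' j end).
rewrite big_split_ord/= opprD addrA.
under eq_bigr do rewrite -[lshift _ _]/(unsplit (inl _)) unsplitK.
under [X in _ - X]eq_bigr do rewrite -[rshift _ _]/(unsplit (inr _)) unsplitK.
exact: Cc.
Qed.

                                                                                
                              
Lemma dim_ge_subl A B C m k : linsub B -> linsub C ->
  dim_ge A C (m + k) -> spanned A B k -> dim_ge B C m.
Proof.
move=> sB sC hA hAB; apply: contrapT => /(not_dim_ge_spanned sC)[p pm hBC].
have := dim_ge_spanned sC hA (spanned_cat sC hAB hBC); lia.
Qed.

Lemma dim_ge_subr A B C m k : linsub B -> linsub C ->
  dim_ge A C (m + k) -> spanned B C k -> dim_ge A B m.
Proof.
move=> sB sC hA hBC; apply: contrapT => /(not_dim_ge_spanned sB)[p pm hAB].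
have := dim_ge_spanned sC hA (spanned_cat sC hAB hBC); lia.
Qed.

Lemma dim_ge1 A B x : linsub B -> A x -> ~ B x -> dim_ge A B 1.
Proof.
move=> sB Ax nBx; exists (fun=> x); split=> // c; rewrite big_ord1 => Bc i.
rewrite (ord1 i); apply/eqP/negPn/negP => c0; apply: nBx.
exact: subspace_scaler sB c0 Bc.
Qed.

Lemma not_dim_ge1 A B : linsub B -> ~ dim_ge A B 1 <-> A `<=` B.
Proof.
move=> sB; split=> [h x Ax|h [v [Av vB]]].
  by apply: contrapT => nBx; apply: h; exact: dim_ge1 nBx.
have /eqP : (1 : F) = 0 by apply: (vB (fun=> 1) _ ord0); rewrite big_ord1 scale1r; exact/h/Av.
by rewrite oner_eq0.
Qed.

End QuotientDimension.

Section DimensionTransfer.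
Context (F : fieldType) (V W : lmodType F) (f : V -> W).
Hypothesis lf : linear f.
Variables (A B : set V) (A' B' : set W).

Lemma linear_comb n (c : 'I_n -> F) (v : 'I_n -> V) :
  f (\sum_i c i *: v i) = \sum_i c i *: f (v i).
Proof.
elim: n c v => [|n IH] c v; last by rewrite !big_ord_recl lf IH.
have := lf (-1) 0 0; rewrite !big_ord0 scaler0 addr0 scaleN1r addNr.
by [].
Qed.

Lemma dim_ge_image m : linsub A -> (forall x, A x -> A' (f x)) ->
  (forall x, A x -> B' (f x) -> B x) -> dim_ge A B m -> dim_ge A' B' m.
Proof.
move=> sA fA fB [v [Av vB]]; exists (f \o v); split=> [i|c /=]; first exact/fA/Av.
by rewrite -linear_comb => /fB h; apply/vB/h; exact: subspace_comb.
Qed.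

Lemma dim_ge_preimage m : linsub A -> linsub B' ->
  (forall y, A' y -> exists2 x, A x & B' (y - f x)) ->
  (forall x, A x -> B x -> B' (f x)) -> dim_ge A' B' m -> dim_ge A B m.
Proof.
move=> sA sB' fA fB [w [Aw wB]].
have /choice[v hv] : forall i, exists x, A x /\ B' (w i - f x).
  by move=> i; have [x ? ?] := fA _ (Aw i); exists x.
exists v; split=> [i|c Bc]; first exact: (hv i).1.
have /fB/(_ Bc) : A (\sum_i c i *: v i) by apply: subspace_comb => // i; exact: (hv i).1.
rewrite linear_comb => fc; apply: wB.
suff : B' (\sum_i c i *: w i - \sum_i c i *: f (v i)).
  by move=> /(subspaceD sB')/(_ fc); rewrite subrK.
rewrite -sumrB; under eq_bigr do rewrite -scalerBr.
by apply: subspace_comb => // i; exact: (hv i).2.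
Qed.

Lemma dim_ge_iso m : linsub A -> linsub B' ->
  (forall x, A x -> A' (f x)) -> (forall x, A x -> B' (f x) <-> B x) ->
  (forall y, A' y -> exists2 x, A x & B' (y - f x)) ->
  dim_ge A B m <-> dim_ge A' B' m.
Proof.
move=> sA sB fA fB fs; split; [apply: dim_ge_image|apply: dim_ge_preimage] => //.
- by move=> x Ax; rewrite fB.
- by move=> x Ax; rewrite fB.
Qed.

End DimensionTransfer.

Section QuotDim.
Context (R : realType) (Y : completeNormedModType R[i]).
Implicit Types (A B : set Y).

Lemma quot_basis_dim A B n : linsub B -> (exists v : 'I_n -> Y, quot_basis A B v) <->
  dim_ge A B n /\ ~ dim_ge A B n.+1.
Proof.
move=> sB; split=> [[v [Av vB vs]]|[h h']]; last exact: dim_ge_basis.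
split; first by exists v.
by move=> /(dim_ge_spanned sB) => /(_ n)/(_ (ex_intro _ v vs)); rewrite ltnn.
Qed.

Lemma quot_dim_nat A B n : linsub B -> dim_ge A B n -> ~ dim_ge A B n.+1 ->
  quot_dim A B = n%:R%:E.
Proof.
move=> sB h h'; rewrite /quot_dim /infn.
suff -> : [set n0 | exists v : 'I_n0 -> Y, quot_basis A B v] = [set n].
  by rewrite image_set1 ereal_inf1.
apply/seteqP; split=> m /=; last by move=> ->; exact/quot_basis_dim.
move=> /(quot_basis_dim _ _ sB)[hm hm']; apply/eqP; rewrite eqn_leq.
apply/andP; split; rewrite leqNgt; apply/negP => mn.
- by apply: h'; exact: dim_geW hm.
- by apply: hm'; exact: dim_geW h.
Qed.

Lemma quot_dim_pinfty A B : linsub B -> (forall n, dim_ge A B n) -> quot_dim A B = +oo%E.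
Proof.
move=> sB h; rewrite /quot_dim /infn.
rewrite (_ : [set n0 | _] = set0) ?image_set0 ?ereal_inf0//.
by apply/seteqP; split=> m //= /(quot_basis_dim _ _ sB)[_]; apply.
Qed.

                                                                              
                     
Lemma quot_dimP A B : linsub B ->
  (quot_dim A B = +oo%E /\ forall n, dim_ge A B n) \/
  exists n, quot_dim A B = n%:R%:E /\ forall m, dim_ge A B m <-> (m <= n)%N.
Proof.
move=> sB; have [h|] := pselect (forall n, dim_ge A B n).
  by left; split=> //; exact: quot_dim_pinfty.
move=> /existsNP[n /(not_dim_ge_basis sB)[m mn [h h']]]; right; exists m.
split; first exact: quot_dim_nat.
move=> p; split=> [hp|pm]; last exact: dim_geW h.
by rewrite leqNgt; apply/negP => mp; apply: h'; exact: dim_geW hp.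
Qed.

Lemma quot_dim_lty A B : linsub B ->
  (quot_dim A B < +oo)%E <-> exists n, ~ dim_ge A B n.
Proof.
move=> sB; have [[-> h]|[n [-> h]]] := quot_dimP A sB.
  by rewrite ltxx; split=> // -[n]; exact.
by rewrite ltry; split=> // _; exists n.+1; rewrite h ltnn.
Qed.

Lemma quot_dim_eq0 A B : linsub B -> quot_dim A B = 0%E <-> A `<=` B.
Proof.
move=> sB; rewrite -(not_dim_ge1 _ sB).
have [[-> h]|[n [-> h]]] := quot_dimP A sB; first by split=> // /(_ (h 1)).
rewrite h; case: n {h} => [|n]; last first.
  by split=> [/eqP|//]; rewrite eqe pnatr_eq0.
by split=> // _; rewrite ltnn.
Qed.

End QuotDim.

Section QuotDimCompare.
Context (R : realType) (Y Z : completeNormedModType R[i]).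
Variables (A B : set Y) (A' B' : set Z).
Hypotheses (sB : linsub B) (sB' : linsub B').

Lemma quot_dim_sub_le0 : (quot_dim A B < +oo)%E ->
  (quot_dim A B - quot_dim A' B' <= 0)%E <-> (forall m, dim_ge A B m -> dim_ge A' B' m).
Proof.
have [[-> h]|[n [-> h]]] := quot_dimP A sB; first by rewrite ltxx.
move=> _; have [[-> h']|[n' [-> h']]] := quot_dimP A' sB'.
  by rewrite addeNy ?leNye; split.
rewrite lee_fin subr_le0 ler_nat; split=> [nn m|/(_ n)]; rewrite h h'; last exact.
by move=> /leq_trans; exact.
Qed.

Lemma quot_dim_sub_ge0 : (quot_dim A' B' < +oo)%E ->
  (0 <= quot_dim A B - quot_dim A' B')%E <-> (forall m, dim_ge A' B' m -> dim_ge A B m).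
Proof.
have [[-> h]|[n [-> h]]] := quot_dimP A' sB'; first by rewrite ltxx.
move=> _; have [[-> h']|[n' [-> h']]] := quot_dimP A sB; first by rewrite addye ?leey; split.
rewrite lee_fin subr_ge0 ler_nat; split=> [nn m|/(_ n)]; rewrite h h'; last exact.
by move=> /leq_trans; exact.
Qed.

End QuotDimCompare.

                                                                 

Section ClosedSubspaces.
Context (R : realType) (V : normedModType R[i]).
Implicit Types (A B : set V) (x y z : V).

Lemma closed_dist_gt0 B x : closed B -> ~ B x ->
  exists2 d : R, 0 < d & forall b, B b -> d <= nrm (x - b).
Proof.
move=> /closed_adherentP cB nBx; apply: contrapT => h; apply: nBx; apply: cB => e e0.
apply: contrapT => h'; apply: h; exists e => // b Bb; rewrite leNgt; apply/negP => be.
by apply: h'; exists b.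
Qed.

Definition adjoin B x := [set y | exists c, B (y - c *: x)].

Lemma subspace_adjoin B x : linsub B -> linsub (adjoin B x).
Proof.
move=> sB; split; first by exists 0; rewrite scale0r subr0; exact: sB.1.
move=> a y z [c yc] [c' zc]; exists (a * c + c').
have -> : a *: y + z - (a * c + c') *: x = a *: (y - c *: x) + (z - c' *: x).
  by rewrite scalerDl opprD addrACA scalerBr scalerA.
exact: sB.2.
Qed.

Lemma sub_adjoin B x : B `<=` adjoin B x.
Proof. by move=> y By; exists 0; rewrite scale0r subr0. Qed.

Lemma dist_scale B x (d : R) : linsub B -> (forall b, B b -> d <= nrm (x - b)) ->
  0 <= d -> forall c b, B b -> d * cabs c <= nrm (c *: x - b).
Proof.
move=> sB h d0 c b Bb; have [->|c0] := eqVneq c 0.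
  by rewrite cabs0 mulr0 nrm_ge0.
have -> : c *: x - b = c *: (x - c^-1 *: b).
  by rewrite scalerBr scalerA divff// scale1r.
rewrite nrmZ mulrC ler_wpM2l ?cabs_ge0// h//; exact: subspaceZ.
Qed.

                                                                               
                                                                                   
                
Lemma closed_adjoin B x : linsub B -> closed B -> closed (adjoin B x).
Proof.
move=> sB cB; have [Bx|nBx] := pselect (B x).
  suff -> : adjoin B x = B by [].
  apply/seteqP; split; last exact: sub_adjoin.
  by move=> y [c] /(subspaceD sB)/(_ (subspaceZ c sB Bx)); rewrite subrK.
have [d d0 hd] := closed_dist_gt0 cB nBx.
apply/closed_adherentP => z zA.
have /choice[yc hyc] : forall k : nat, exists yc : V * R[i], B (yc.1 - yc.2 *: x) /\
     nrm (z - yc.1) < 2^-1 ^+ k.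
  move=> k; have [|y [c By] zy] := zA (2^-1 ^+ k); first by rewrite exprn_gt0.
  by exists (y, c).
pose y k := (yc k).1; pose c k := (yc k).2.
have By k : B (y k - c k *: x) by exact: (hyc k).1.
have zy k : nrm (z - y k) < 2^-1 ^+ k by exact: (hyc k).2.
have ck k : cabs (c k.+1 - c k) <= 2 / d * 2^-1 ^+ k.
  have := dist_scale sB hd (ltW d0) (c k.+1 - c k) (subspaceB sB (By k) (By k.+1)).
  have -> : (c k.+1 - c k) *: x - (y k - c k *: x - (y k.+1 - c k.+1 *: x)) = y k.+1 - y k.
    by rewrite scalerBl; abelian_group.
  rewrite mulrAC ler_pdivlMr// mulrC => /le_trans; apply.
  apply: le_trans (nrmBB _ z _) _; rewrite (nrmB _ z).
  apply: le_trans (lerD (ltW (zy _)) (ltW (zy _))) _.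
  rewrite exprS; have : 0 <= 2^-1 ^+ k :> R by rewrite exprn_ge0.
  lra.
have [s hs] := complete_series_complex ck.
exists (s + c 0); move/closed_adherentP : cB; apply => e e0.
have [n hn] := half_pow_lt (1 + 2 / d * 4 * nrm x) e0.
exists (y n - c n *: x) => //; apply: le_lt_trans hn.
have -> : z - (s + c 0) *: x - (y n - c n *: x) = z - y n - (s - (c n - c 0)) *: x.
  by rewrite !scalerBl scalerDl; abelian_group.
rewrite (le_trans (nrmBD _ _))// mulrDl mul1r lerD ?(ltW (zy _))//.
rewrite nrmZ mulrAC ler_wpM2r ?nrm_ge0//.
by have := hs n; rewrite -(big_mkord xpredT (fun i => c i.+1 - c i)) telescope_sumr.
Qed.

Lemma closed_span B n (v : 'I_n -> V) : linsub B -> closed B ->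
  closed [set x | exists c : 'I_n -> R[i], B (x - \sum_i c i *: v i)].
Proof.
elim: n B v => [|n IH] B v sB cB.
  suff -> : [set x | exists c : 'I_0 -> R[i], B (x - \sum_i c i *: v i)] = B by [].
  apply/seteqP; split=> x /= => [[c]|]; first by rewrite big_ord0 subr0.
  by exists (fun=> 0); rewrite big_ord0 subr0.
have := IH _ (v \o lift ord0) (subspace_adjoin (v ord0) sB) (closed_adjoin (x := v ord0) sB cB).
congr closed; apply/seteqP; split=> x /= [].
- move=> c [a h]; exists (fun i => oapp c a (unlift ord0 i)).
  rewrite big_ord_recl unlift_none/=; under eq_bigr do rewrite liftK/=.
  by rewrite opprD addrCA addrC.
- move=> c; rewrite big_ord_recl => h; exists (c \o lift ord0); exists (c ord0).
  by rewrite -addrA -opprD addrC [X in - X]addrC addrC.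
Qed.

Lemma closed_findim_ext A B n : linsub A -> linsub B -> closed B -> B `<=` A ->
  ~ dim_ge A B n -> closed A.
Proof.
move=> sA sB cB BA /(not_dim_ge_basis sB)[m _ [h h']].
have [v [Av _ vs]] := dim_ge_basis sB h h'.
have := closed_span (v := v) sB cB; congr closed; apply/seteqP; split=> [x [c /BA]|x /vs//].
move=> /(subspaceD sA)/(_ (subspace_comb c sA Av)).
by rewrite subrK.
Qed.

Lemma closed_set0 : closed [set (0 : V)].
Proof.
apply/closed_adherentP => x h; apply: nrm_le0 => e /h[_ -> ].
by rewrite subr0 => /ltW.
Qed.

Lemma closed_findim A n : linsub A -> ~ dim_ge A [set 0] n -> closed A.
Proof.
move=> sA; apply: (closed_findim_ext sA (@subspace_set0 _ _) closed_set0).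
by move=> _ ->; exact: sA.1.
Qed.

                                                                                   
                                                  
Lemma riesz A B x : linsub A -> linsub B -> closed B -> B `<=` A -> A x -> ~ B x ->
  exists2 u, A u /\ nrm u <= 1 & forall c b, B b -> cabs c <= 2 * nrm (c *: u - b).
Proof.
move=> sA sB cB BA Ax nBx; have [d d0 hd] := closed_dist_gt0 cB nBx.
pose E := [set nrm (x - b) | b in B].
have iE : has_inf E.
  split; first by exists (nrm (x - 0)); exists 0 => //; exact: sB.1.
  by exists d => _ [b Bb <-]; exact: hd.
have infd : d <= inf E by apply: lb_le_inf; [exact: iE.1|move=> _ [b Bb <-]; exact: hd].
have i0 : 0 < inf E by exact: lt_le_trans infd.
have [_ [b0 Bb0 <-] hb0] := inf_adherent i0 iE.
have hb b : B b -> inf E <= nrm (x - b) by move=> Bb; apply: (inf_lbound iE.2); exists b.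
set r := nrm (x - b0) in hb0; have r0 : 0 < r by apply: lt_le_trans i0 (hb _ Bb0).
have r2 : r <= 2 * inf E by rewrite mulr_natl mulr2n ltW.
have rV0 : 0 <= r^-1 by rewrite invr_ge0 ltW.
exists (r^-1%:C *: (x - b0)).
  split; first by apply: subspaceZ => //; apply: subspaceB => //; exact: BA.
  by rewrite nrmZ cabs_real// -/r mulVf ?gt_eqF.
move=> c b Bb; rewrite -ler_pdivrMl//.
have h b' : B b' -> 2^-1 <= nrm (r^-1%:C *: (x - b0) - b').
  move=> Bb'; have -> : r^-1%:C *: (x - b0) - b' = r^-1%:C *: (x - (b0 + r%:C *: b')).
    rewrite [in RHS]opprD addrA [RHS]scalerBr scalerA -rmorphM/= mulVf ?gt_eqF//.
    by rewrite scale1r.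
  rewrite nrmZ cabs_real// mulrC ler_pdivlMr// ler_pdivrMl//.
  by rewrite (le_trans r2)// ler_pM2l// hb//; apply: subspaceD => //; exact: subspaceZ.
exact: dist_scale sB h _ c b Bb.
Qed.

Fixpoint riesz_const (m : nat) : R := if m is n.+1 then
  Num.min (riesz_const n) (2 * (1 + n%:R / riesz_const n))^-1 else 1.

Lemma riesz_const_gt0 m : 0 < riesz_const m.
Proof.
elim: m => //= m IH; rewrite lt_min IH/= invr_gt0 mulr_gt0// ltr_wpDr//.
by rewrite divr_ge0// ltW.
Qed.

                                                                                  
                                                                        
Lemma riesz_family m A B : linsub A -> linsub B -> closed B -> B `<=` A -> dim_ge A B m ->
  exists2 x : 'I_m -> V, (forall i, A (x i) /\ nrm (x i) <= 1) &
    forall c b, B b -> forall i, riesz_const m * cabs (c i) <= nrm (\sum_i c i *: x i - b).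
Proof.
elim: m B => [|m IH] B sA sB cB BA hAB.
  by exists (fun=> 0) => [[]|c b _ []].
have [x Ax nBx] : exists2 x, A x & ~ B x.
  apply: contrapT => h; have : dim_ge A B 1 by exact: dim_geW hAB.
  move=> /(not_dim_ge1 A sB).2; apply => x Ax; apply: contrapT => nBx; apply: h; by exists x.
have [u [Au u1] hu] := riesz sA sB cB BA Ax nBx.
have sB1 := subspace_adjoin u sB.
have [||w Aw hw] := IH (adjoin B u) sA sB1 (closed_adjoin (x := u) sB cB).
- move=> y [c /BA] /(subspaceD sA)/(_ (subspaceZ c sA Au)).
  by rewrite subrK.
- apply: (@dim_ge_subr _ _ A _ B m 1); rewrite ?addn1//.
  by exists (fun=> u) => y [c h]; exists (fun=> c); rewrite big_ord1.
exists (fun i => oapp w u (unlift ord0 i)) => [i|c b Bb].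
  by case: unliftP => [j|] _ //=; exact: Aw.
rewrite big_ord_recl unlift_none/=; under eq_bigr do rewrite liftK/=.
set s := \sum_i _; set N := nrm _; set r := riesz_const m.
have r0 : 0 < r by exact: riesz_const_gt0.
have hN i : r * cabs (c (lift ord0 i)) <= N.
  have := hw (fun i => c (lift ord0 i)) (b - c ord0 *: u) _ i.
  rewrite opprB addrCA -/s => h; rewrite /N -addrA; apply: h.
  by exists (- c ord0); rewrite scaleNr opprK subrK.
have h0 : cabs (c ord0) <= 2 * (1 + m%:R / r) * N.
  apply: le_trans (hu _ _ Bb) _; rewrite -mulrA ler_pM2l//.
  have -> : c ord0 *: u - b = (c ord0 *: u + s - b) - s by rewrite addrAC addrK.
  apply: le_trans (nrmBD _ _) _; rewrite mulrDl mul1r lerD//.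
  apply: le_trans (nrm_sum _) _.
  apply: (@le_trans _ _ (\sum_(i < m) (N / r))); last first.
    by rewrite sumr_const card_ord -[leLHS]mulr_natl; lra.
  apply: ler_sum => i _; rewrite nrmZ ler_pdivlMr// mulrC.
  apply: le_trans (hN i); rewrite ler_pM2l// -[leRHS]mulr1 ler_wpM2l ?cabs_ge0//.
  exact: (Aw i).2.
have q0 : 0 < 2 * (1 + m%:R / r) by rewrite mulr_gt0// ltr_wpDr// divr_ge0// ltW.
move=> i; case: (unliftP ord0 i) => [j|] ->.
- apply: le_trans (hN j); rewrite ler_wpM2r ?cabs_ge0//= ge_min lexx//.
- apply: le_trans (_ : (2 * (1 + m%:R / r))^-1 * cabs (c ord0) <= _).
    by rewrite ler_wpM2r ?cabs_ge0//= ge_min lexx orbT.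
  by rewrite ler_pdivrMl.
Qed.

                                                                            
                                                                                  
                                                                               
                                             
Lemma gap_dim_ge (A B A' B' : set V) m (t : R) : linsub A -> linsub B -> closed B ->
  B `<=` A -> 0 <= t <= 1 -> 3 * m%:R * t < riesz_const m ->
  (forall x, A x -> exists2 x', A' x' & nrm (x - x') <= t * nrm x) ->
  (forall y, B' y -> exists2 y', B y' & nrm (y - y') <= t * nrm y) ->
  dim_ge A B m -> dim_ge A' B' m.
Proof.
move=> sA sB cB BA /andP[t0 t1] tm hA hB /(riesz_family sA sB cB BA)[x Ax hx].
have /choice[f hf] : forall i, exists f, A' f /\ nrm (x i - f) <= t.
  move=> i; have [f Af h] := hA _ (Ax i).1; exists f; split => //.
  apply: le_trans h _; rewrite -[leRHS]mulr1 ler_wpM2l//; exact: (Ax i).2.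
exists f; split=> [i|c /hB[b Bb hb]]; first exact: (hf i).1.
pose s := \sum_i cabs (c i).
have s0 : 0 <= s by apply: sumr_ge0 => i _; exact: cabs_ge0.
have xf : nrm (\sum_i c i *: x i - \sum_i c i *: f i) <= t * s.
  rewrite -sumrB; under eq_bigr do rewrite -scalerBr.
  apply: le_trans (nrm_sum _) _; rewrite mulr_sumr; apply: ler_sum => i _.
  by rewrite nrmZ mulrC ler_wpM2r ?cabs_ge0//; exact: (hf i).2.
have xs : nrm (\sum_i c i *: x i) <= s.
  apply: le_trans (nrm_sum _) _; apply: ler_sum => i _; rewrite nrmZ.
  by rewrite -[leRHS]mulr1 ler_wpM2l ?cabs_ge0//; exact: (Ax i).2.
have fs : nrm (\sum_i c i *: f i) <= 2 * s.
  have := nrmD (\sum_i c i *: f i - \sum_i c i *: x i) (\sum_i c i *: x i).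
  rewrite subrK nrmB => /le_trans; apply.
  have : t * s <= s by rewrite ler_piMl.
  lra.
have xb : nrm (\sum_i c i *: x i - b) <= 3 * t * s.
  apply: le_trans (nrmBB _ (\sum_i c i *: f i) _) _.
  have : nrm (\sum_i c i *: f i - b) <= 2 * t * s.
    by apply: le_trans hb _; rewrite mulrAC [leRHS]mulrC ler_wpM2l.
  lra.
have sN : riesz_const m * s <= m%:R * (3 * t * s).
  rewrite mulr_sumr; apply: (@le_trans _ _ (\sum_(i < m) (3 * t * s))).
    by apply: ler_sum => i _; apply: le_trans (hx _ _ Bb i) xb.
  by rewrite sumr_const card_ord [leRHS]mulr_natl.
have s00 : s = 0.
  apply/eqP; rewrite eq_le s0 andbT leNgt; apply/negP => sgt0.
  have : riesz_const m * s <= (3 * m%:R * t) * s by move: sN; lra.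
  by rewrite ler_pM2r// leNgt tm.
move=> i; apply: cabs_eq0; apply/eqP; rewrite eq_le cabs_ge0 andbT -s00 /s.
by rewrite (bigD1 i)//= lerDl sumr_ge0// => j _; exact: cabs_ge0.
Qed.

End ClosedSubspaces.

                              

Section Powers.
Context (R : realType) (Y : completeNormedModType R[i]).
Implicit Types (T : boundedOp Y) (n m : nat) (x y : Y).

Lemma bop_nrm T : exists2 c : R, 0 < c & forall x, nrm (T x) <= c * nrm x.
Proof.
have [c hc] := bop_bounded T; exists (`|c| + 1); first by rewrite ltr_wpDl.
move=> x; apply: (@le_trans _ _ (c * nrm x)).
  by rewrite -lecR rmorphM/= !nrmE.
by rewrite ler_wpM2r ?nrm_ge0// (le_trans (ler_norm c))// lerDl.
Qed.

Lemma iter_linear T n : linear (iter n T).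
Proof. by move=> a x y; elim: n => //= n ->; rewrite linearP. Qed.

Lemma iter_bounded T n : exists c : R, forall x, `|iter n T x| <= c%:C * `|x|.
Proof.
have [c c0 hc] := bop_nrm T; exists (c ^+ n) => x.
rewrite -!nrmE -rmorphM/= lecR; elim: n => /= [|n IH]; first by rewrite expr0 mul1r.
by rewrite (le_trans (hc _))// exprS -mulrA ler_pM2l.
Qed.

Definition opow_fun T n (x : Y) : Y := iter n T x.
HB.instance Definition _ T n := GRing.isLinear.Build _ _ _ _ (opow_fun T n) (iter_linear T n).
Definition opow T n : boundedOp Y := BoundedOp
  (iter_bounded T n : exists c : R, forall x, `|opow_fun T n x| <= c%:C * `|x|).

Lemma opowE T n x : opow T n x = iter n T x. Proof. by []. Qed.

Lemma iterD_lin T n x y : iter n T (x + y) = iter n T x + iter n T y.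
Proof. exact: (linearD (opow T n)). Qed.
Lemma iterB_lin T n x y : iter n T (x - y) = iter n T x - iter n T y.
Proof. exact: (linearB (opow T n)). Qed.
Lemma iter0_lin T n : iter n T 0 = 0.
Proof. exact: (linear0 (opow T n)). Qed.
Lemma iterZ_lin T n a x : iter n T (a *: x) = a *: iter n T x.
Proof. by have := iter_linear T n a x 0; rewrite iter0_lin !addr0. Qed.

Lemma subspace_range (f : boundedOp Y) : linsub (range f).
Proof.
split; first by exists 0 => //; rewrite linear0.
by move=> a _ _ [x _ <-] [y _ <-]; exists (a *: x + y) => //; rewrite linearP.
Qed.
Lemma subspace_null (f : boundedOp Y) : linsub (null_space f).
Proof.
by split; rewrite /null_space/= ?linear0// => a x y fx fy; rewrite linearP fx fy scaler0 addr0.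
Qed.
Lemma subspace_preim (f : boundedOp Y) (A : set Y) : linsub A -> linsub (f @^-1` A).
Proof.
move=> sA; split=> [|a x y fx fy]; rewrite /preimage/= ?linear0 ?linearP.
  exact: sA.1.
exact: sA.2.
Qed.

Definition ran T n : set Y := range (iter n T).
Definition ker T n : set Y := null_space (iter n T).

Lemma subspace_ran T n : linsub (ran T n). Proof. exact: (subspace_range (opow T n)). Qed.
Lemma subspace_ker T n : linsub (ker T n). Proof. exact: (subspace_null (opow T n)). Qed.

Lemma ran0 T : ran T 0 = setT.
Proof. by apply/seteqP; split=> // x _; exists x. Qed.
Lemma ran_iter T n x : ran T n (iter n T x). Proof. by exists x. Qed.
Lemma ranS T n x : ran T n x -> ran T n.+1 (T x).
Proof. by move=> [u _ <-]; exists u. Qed.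
Lemma ranS_inv T n y : ran T n.+1 y -> exists2 x, ran T n x & y = T x.
Proof. by move=> [u _ <-]; exists (iter n T u) => //; exists u. Qed.
Lemma ranW T m n : (m <= n)%N -> ran T n `<=` ran T m.
Proof.
by move=> mn _ [u _ <-]; exists (iter (n - m) T u) => //; rewrite -iterD subnKC.
Qed.
Lemma ran_stable T n x : ran T n x -> ran T n (T x).
Proof. by move=> /ranS; apply: ranW. Qed.
Lemma kerW T m n : (m <= n)%N -> ker T m `<=` ker T n.
Proof.
move=> mn x kx; rewrite /ker /null_space /= -(subnK mn) iterD.
by rewrite (kx : iter m T x = 0) iter0_lin.
Qed.
Lemma iter_ran T m n x : ran T n x -> ran T (m + n) (iter m T x).
Proof. by move=> [u _ <-]; exists u => //; rewrite iterD. Qed.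

Lemma closed_preim (f : boundedOp Y) (A : set Y) : closed A -> closed (f @^-1` A).
Proof.
move=> /closed_adherentP cA; apply/closed_adherentP => x hx; apply: cA => e e0.
have [c c0 hc] := bop_nrm f; have [|a Aa xa] := hx (e / c); first by rewrite divr_gt0.
exists (f a) => //; rewrite -linearB (le_lt_trans (hc _))//.
by rewrite mulrC -ltr_pdivlMr.
Qed.

Lemma closed_null (f : boundedOp Y) : closed (null_space f).
Proof. by have := closed_preim (f := f) (@closed_set0 _ Y). Qed.

End Powers.

                                               

Section OpenMapping.
Context (R : realType) (Y : completeNormedModType R[i]) (f : boundedOp Y) (N : set Y).
Hypotheses (sN : linsub N) (cN : closed N).

Let W := sum_set (range f) N.
Hypothesis cW : closed W.

Let sW : linsub W. Proof. exact/subspace_sum_set/sN/subspace_range. Qed.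

Let K (k : R) (w : Y) := exists x, [/\ N (w - f x), nrm x <= k & nrm (w - f x) <= k].

Let KZ k a w : K k w -> K (cabs a * k) (a *: w).
Proof.
move=> [x [h1 h2 h3]]; exists (a *: x); rewrite linearZ -scalerBr !nrmZ.
by split; [exact: subspaceZ| |]; rewrite ler_wpM2l ?cabs_ge0.
Qed.

Let KB k l w v : K k w -> K l v -> K (k + l) (w - v).
Proof.
move=> [x [h1 h2 h3]] [y [g1 g2 g3]]; exists (x - y).
have -> : w - v - f (x - y) = (w - f x) - (v - f y) by rewrite linearB; abelian_group.
split; first exact: subspaceB.
- by rewrite (le_trans (nrmBD _ _))// lerD.
- by rewrite (le_trans (nrmBD _ _))// lerD.
Qed.

                                                                    
Let baire : exists k w0, exists2 r : R, 0 < r &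
  W w0 /\ forall w, W w -> nrm (w - w0) < r -> adherent (K k) w.
Proof.
apply: contrapT => h.
have step : forall (k : nat) (s : Y * R), exists s' : Y * R, W s.1 -> 0 < s.2 ->
    [/\ W s'.1, 0 < s'.2, s'.2 <= s.2 / 2, nrm (s'.1 - s.1) <= s.2 / 2 &
      forall a, K k%:R a -> s'.2 < nrm (s'.1 - a)].
  move=> k [w r] /=; apply: contrapT => h'; apply: h; exists k%:R, w, (r / 2).
    apply: contrapT => h''; apply: h'; exists (w, r) => _ r0; exfalso; apply: h''.
    by rewrite divr_gt0.
  split.
    by apply: contrapT => h''; apply: h'; exists (w, r).
  move=> v Wv vw e e0; apply: contrapT => nK; apply: h'.
  exists (v, Num.min (r / 2) (e / 2)) => /= Ww r0; split=> //.
  - by rewrite lt_min !divr_gt0.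
  - by rewrite ge_min lexx.
  - exact: ltW.
  - move=> a Ka; rewrite gt_min; apply/orP; right.
    have : e <= nrm (v - a) by rewrite leNgt; apply/negP => ?; apply: nK; exists a.
    by apply: lt_le_trans; rewrite ltr_pdivrMr// mulr_natr mulr2n ltrDl.
have /choice[g hg] : forall ks : nat * (Y * R), exists s', _ := fun ks => step ks.1 ks.2.
pose s := fix s n := if n is m.+1 then g (m, s m) else (0 : Y, 1 : R).
have hs n : W (s n).1 /\ 0 < (s n).2.
  elim: n => [|n [h1 h2]]; first by split=> //=; exact: sW.1.
  by have [? ? _ _ _] := hg (n, s n) h1 h2.
have hsS n := hg (n, s n) (hs n).1 (hs n).2.
have r_le n : (s n).2 <= 2^-1 ^+ n.
  elim: n => [|n IH]; first by rewrite expr0.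
  have [_ _ h1 _ _] := hsS n; rewrite exprS; move: h1 IH; rewrite /=; lra.
have w_le i j : nrm ((s (i + j)%N).1 - (s i).1) <= (s i).2 - (s (i + j)%N).2.
  elim: j => [|j IH]; first by rewrite addn0 !subrr nrm0.
  rewrite addnS; have [_ _ h1 h2 _] := hsS (i + j)%N.
  apply: le_trans (nrmBB _ (s (i + j)%N).1 _) _; move: h1 h2 IH => /=; lra.
have [|l hl] := @complete_series R Y (fun k => (s k.+1).1 - (s k).1) 1.
  by move=> k; rewrite mul1r; have [_ _ _ h2 _] := hsS k; have := r_le k; have := (hs k).2;
   move: h2 => /=; lra.
have lim n : nrm (l - (s n).1) <= 2 * 2^-1 ^+ n.
  have := hl n; rewrite -(big_mkord xpredT (fun k => (s k.+1).1 - (s k).1)).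
  by rewrite telescope_sumr// subr0 mul1r.
have Wl : W l.
  move/closed_adherentP : cW; apply => e e0; have [n hn] := half_pow_lt 2 e0.
  by exists (s n).1; [exact: (hs n).1|exact: le_lt_trans hn].
have ball_l i : nrm ((s i).1 - l) <= (s i).2.
  apply/ler_addgt0Pr => e e0; have [n hn] := half_pow_lt 2 e0.
  apply: le_trans (nrmBB _ (s (i + n)%N).1 _) _; apply: lerD.
    by rewrite nrmB; apply: le_trans (w_le _ _) _; rewrite gerBl ltW// (hs _).2.
  rewrite nrmB; apply: le_trans (lim _) _; apply: le_trans (ltW hn).
  rewrite ler_pM2l// exprD ler_piMl ?exprn_ge0// exprn_ile1//; lra.
have [_ [x _ <-] Nl] := Wl.
pose k := (Num.truncn (nrm x + nrm (l - f x))).+1.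
have kk : nrm x + nrm (l - f x) <= k%:R by exact/ltW/truncnS_gt.
have [_ _ _ _ hK] := hsS k.
have : K k%:R l.
  exists x; split=> //; apply: le_trans kk; rewrite ?lerDl ?lerDr nrm_ge0//.
by move=> /hK; apply/negP; rewrite -leNgt; exact: (ball_l k.+1).
Qed.

                                                                             
                                                              
Let approx : exists2 M : R, 0 < M & forall w, W w -> exists x,
  exists n, [/\ N n, nrm x <= M * nrm w & nrm (w - f x - n) <= nrm w / 2].
Proof.
have [k [w0 [r r0 [Ww0 hr]]]] := baire.
have k0 : 0 <= k.
  have [|a [x [_ ? _]] _] := hr w0 Ww0 _ 1 ltr01; first by rewrite subrr nrm0.
  exact: le_trans (nrm_ge0 x) _.
exists (4 * k / r + 1); first by rewrite ltr_wpDl// divr_ge0 ?mulr_ge0// ltW.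
move=> w Ww; have [->|wn0] := eqVneq w 0.
  by exists 0, 0; rewrite linear0 !subr0 nrm0 mulr0 mul0r; split=> //; exact: sN.1.
have nw := nrm_gt0 wn0.
pose t : R := r / 2 / nrm w.
have t0 : 0 < t by rewrite !divr_gt0.
have ct : cabs t%:C = t by rewrite cabs_real// ltW.
have nt : nrm (t%:C *: w) = r / 2 by rewrite nrmZ ct /t divfK ?gt_eqF.
have e0 : 0 < r / 8 by rewrite divr_gt0.
have [||a Ka ha] := hr (w0 + t%:C *: w) _ _ _ e0.
- by apply: subspaceD => //; exact: subspaceZ.
- by rewrite addrAC subrr add0r nt; lra.
have [|b Kb hb] := hr w0 Ww0 _ _ e0; first by rewrite subrr nrm0.
have [x [h1 h2 h3]] := KZ t^-1%:C (KB Ka Kb).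
have cti : cabs t^-1%:C = t^-1 by rewrite cabs_real// invr_ge0 ltW.
exists x, (t^-1%:C *: (a - b) - f x); split=> //.
- apply: le_trans h2 _; rewrite cti /t !invf_div.
  have -> : nrm w * (2 / r) * (k + k) = 4 * k / r * nrm w by field; rewrite gt_eqF.
  by rewrite ler_wpM2r ?nrm_ge0// lerDl.
- have -> : w - f x - (t^-1%:C *: (a - b) - f x) = t^-1%:C *: (t%:C *: w - (a - b)).
    rewrite [RHS]scalerBr scalerA -rmorphM/= mulVf ?gt_eqF// scale1r; abelian_group.
  rewrite nrmZ cti.
  have -> : t%:C *: w - (a - b) = (w0 + t%:C *: w - a) - (w0 - b) by abelian_group.
  have : nrm (w0 + t%:C *: w - a - (w0 - b)) <= r / 4.
    apply: le_trans (nrmBD _ _) _; lra.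
  rewrite ler_pdivrMl// => /le_trans; apply; rewrite /t.
  suff -> : r / 2 / nrm w * (nrm w / 2) = r / 4 by [].
  by field; rewrite gt_eqF.
Qed.

                                                                             
                 
Lemma open_mapping : exists2 C : R, 0 < C & forall w, W w -> exists x,
  [/\ N (w - f x), nrm x <= C * nrm w & nrm (w - f x) <= C * nrm w].
Proof.
have [M M0 hM] := approx; have [c c0 hc] := bop_nrm f.
have /choice[g hg] : forall w, exists p : Y * Y, W w -> [/\ N p.2, nrm p.1 <= M * nrm w &
    nrm (w - f p.1 - p.2) <= nrm w / 2].
  move=> w; have [/hM[x [n h]]|nW] := pselect (W w); first by exists (x, n).
  by exists (0, 0).
exists (2 * M + (1 + c * (2 * M))).
  by rewrite addr_gt0 ?mulr_gt0// addr_gt0 ?mulr_gt0.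
move=> w Ww; pose u := fix u n := if n is m.+1 then u m - f (g (u m)).1 - (g (u m)).2 else w.
have Wu n : W (u n).
  elim: n => [//|n IH] /=; have [h1 _ _] := hg _ IH.
  rewrite -addrA -opprD; apply: subspaceB => //.
  exists (f (g (u n)).1); first by exists (g (u n)).1.
  by rewrite addrAC subrr add0r.
have nu n : nrm (u n) <= nrm w * 2^-1 ^+ n.
  elim: n => [|n IH]; first by rewrite expr0 mulr1.
  have [_ _ h] := hg _ (Wu n); rewrite /= (le_trans h)// exprS; move: IH; lra.
have [|s hs] := @complete_series R Y (fun n => (g (u n)).1) (M * nrm w).
  move=> n; have [_ h _] := hg _ (Wu n); rewrite (le_trans h)// -mulrA ler_pM2l//.
have partial n : exists2 b, N b & w - f (\sum_(k < n) (g (u k)).1) - b = u n.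
  elim: n => [|n [b Nb e]].
    by exists 0; [exact: sN.1|rewrite big_ord0 linear0 !subr0].
  have [h1 _ _] := hg _ (Wu n).
  exists (b + (g (u n)).2); first exact: subspaceD.
  rewrite big_ord_recr/= linearD -e; abelian_group.
have ns : nrm s <= 2 * M * nrm w.
  have := hs 0; rewrite big_ord0 subr0 expr0 mulr1; lra.
have nw := nrm_ge0 w.
exists s; split.
- move/closed_adherentP : cN; apply => e e0.
  have [n hn] := half_pow_lt (nrm w + c * (M * nrm w * 2)) e0.
  have [b Nb eb] := partial n; exists b => //; apply: le_lt_trans hn.
  have -> : w - f s - b = u n - f (s - \sum_(k < n) (g (u k)).1).
    by rewrite -eb linearB; abelian_group.
  rewrite (le_trans (nrmBD _ _))// mulrDl lerD// (le_trans (hc _))// -mulrA ler_pM2l//.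
- rewrite (le_trans ns)// ler_wpM2r// lerDl addr_ge0// mulr_ge0 ?(ltW c0)//; lra.
- rewrite (le_trans (nrmBD _ _))//.
  have : nrm (f s) <= c * (2 * M) * nrm w.
    by rewrite (le_trans (hc _))// -mulrA ler_pM2l.
  have : 0 <= 2 * M * nrm w by rewrite !mulr_ge0// ltW.
  lra.
Qed.

                                                                              
                                                                       
                                                                                 
Lemma closed_range_of_sum : closed (range f `&` N) -> closed (range f).
Proof.
move=> /closed_adherentP cI; have [C C0 hC] := open_mapping.
apply/closed_adherentP => y hy.
have Wr z : range f z -> W z.
  by move=> rz; exists z => //; rewrite subrr; exact: sN.1.
have Wy : W y.
  move/closed_adherentP : cW; apply => e /hy[a ra ya]; exists a => //; exact: Wr.
have [x [Nx _ _]] := hC _ Wy.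
suff [rn _] : (range f `&` N) (y - f x).
  by rewrite -(subrK (f x) y); apply: subspaceD rn _; [exact: subspace_range|exists x].
apply: cI => e e0; have [|a ra ya] := hy (e / C); first by rewrite divr_gt0.
have [z [Nz _ nz]] := hC _ (subspaceB sW Wy (Wr _ ra)).
exists (y - f x - (y - a - f z)).
  split; last exact: subspaceB.
  have -> : y - f x - (y - a - f z) = a - f (x - z).
    by rewrite (linearB f); abelian_group.
  by apply: (subspaceB (subspace_range f) ra); exists (x - z).
rewrite opprB addrCA subrr addr0 (le_lt_trans nz)// mulrC -ltr_pdivlMr//.
Qed.

End OpenMapping.

Section ClosedRange.
Context (R : realType) (Y : completeNormedModType R[i]).
Implicit Types (f T : boundedOp Y).

Lemma closed_range_lift f : closed (range f) -> exists2 c : R, 0 < c &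
  forall y, range f y -> exists2 x, f x = y & nrm x <= c * nrm y.
Proof.
move=> cf; have := @open_mapping _ _ f [set 0] (@subspace_set0 _ _) (@closed_set0 _ _).
have -> : sum_set (range f) [set 0] = range f.
  apply/seteqP; split=> [y [a ra /= /subr0_eq ->//]|y ry].
  by exists y => //=; rewrite subrr.
move=> /(_ cf)[c c0 h]; exists c => // y /h[x [/= /subr0_eq e ? _]]; by exists x.
Qed.

                                                                                 
                                                               
Lemma lift_closed_range f (c : R) :
  (forall x, exists2 x', f x' = f x & nrm x' <= c * nrm (f x)) -> closed (range f).
Proof.
move=> h; have {}h : exists2 c : R, 0 < c &
    forall x, exists2 x', f x' = f x & nrm x' <= c * nrm (f x).
  exists (`|c| + 1); first by rewrite ltr_wpDl.
  move=> x; have [x' e h'] := h x; exists x' => //; rewrite (le_trans h')//.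
  by rewrite ler_wpM2r ?nrm_ge0// (le_trans (ler_norm _))// lerDl.
move: h => [{}c c0 h]; apply/closed_adherentP => y hy.
have /choice[x hx] : forall k : nat, exists x, nrm (y - f x) < 2^-1 ^+ k.
  by move=> k; have [|_ [x _ <-] yx] := hy (2^-1 ^+ k); [rewrite exprn_gt0|exists x].
have /choice[u hu] : forall k, exists u, f u = f (x k.+1) - f (x k) /\
    nrm u <= c * 2 * 2^-1 ^+ k.
  move=> k; have [u fu nu] := h (x k.+1 - x k); exists u; split; first by rewrite fu linearB.
  rewrite (le_trans nu)// -mulrA ler_pM2l// linearB.
  apply: le_trans (nrmBB _ y _) _; rewrite (nrmB (f _) y).
  have := hx k.+1; have := hx k; rewrite exprS.
  have : 0 < 2^-1 ^+ k :> R by rewrite exprn_gt0.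
  lra.
have [s hs] := complete_series (fun k => (hu k).2).
exists (s + x 0%N) => //; apply/esym/subr0_eq; apply: nrm_le0 => e e0.
have [d d0 hd] := bop_nrm f.
have [n hn] := half_pow_lt (1 + d * (c * 2 * 2)) e0; apply: le_trans (ltW hn).
have fs : f (\sum_(k < n) u k) = f (x n) - f (x 0%N).
  rewrite linear_sum; under eq_bigr do rewrite (hu _).1.
  by rewrite -(big_mkord xpredT (fun k => f (x k.+1) - f (x k))) telescope_sumr.
have -> : y - f (s + x 0%N) = y - f (x n) - f (s - \sum_(k < n) u k).
  by rewrite linearB linearD fs; abelian_group.
rewrite (le_trans (nrmBD _ _))// mulrDl mul1r lerD ?(ltW (hx n))//.
by rewrite (le_trans (hd _))// -mulrA ler_pM2l.
Qed.

                                                                              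
                                
Lemma closed_range_findef f m : ~ dim_ge setT (range f) m -> closed (range f).
Proof.
have sr := subspace_range f.
move=> /(not_dim_ge_basis sr)[n _ [h h']]; have [v [_ vB vs]] := dim_ge_basis sr h h'.
pose N := [set x | exists c : 'I_n -> R[i], x - \sum_i c i *: v i = 0].
have cN : closed N := closed_span (v := v) (@subspace_set0 _ _) (@closed_set0 _ _).
have sN : linsub N.
  split; first by exists (fun=> 0); rewrite big1 ?subr0// => i _; rewrite scale0r.
  move=> a x y [c /subr0_eq xc] [c' /subr0_eq yc]; exists (fun i => a * c i + c' i).
  rewrite xc yc scaler_sumr -big_split/= -sumrB big1// => i _.
  by rewrite scalerDl scalerA subrr.
apply: (closed_range_of_sum sN cN).
- suff -> : sum_set (range f) N = setT by exact: closedT.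
  apply/seteqP; split=> // x _; have [c hc] := vs x I.
  by exists (x - \sum_i c i *: v i) => //; exists c; rewrite subKr subrr.
- suff -> : range f `&` N = [set 0] by exact: closed_set0.
  apply/seteqP; split=> [x [rx [c /subr0_eq xc]]|_ ->]; last first.
    by split; [exact: sr.1|exact: sN.1].
  move: (rx); rewrite xc => /vB c0; rewrite /= big1// => i _; by rewrite c0 scale0r.
Qed.

                                                                               
                                                                
Lemma closed_of_preimage f (A : set Y) : closed (range f) -> A `<=` range f ->
  closed (f @^-1` A) -> closed A.
Proof.
move=> cf Af /closed_adherentP cA; have [c c0 hc] := closed_range_lift cf.
apply/closed_adherentP => y hy.
have [u _ yu] : range f y.
  by move/closed_adherentP : cf; apply => e /hy[a /Af ra ya]; exists a.
rewrite -yu; apply: cA => e e0; have [|a Aa ya] := hy (e / c); first by rewrite divr_gt0.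
have [|w fw nw] := hc (y - a).
  by apply: subspaceB; [exact: subspace_range|exists u|exact: Af].
exists (u - w); first by rewrite /preimage/= linearB fw yu subKr.
by rewrite subKr (le_lt_trans nw)// mulrC -ltr_pdivlMr.
Qed.

                                                                         
                                                                     
Lemma closed_ranS T q m : closed (ran T q.+1) ->
  ~ dim_ge (ran T q `&` null_space T) (ran T q.+1 `&` null_space T) m ->
  closed (ran T q.+2).
Proof.
move=> cq hk; apply: (@closed_of_preimage (opow T q.+1)) => //.
  exact: ranW.
set P2 := _ @^-1` _; pose P1 := opow T q @^-1` ran T q.+1.
have sP1 : linsub P1 by exact/subspace_preim/subspace_ran.
have sP2 : linsub P2 by exact/subspace_preim/subspace_ran.
apply: (closed_findim_ext (n := m) sP2 sP1); first exact: closed_preim.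
  by move=> x /ranS.
move=> h; apply: hk.
have {}h : dim_ge (ker T q.+1) P1 m.
  apply: (dim_ge_preimage (f := id)) h => //; first exact: subspace_ker.
  move=> y [u _ yu]; exists (y - T u).
    rewrite /ker /null_space /= -iterS iterB_lin -iterSr yu.
    by rewrite opowE subrr.
  rewrite subKr /P1 /preimage/= opowE -iterSr; exact: ran_iter.
apply: dim_ge_image h => //; first exact: (iter_linear T q).
- exact: subspace_ker.
- by move=> x kx; split=> //; exists x.
- by move=> x _ [].
Qed.

End ClosedRange.

                                             

Section RestrictedDimensions.
Context (R : realType) (X : completeNormedModType R[i]).
Implicit Types (T : boundedOp X) (n m : nat).

                                                                              
                                                                    
Definition alpha_ge T n m := dim_ge (ran T n `&` null_space T) [set 0] m.
Definition beta_ge T n m := dim_ge (ran T n) (ran T n.+1) m.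

Lemma alpha_ge0E T : alpha_ge T 0 = dim_ge (null_space T) [set 0].
Proof. by rewrite /alpha_ge ran0 setTI. Qed.

Lemma beta_ge0E T : beta_ge T 0 = dim_ge setT (range T).
Proof. by rewrite /beta_ge ran0. Qed.

Lemma subspace_ran_null T n : linsub (ran T n `&` null_space T).
Proof. by apply: subspaceI; [exact: subspace_ran|exact: subspace_null]. Qed.

End RestrictedDimensions.

                                                                                 
                                                                                 
                                                
Section Embedding.
Context (R : realType) (X Z : completeNormedModType R[i]).
Context (T : boundedOp X) (P : boundedOp Z) (j : Z -> X) (n : nat).
Hypotheses (j_linear : linear j) (j_inj : injective j).
Hypothesis jP : forall x, j (P x) = T (j x).
Hypotheses (j_ran : forall x, ran T n (j x))
  (j_onto : forall y, ran T n y -> exists x, j x = y).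

Lemma embed_iter m x : j (iter m P x) = iter m T (j x).
Proof. by elim: m => //= m IH; rewrite jP IH. Qed.

Lemma embed_ran m x : ran P m x <-> ran T (n + m) (j x).
Proof.
split=> [[y _ <-]|[u _ /esym xu]].
  by rewrite embed_iter addnC; exact/iter_ran/j_ran.
have [y hy] := j_onto (ran_iter T n u); exists y => //.
by apply: j_inj; rewrite embed_iter hy -iterD addnC.
Qed.

Let j0 : j 0 = 0.
Proof. by have := j_linear (-1) 0 0; rewrite scaler0 addr0 scaleN1r addNr. Qed.

Lemma embed_null x : null_space P x <-> null_space T (j x).
Proof.
rewrite /null_space /= -jP; split=> [->|h]; first exact: j0.
by apply: j_inj; rewrite h j0.
Qed.

Lemma embed_alpha_ge m : alpha_ge P m = alpha_ge T (n + m).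
Proof.
apply/funext => k; apply/propext; apply: (dim_ge_iso j_linear).
- exact: subspace_ran_null.
- exact: subspace_set0.
- by move=> x [/embed_ran rx /embed_null nx].
- by move=> x _; split=> [h|->]; [apply: j_inj; rewrite h j0|exact: j0].
- move=> y [ry ny]; have [x xy] := j_onto (ranW (leq_addr m n) ry).
  exists x; last by rewrite /= xy subrr.
  by split; [apply/embed_ran; rewrite xy|apply/embed_null; rewrite xy].
Qed.

Lemma embed_beta_ge m : beta_ge P m = beta_ge T (n + m).
Proof.
apply/funext => k; apply/propext; apply: (dim_ge_iso j_linear).
- exact: subspace_ran.
- exact: subspace_ran.
- by move=> x /embed_ran.
- by move=> x _; rewrite -addnS; exact: iff_sym (embed_ran _ _).
- move=> y ry; have [x xy] := j_onto (ranW (leq_addr m n) ry).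
  exists x; last by rewrite xy subrr; exact: (subspace_ran T _).1.
  by apply/embed_ran; rewrite xy.
Qed.

End Embedding.

                                            

                                                                                 
                              
Lemma chain_disc (R : realType) (P : R[i] -> Prop) (r d : R) : 0 < d ->
  (forall l l', cabs l <= r -> cabs l' <= r -> cabs (l - l') <= d -> P l -> P l') ->
  forall l, cabs l <= r -> P 0 <-> P l.
Proof.
move=> d0 h l lr; pose N := (Num.truncn (cabs l / d)).+1.
have N0 : 0 < N%:R :> R by rewrite ltr0n.
have hN : cabs l / N%:R <= d.
  by rewrite ler_pdivrMr// mulrC -ler_pdivrMr//; exact/ltW/truncnS_gt.
pose p j := (j%:R / N%:R)%:C * l.
have pr j : (j <= N)%N -> cabs (p j) <= r.
  move=> jN; rewrite cabsM cabs_real ?divr_ge0// (le_trans _ lr)// ler_piMl ?cabs_ge0//.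
  by rewrite ler_pdivrMr// mul1r ler_nat.
have pS j : cabs (p j.+1 - p j) <= d.
  have -> : p j.+1 - p j = (N%:R^-1)%:C * l.
    by rewrite /p -mulrBl -rmorphB/= -mulrBl -natrB// subSnn mul1r.
  by rewrite cabsM cabs_real ?invr_ge0// mulrC.
have p0 : p 0%N = 0 by rewrite /p mul0r mul0r.
have pN : p N = l by rewrite /p divff ?gt_eqF// mul1r.
have hj j : (j <= N)%N -> P 0 <-> P (p j).
  elim: j => [|j IH] jN; first by rewrite p0.
  rewrite IH; last exact: ltnW.
  by split; apply: h; rewrite ?pr ?(ltnW jN) ?pS// -cabsN opprB.
by rewrite -pN; exact: hj.
Qed.

Section Semiregular.
Context (R : realType) (Y : completeNormedModType R[i]) (T : boundedOp Y).

Lemma null_shift_iter (l : R[i]) n x : null_space (op_shift T l) x -> iter n T x = l ^+ n *: x.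
Proof.
move=> /subr0_eq Tx; elim: n => [|n IH]; first by rewrite expr0 scale1r.
by rewrite iterS IH linearZ/= (Tx : T x = _) scalerA exprSr.
Qed.

Lemma null_shift_ran (l : R[i]) n : l != 0 -> null_space (op_shift T l) `<=` ran T n.
Proof.
move=> l0 x hx; exists (l ^- n *: x) => //.
by rewrite iterZ_lin (null_shift_iter _ hx) scalerA mulVf ?scale1r// expf_neq0.
Qed.

Hypothesis cT : closed (range T).
Hypothesis hN : forall n, null_space T `<=` ran T n.

Lemma semiregular_closed_ran n : closed (ran T n).
Proof.
elim: n => [|[|n] IH]; [by rewrite ran0; exact: closedT|exact: cT|].
apply: (@closed_ranS _ _ T n 1) => //; apply/not_dim_ge1.
  by apply: subspaceI; [exact: subspace_ran|exact: subspace_null].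
by move=> x [_ Nx]; split=> //; exact: hN.
Qed.

Let Rinf : set Y := [set x | forall n, ran T n x].

Let sRinf : linsub Rinf.
Proof.
split=> [n|a x y hx hy n]; first exact: (subspace_ran T n).1.
exact: (subspace_ran T n).2.
Qed.

Let cRinf : closed Rinf.
Proof.
apply/closed_adherentP => x hx n.
have /closed_adherentP := semiregular_closed_ran (n := n); apply => e /hx[a Ra xa].
by exists a.
Qed.

Let Rinf_pre x : Rinf (T x) -> Rinf x.
Proof.
move=> h n; have [u Ru Tu] := ranS_inv (h n.+1).
rewrite -(subrK u x); apply: (subspaceD (subspace_ran T n)) => //.
by apply: hN; rewrite /null_space/= linearB Tu subrr.
Qed.

Variables (c : R).
Hypotheses (c0 : 0 < c) (hc : forall y, range T y -> exists2 x, T x = y & nrm x <= c * nrm y).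

Section Fixed.
Variable l : R[i].
Hypothesis lc : c * cabs l <= 8^-1.
Local Notation S := (op_shift T l).

                                                                                
                                                                  
Let solve y : Rinf y -> exists2 x, Rinf x & S x = y /\ nrm x <= 2 * c * nrm y.
Proof.
move=> Ry.
have /choice[g hg] : forall y, exists x, range T y -> T x = y /\ nrm x <= c * nrm y.
  move=> z; have [/hc[x ? ?]|nz] := pselect (range T z); first by exists x.
  by exists 0.
pose v k := iter k g y.
have Rv k : Rinf (v k).
  elim: k => [//|k IH]; apply: Rinf_pre; rewrite /v iterS.
  by rewrite (hg _ (IH 1%N)).1.
have Tv k : T (v k.+1) = v k by exact: (hg _ (Rv k 1%N)).1.
have nv k : nrm (l ^+ k *: v k) <= nrm y * 2^-1 ^+ k.
  elim: k => [|k IH]; first by rewrite expr0 scale1r mulr1.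
  have h := (hg _ (Rv k 1%N)).2.
  rewrite exprSr -scalerA nrmZ exprSr mulrA nrmZ.
  have h2 : cabs l * nrm (v k.+1) <= 2^-1 * nrm (v k).
    apply: (@le_trans _ _ (c * cabs l * nrm (v k))).
      by rewrite [leRHS]mulrAC mulrC ler_wpM2r ?cabs_ge0.
    by rewrite ler_wpM2r ?nrm_ge0//; move: lc; lra.
  apply: (@le_trans _ _ (cabs (l ^+ k) * (2^-1 * nrm (v k)))).
    by rewrite ler_wpM2l ?cabs_ge0.
  by rewrite mulrCA mulrC ler_wpM2r//; rewrite nrmZ in IH.
have nu k : nrm (l ^+ k *: v k.+1) <= (c * nrm y) * 2^-1 ^+ k.
  have h := (hg _ (Rv k 1%N)).2; rewrite nrmZ.
  apply: (@le_trans _ _ (cabs (l ^+ k) * (c * nrm (v k)))).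
    by rewrite ler_wpM2l ?cabs_ge0.
  by rewrite mulrCA -mulrA ler_pM2l// -nrmZ.
have [s hs] := complete_series nu.
pose P n := \sum_(k < n) l ^+ k *: v k.+1.
have SP n : S (P n) = y - l ^+ n *: v n.
  elim: n => [|n IH]; first by rewrite /P big_ord0 linear0 expr0 scale1r subrr.
  have SvE : S (v n.+1) = v n - l *: v n.+1 by rewrite -(Tv n).
  rewrite /P big_ord_recr -/(P n) (linearD S) IH (linearZZ S) SvE scalerBr scalerA -exprSr.
  abelian_group.
exists s.
  move/closed_adherentP : cRinf; apply => e e0; have [n hn] := half_pow_lt (c * nrm y * 2) e0.
  exists (P n); last exact: le_lt_trans (hs n) hn.
  by apply: (@subspace_comb _ _ Rinf) => // k; exact: Rv.
split; last first.
  by have := hs 0%N; rewrite big_ord0 subr0 expr0 mulr1; lra.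
have [d d0 hd] := bop_nrm S.
apply/subr0_eq/nrm_le0 => e e0.
have [n hn] := half_pow_lt (d * (c * nrm y * 2) + nrm y) e0; apply: le_trans (ltW hn).
have -> : S s - y = S (s - P n) - l ^+ n *: v n by rewrite (linearB S) SP; abelian_group.
rewrite (le_trans (nrmBD _ _))// mulrDl lerD//.
by rewrite (le_trans (hd _))// -mulrA ler_pM2l//; exact: hs.
Qed.

                                                                         
                                                                               
                                                                                
Let shift_lift_step x : exists2 x', S x' = S x & nrm x' <= 2 * c * nrm (S x) + nrm x / 2.
Proof.
have [|u Tu nu] := hc (y := T x); first by exists x.
have Nn : null_space T (x - u) by rewrite /null_space/= linearB Tu subrr.
have [|w Rw [Sw nw]] := @solve (l *: (x - u)).
  by apply: (@subspaceZ _ _ Rinf _ _ sRinf) => n; exact: hN.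
exists (u - w).
  rewrite linearB Sw /= /shift_fun Tu scalerBr; abelian_group.
have Tx : T x = S x + l *: x by rewrite /= /shift_fun subrK.
have n1 : nrm u <= c * nrm (S x) + 8^-1 * nrm x.
  apply: le_trans nu _; rewrite Tx.
  apply: (@le_trans _ _ (c * (nrm (S x) + cabs l * nrm x))).
    by rewrite ler_pM2l// -nrmZ nrmD.
  by rewrite mulrDr lerD2l mulrA ler_wpM2r// nrm_ge0.
have n2 := nrmBD x u.
have n3 : nrm w <= 4^-1 * nrm (x - u).
  apply: le_trans nw _; rewrite nrmZ mulrA ler_wpM2r ?nrm_ge0//.
  move: lc; lra.
have := nrmBD u w; have := nrm_ge0 x.
have : 0 <= c * nrm (S x) by rewrite mulr_ge0 ?nrm_ge0// ltW.
lra.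
Qed.

                                                                         
                                                                  
Lemma semiregular_shift_lift x : exists2 x', S x' = S x & nrm x' <= 5 * c * nrm (S x).
Proof.
have iterk k : exists2 x', S x' = S x & nrm x' <= 4 * c * nrm (S x) + nrm x * 2^-1 ^+ k.
  elim: k => [|k [x' Sx' nx']].
    exists x => //; rewrite expr0 mulr1 lerDr !mulr_ge0 ?nrm_ge0// ltW//.
  have [x'' Sx'' nx''] := shift_lift_step x'; exists x''; first by rewrite Sx''.
  rewrite (le_trans nx'')// Sx' exprS; move: nx'; lra.
have [Sx0|Sx0] := eqVneq (S x) 0.
  by exists 0; rewrite ?linear0 ?nrm0 ?Sx0 ?nrm0 ?mulr0.
have e0 : 0 < c * nrm (S x) by rewrite mulr_gt0// nrm_gt0.
have [k hk] := half_pow_lt (nrm x) e0.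
have [x' Sx' nx'] := iterk k; exists x' => //; rewrite (le_trans nx')//; lra.
Qed.

                                                                               
                        
Lemma semiregular_shift_ran n : null_space S `<=` ran S n.
Proof.
have NR : null_space S `<=` Rinf.
  move=> x hx k; have [l0|l0] := eqVneq l 0; last exact: null_shift_ran hx.
  by apply: hN; move: hx; rewrite /null_space/= /shift_fun l0 scale0r subr0.
have RR : forall y, Rinf y -> exists2 x, Rinf x & iter n S x = y.
  elim: n => [|n IH] y Ry; first by exists y.
  have [x Rx [Sx _]] := solve Ry; have [z Rz Sz] := IH _ Rx.
  by exists z => //; rewrite iterS Sz.
by move=> x /NR/RR[z _ <-]; exists z.
Qed.

End Fixed.

                                                                                 
                                                                                  
                                                                                 
Lemma semiregular_shift_gap (l l' : R[i]) m (t := 5 * c * cabs (l - l')) :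
  c * cabs l <= 8^-1 -> c * cabs l' <= 8^-1 -> t <= 1 -> 3 * m%:R * t < riesz_const R m ->
  (dim_ge (null_space (op_shift T l)) [set 0] m ->
     dim_ge (null_space (op_shift T l')) [set 0] m) /\
  (dim_ge setT (range (op_shift T l)) m -> dim_ge setT (range (op_shift T l')) m).
Proof.
move=> lc lc' t1 tm; have t0 : 0 <= t <= 1 by rewrite t1 !mulr_ge0 ?cabs_ge0// ltW.
have c5 : 0 <= 5 * c by rewrite mulr_ge0// ltW.
have diff x : op_shift T l' x - op_shift T l x = (l - l') *: x.
  by rewrite /= /shift_fun scalerBl; abelian_group.
split; apply: (gap_dim_ge (t := t)) => //.
- exact: subspace_null.
- exact: subspace_set0.
- exact: closed_set0.
- by move=> _ ->; rewrite /null_space/= linear0.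
- move=> x hx; have [x' Sx' nx'] := semiregular_shift_lift lc' x.
  exists (x - x'); first by rewrite /null_space/= linearB Sx' subrr.
  have Sx : op_shift T l' x = (l - l') *: x.
    by rewrite -diff (hx : op_shift T l x = 0) subr0.
  by rewrite subKr (le_trans nx')// Sx nrmZ mulrA.
- by move=> _ ->; exists 0; rewrite ?subr0 ?nrm0 ?mulr0.
- exact: subspace_range.
- by apply: (lift_closed_range (c := 5 * c)) => x; exact: semiregular_shift_lift.
- by move=> x _; exists x => //; rewrite subrr nrm0 mulr_ge0 ?nrm_ge0//; case/andP: t0.
- move=> _ [x _ <-]; have [x' Sx' nx'] := semiregular_shift_lift lc' x.
  exists (op_shift T l x'); first by exists x'.
  by rewrite -Sx' diff nrmZ Sx' mulrC (le_trans (ler_wpM2r _ nx')) ?cabs_ge0// mulrAC.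
Qed.

End Semiregular.

                                                                                 
                                                                 
Theorem semiregular_stability (R : realType) (Y : completeNormedModType R[i])
    (T : boundedOp Y) :
  closed (range T) -> (forall n, null_space T `<=` ran T n) ->
  exists2 e : R, 0 < e & forall l, cabs l <= e -> let S := op_shift T l in
  [/\ closed (range S), forall n, null_space S `<=` ran S n,
   forall m, dim_ge (null_space T) [set 0] m <-> dim_ge (null_space S) [set 0] m &
   forall m, dim_ge setT (range T) m <-> dim_ge setT (range S) m].
Proof.
move=> cT hN; have [c c0 hc] := closed_range_lift cT.
have e8 l : cabs l <= (8 * c)^-1 -> c * cabs l <= 8^-1.
  by rewrite invfM ler_pdivlMr// mulrC.
exists (8 * c)^-1; first by rewrite invr_gt0 mulr_gt0.
move=> l le S.
pose t m := Num.min 1 (riesz_const R m / (3 * m%:R + 1) / 2).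
have q0 m : 0 < 3 * m%:R + 1 :> R by rewrite ltr_wpDl ?mulr_ge0.
have t0 m : 0 < t m by rewrite lt_min ltr01/= !divr_gt0// riesz_const_gt0.
have step m l1 l2 : cabs l1 <= (8 * c)^-1 -> cabs l2 <= (8 * c)^-1 ->
    cabs (l1 - l2) <= t m / (5 * c) ->
    (dim_ge (null_space (op_shift T l1)) [set 0] m ->
       dim_ge (null_space (op_shift T l2)) [set 0] m) /\
    (dim_ge setT (range (op_shift T l1)) m -> dim_ge setT (range (op_shift T l2)) m).
  move=> h1 h2; rewrite ler_pdivlMr ?mulr_gt0// mulrC => h3.
  apply: (semiregular_shift_gap cT hN c0 hc); rewrite ?e8//.
    by apply: le_trans h3 _; rewrite ge_min lexx.
  apply: (@le_lt_trans _ _ (riesz_const R m / 2)); last first.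
    by have := riesz_const_gt0 R m; lra.
  apply: (@le_trans _ _ ((3 * m%:R + 1) * t m)).
    by rewrite ler_pM ?mulr_ge0 ?cabs_ge0 ?(ltW c0)// lerDl.
  apply: (@le_trans _ _ ((3 * m%:R + 1) * (riesz_const R m / (3 * m%:R + 1) / 2))).
    by rewrite ler_pM2l// ge_min lexx orbT.
  by rewrite mulrC -!mulrA (mulrCA _^-1) mulVf ?gt_eqF// mulr1.
have d0 m : 0 < t m / (5 * c) by rewrite divr_gt0// mulr_gt0.
have shift0 : op_shift T 0 = T :> (Y -> Y).
  by apply/funext => x; rewrite /= /shift_fun scale0r subr0.
split.
- apply: (lift_closed_range (c := 5 * c)) => x.
  exact: (semiregular_shift_lift cT hN c0 hc (e8 _ le)).
- by move=> n; exact: (semiregular_shift_ran cT hN c0 hc (e8 _ le)).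
- move=> m; rewrite -{1}shift0.
  apply: (chain_disc (P := fun l => dim_ge (null_space (op_shift T l)) [set 0] m) (d0 m) _ le).
  by move=> l1 l2 h1 h2 h3; exact: (step m l1 l2 h1 h2 h3).1.
- move=> m; rewrite -{1}shift0.
  apply: (chain_disc (P := fun l => dim_ge setT (range (op_shift T l)) m) (d0 m) _ le).
  by move=> l1 l2 h1 h2 h3; exact: (step m l1 l2 h1 h2 h3).2.
Qed.

                                                        

                                                                               
                                                      
Lemma cauchy_cvg_of_series (R : realType) (V : normedModType R[i]) :
  (forall (u : nat -> V) (C : R), (forall k, nrm (u k) <= C * 2^-1 ^+ k) ->
    exists s, exists D, forall n, nrm (s - \sum_(k < n) u k) <= D * 2^-1 ^+ n) ->
  forall F : set_system V, ProperFilter F -> cauchy F -> cvg F.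
Proof.
move=> hV F FF /cauchyP Fc.
have /choice[x hx] : forall k : nat, exists x, F (ball x (2^-1 ^+ k : R)%:C).
  by move=> k; apply: Fc; rewrite ltcR exprn_gt0.
have ballE (a b : V) (r : R) : ball a r%:C b -> nrm (a - b) < r.
  by rewrite -ball_normE /ball_/= -nrmE ltcR.
have dx k : nrm (x k.+1 - x k) <= 2 * 2^-1 ^+ k.
  have [z [/ballE h1 /ballE h2]] := filter_ex (filterI (hx k) (hx k.+1)).
  apply: le_trans (nrmBB _ z _) _; rewrite (nrmB z).
  move: h1 h2; rewrite exprS; have : 0 < 2^-1 ^+ k :> R by rewrite exprn_gt0.
  lra.
have [s [D hs]] := hV _ _ dx.
apply/cvg_ex; exists (s + x 0%N); apply/cvgrPdist_lt => e e0.
have er : (complex.Re e)%:C = e by rewrite RRe_real// realE ltW.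
have e0' : 0 < complex.Re e by rewrite -ltcR er.
have [n hn] := half_pow_lt (D + 1) e0'.
apply: filterS (hx n) => y /ballE xy; rewrite -nrmE -er ltcR; apply: le_lt_trans hn.
have := hs n; rewrite -(big_mkord xpredT (fun k => x k.+1 - x k)) telescope_sumr//.
move=> h; have -> : s + x 0%N - y = s - (x n - x 0%N) + (x n - y) by abelian_group.
by rewrite (le_trans (nrmD _ _))// mulrDl mul1r lerD// ltW.
Qed.

Section RangeSpace.
Context (R : realType) (X : completeNormedModType R[i]) (T : boundedOp X) (d : nat).

Local Notation rn := (range_norm T d).

Let E (y : X) := [set complex.Re `|x| | x in [set x | y = iter d T x]].

Lemma range_norm_le x : rn (iter d T x) <= nrm x.
Proof.
apply: inf_lbound; last by exists x.
by exists 0 => _ [z _ <-]; exact: nrm_ge0.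
Qed.

Lemma range_norm_approx y e : ran T d y -> 0 < e ->
  exists2 x, y = iter d T x & nrm x < rn y + e.
Proof.
move=> [x0 _ yx0] e0; have iE : has_inf (E y).
  split; first by exists (nrm x0); exists x0.
  by exists 0 => _ [z _ <-]; exact: nrm_ge0.
by have [_ [x yx <-] hx] := inf_adherent e0 iE; exists x.
Qed.

Lemma range_norm_ge0 y : ran T d y -> 0 <= rn y.
Proof.
move=> [x0 _ yx0]; apply: lb_le_inf; first by exists (nrm x0); exists x0.
by move=> _ [z _ <-]; exact: nrm_ge0.
Qed.

Definition range_pred : {pred X} := mem (ran T d).

Lemma range_pred_submod : submod_closed range_pred.
Proof.
have [h0 h] := subspace_ran T d; split; first exact/mem_set.
by move=> a x y /set_mem hx /set_mem hy; apply/mem_set/h.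
Qed.

HB.instance Definition _ :=
  GRing.isSubmodClosed.Build R[i] X range_pred range_pred_submod.

                                                                             
                                                
Record rspace := RSpace { rval : X ; rvalP : rval \in range_pred }.

HB.instance Definition _ := [isSub for rval].
HB.instance Definition _ := [Choice of rspace by <:].
HB.instance Definition _ := [SubChoice_isSubLmodule of rspace by <:].

Lemma rval_ran (x : rspace) : ran T d (rval x). Proof. exact/set_mem/rvalP. Qed.

Let rnorm (x : rspace) : R[i] := (rn (rval x))%:C.

Let rnorm_ler_normD x y : rnorm (x + y) <= rnorm x + rnorm y.
Proof.
rewrite -rmorphD/= lecR; apply/ler_addgt0Pr => e e0.
have e2 : 0 < e / 2 by rewrite divr_gt0.
have [u xu hu] := range_norm_approx (rval_ran x) e2.
have [v yv hv] := range_norm_approx (rval_ran y) e2.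
have -> : rval (x + y) = iter d T (u + v) by rewrite iterD_lin -xu -yv.
apply: le_trans (range_norm_le _) _; apply: le_trans (nrmD _ _) _; lra.
Qed.

Let range_normZ_le a y : ran T d y -> rn (a *: y) <= cabs a * rn y.
Proof.
move=> ry; apply/ler_addgt0Pr => e e0.
have a1 : 0 < cabs a + 1 by rewrite ltr_wpDl// cabs_ge0.
have [u yu hu] := range_norm_approx ry (divr_gt0 e0 a1).
have -> : a *: y = iter d T (a *: u) by rewrite iterZ_lin -yu.
apply: le_trans (range_norm_le _) _; rewrite nrmZ.
apply: le_trans (ler_wpM2l (cabs_ge0 a) (ltW hu)) _; rewrite mulrDr lerD2l.
by rewrite mulrA ler_pdivrMr// mulrC ler_pM2l// lerDl.
Qed.

Let rnorm_normrZ (a : R[i]) x : rnorm (a *: x) = `|a| * rnorm x.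
Proof.
rewrite -cabsE -rmorphM/=; congr (_%:C); apply/eqP.
have e : rval (a *: x) = a *: rval x by [].
rewrite e eq_le range_normZ_le /=; last exact: rval_ran.
have [->|a0] := eqVneq a 0.
  rewrite cabs0 mul0r range_norm_ge0// scale0r; exact: (subspace_ran T d).1.
have ca := cabs_gt0 a0; rewrite -ler_pdivlMl//.
rewrite -{1}(scale1r (rval x)) -(mulVf a0) -scalerA.
rewrite (le_trans (range_normZ_le _ _)) ?cabsV//.
by rewrite -e; exact: rval_ran.
Qed.

Lemma rval_nrm_bound : exists2 c : R, 0 < c &
  forall x : rspace, nrm (rval x) <= c * rn (rval x).
Proof.
have [c c0 hc] := bop_nrm (opow T d); exists c => // x.
apply/ler_addgt0Pr => e e0; have [u xu hu] := range_norm_approx (rval_ran x) (divr_gt0 e0 c0).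
rewrite {1}xu; apply: le_trans (hc _) _.
apply: le_trans (ler_wpM2l (ltW c0) (ltW hu)) _.
by rewrite mulrDr lerD2l mulrC divfK ?gt_eqF.
Qed.

Let rnorm_normr0_eq0 x : rnorm x = 0 -> x = 0.
Proof.
move=> /complexI rn0; apply: val_inj => /=; apply: nrm_eq0; apply/eqP.
have [c c0 /(_ x)] := rval_nrm_bound.
by rewrite rn0 mulr0 eq_le nrm_ge0 andbT.
Qed.

HB.instance Definition _ := Lmodule_isNormed.Build R[i] rspace
  rnorm_ler_normD rnorm_normrZ rnorm_normr0_eq0.

Lemma rspace_nrm (x : rspace) : nrm x = rn (rval x).
Proof. by []. Qed.

                                                                        
Let rspace_complete (F : set_system rspace) : ProperFilter F -> cauchy F -> cvg F.
Proof.
apply: cauchy_cvg_of_series => u C hu.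
have /choice[v hv] : forall k, exists v,
    rval (u k) = iter d T v /\ nrm v <= (C + 1) * 2^-1 ^+ k.
  move=> k; have e0 : 0 < 2^-1 ^+ k :> R by rewrite exprn_gt0.
  have [v uv nv] := range_norm_approx (rval_ran (u k)) e0; exists v; split => //.
  rewrite (le_trans (ltW nv))// mulrDl mul1r lerD2r -rspace_nrm; exact: hu.
have [s hs] := complete_series (fun k => (hv k).2).
exists (RSpace (mem_set (ran_iter T d s))), ((C + 1) * 2) => n.
rewrite rspace_nrm; apply: le_trans (hs n).
suff -> : rval (RSpace (mem_set (ran_iter T d s)) - \sum_(k < n) u k) =
    iter d T (s - \sum_(k < n) v k) by exact: range_norm_le.
rewrite iterB_lin; congr (_ - _).
elim: n => [|n IH]; first by rewrite !big_ord0 iter0_lin.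
by rewrite !big_ord_recr/= iterD_lin -IH -(hv n).1.
Qed.

HB.instance Definition _ := Uniform_isComplete.Build rspace rspace_complete.

Let rop_subproof (x : rspace) : T (rval x) \in range_pred.
Proof. exact/mem_set/ran_stable/rval_ran. Qed.

Definition rop_fun (x : rspace) : rspace := RSpace (rop_subproof x).

Let rop_linear : linear rop_fun.
Proof. by move=> a x y; apply: val_inj; rewrite /= linearP. Qed.

HB.instance Definition _ := GRing.isLinear.Build _ _ _ _ rop_fun rop_linear.

Let rop_bounded : exists c : R, forall x, `|rop_fun x| <= c%:C * `|x|.
Proof.
have [c c0 hc] := bop_nrm T; exists c => x.
rewrite -!nrmE -rmorphM/= lecR !rspace_nrm; apply/ler_addgt0Pr => e e0.
have [u xu hu] := range_norm_approx (rval_ran x) (divr_gt0 e0 c0).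
have -> : rval (rop_fun x) = iter d T (T u) by rewrite /= xu -iterSr.
apply: le_trans (range_norm_le _) _; apply: le_trans (hc _) _.
apply: le_trans (ler_wpM2l (ltW c0) (ltW hu)) _.
by rewrite mulrDr lerD2l mulrC divfK ?gt_eqF.
Qed.

Definition rop : boundedOp rspace := BoundedOp rop_bounded.

Lemma rval_linear : linear rval. Proof. by []. Qed.

Lemma rval_inj : injective rval. Proof. exact: val_inj. Qed.

Lemma rval_ex y : ran T d y -> exists x : rspace, rval x = y.
Proof. by move=> /mem_set h; exists (RSpace h). Qed.

Lemma rval_rop x : rval (rop x) = T (rval x). Proof. by []. Qed.

Lemma rop_ran n x : ran rop n x <-> ran T (d + n) (rval x).
Proof. exact: embed_ran rval_inj rval_rop rval_ran rval_ex n x. Qed.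

Lemma rop_null x : null_space rop x <-> null_space T (rval x).
Proof. exact: embed_null rval_linear rval_inj rval_rop x. Qed.

Lemma rop_alpha_ge n : alpha_ge rop n = alpha_ge T (d + n).
Proof. exact: embed_alpha_ge rval_linear rval_inj rval_rop rval_ran rval_ex n. Qed.

Lemma rop_beta_ge n : beta_ge rop n = beta_ge T (d + n).
Proof. exact: embed_beta_ge rval_linear rval_inj rval_rop rval_ran rval_ex n. Qed.

Lemma rop_closed_ran n : closed (ran rop n) <-> range_closed T d (ran T (d + n)).
Proof.
rewrite closed_adherentP; split=> h.
- move=> _ /rval_ex[x <-] nx; apply: contrapT => h'; apply: nx.
  apply/rop_ran/h => e e0; apply: contrapT => h''; apply: h'; exists e => // z.
  move=> /rval_ex[z' <-] zx /rop_ran rz; apply: h''; exists z' => //.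
  by rewrite nrmB.
- move=> x hx; apply/rop_ran; apply: contrapT => nx.
  have [e e0 he] := h _ (rval_ran x) nx.
  have [a /rop_ran ra xa] := hx e e0; rewrite nrmB in xa.
  exact: he (rval_ran a) xa ra.
Qed.

End RangeSpace.

                                            

Section PuncturedNeighbourhood.
Context (R : realType) (X : completeNormedModType R[i]) (T : boundedOp X).

Lemma k_dim_eq0 n : k_dim T n = 0%E <-> ran T n `&` null_space T `<=` ran T n.+1.
Proof.
rewrite /k_dim quot_dim_eq0; last exact: subspace_ran_null.
by split=> [h x /h[]//|h x hx]; split; [exact: h|case: hx].
Qed.

Lemma uniform_descent_null d n : uniform_descent_from T d ->
  ran T d `&` null_space T `<=` ran T n.
Proof.
move=> h; have hd m : ran T d `&` null_space T `<=` ran T (d + m).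
  elim: m => [|m IH x hx]; first by rewrite addn0 => x [].
  rewrite addnS; have /k_dim_eq0 := (h (d + m)%N (leq_addr _ _)).1; apply.
  by split; [exact: IH|case: hx].
by move=> x /(hd n); apply: ranW; rewrite leq_addl.
Qed.

Context (l : R[i]) (l0 : l != 0).
Local Notation S := (op_shift T l).

                                                                               
                                                                            
                                                                    
Lemma ker_sub_range_shift d : ker T d `<=` range S.
Proof.
elim: d => [|d IH] w hw.
  by rewrite (hw : w = 0); exact: (subspace_range S).1.
have [|u _ Su] := IH (T w); first by rewrite /ker /null_space /= -iterSr.
apply: (@subspace_scaler _ _ _ l w (subspace_range S) l0); exists (u - w) => //.
by rewrite linearB Su /= /shift_fun subKr.
Qed.

Lemma ran_mod_range_shift d x : exists2 y, ran T d y & range S (x - y).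
Proof.
elim: d x => [|d IH] x.
  by exists x; [rewrite ran0|rewrite subrr; exact: (subspace_range S).1].
have [y ry xy] := IH x; exists (l^-1 *: T y).
  by apply: subspaceZ; [exact: subspace_ran|exact: ranS].
rewrite -(subrK y x) -addrA; apply: (subspaceD (subspace_range S)) => //.
apply: (@subspace_scaler _ _ _ l _ (subspace_range S) l0); exists (- y) => //.
by rewrite linearN /= /shift_fun scalerBr scalerA mulfV// scale1r opprB.
Qed.

Lemma shift_preim_ran d x : ran T d (S x) -> ran T d x.
Proof.
move=> h; have hj j : (j <= d)%N -> ran T j x.
  elim: j => [|j IH] jd; first by rewrite ran0.
  apply: (@subspace_scaler _ _ _ l _ (subspace_ran T j.+1) l0).
  have -> : l *: x = T x - S x by rewrite /= /shift_fun subKr.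
  apply: (subspaceB (subspace_ran T j.+1)); last exact: ranW h.
  exact/ranS/IH/ltnW.
exact: hj.
Qed.

Lemma shift_iter_comm d x : iter d T (S x) = S (iter d T x).
Proof. by rewrite /= /shift_fun iterB_lin iterZ_lin -iterSr. Qed.

End PuncturedNeighbourhood.

                                                                                 
                                                                                   
                                                                               
            
Theorem punctured_neighbourhood (R : realType) (X : completeNormedModType R[i])
    (T : boundedOp X) d : uniform_descent_from T d ->
  exists2 e : R, 0 < e & forall l, l != 0 -> cabs l <= e -> let S := op_shift T l in
  [/\ closed (range S), forall n, null_space S `<=` ran S n,
   forall m, alpha_ge T d m <-> alpha_ge S 0 m & forall m, beta_ge T d m <-> beta_ge S 0 m].
Proof.
move=> h; pose Q := rop T d.
have [||e e0 he] := @semiregular_stability R _ Q.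
- by apply/(rop_closed_ran T d 1); rewrite addn1; exact: (h d.+1 (leqnSn d)).2.
- move=> n x /rop_null nx; apply/rop_ran.
  have := @uniform_descent_null _ _ T d (d + n)%N h; apply.
  by split => //; exact: rval_ran.
exists e => // l l0 le S; have [cS NS nullE codimE] := he l le.
set SQ := op_shift Q l in cS NS nullE codimE.
have rS x : rval (SQ x) = S (rval x) by [].
have rSn n x : rval (iter n SQ x) = iter n S (rval x) by elim: n => //= n ->.
have nullS x : null_space S x -> exists2 y : rspace T d, rval y = x & null_space SQ y.
  move=> nx; have [y yx] := rval_ex (@null_shift_ran _ _ T l d l0 x nx).
  by exists y => //; apply: rval_inj; rewrite rS yx.
split.
- apply/closed_adherentP => z hz.
  have [y yz] := rval_ex (ran_iter T d z).
  have [u _ Su] : range SQ y.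
    move/closed_adherentP : cS; apply => r /hz[_ [x _ <-] zx].
    have [v vx] := rval_ex (ran_iter T d x); exists (SQ v); first by exists v.
    rewrite rspace_nrm; apply: le_lt_trans zx.
    suff -> : rval (y - SQ v) = iter d T (z - S x) by exact: range_norm_le.
    by rewrite iterB_lin shift_iter_comm -yz -vx.
  have [w _ wu] := rval_ran u.
  rewrite -(subrK (S w) z); apply: (subspaceD (subspace_range S)); last by exists w.
  apply: (ker_sub_range_shift (d := d) l0).
  by rewrite /ker /null_space /= iterB_lin shift_iter_comm wu -rS Su yz subrr.
- move=> n x /nullS[y <- ny]; have [u _ <-] := NS n y ny.
  by rewrite rSn; exact: ran_iter.
- move=> m; rewrite -(addn0 d) -rop_alpha_ge !alpha_ge0E.
  rewrite nullE; apply: (dim_ge_iso (@rval_linear _ _ T d)).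
  + exact: subspace_null.
  + exact: subspace_set0.
  + by move=> x nx; rewrite /null_space/= -rS nx.
  + by move=> x _; split=> [h0|->//]; apply: rval_inj.
  + by move=> x /nullS[y <- ny]; exists y => //=; rewrite subrr.
- move=> m; rewrite -(addn0 d) -rop_beta_ge !beta_ge0E.
  rewrite codimE; apply: (dim_ge_iso (@rval_linear _ _ T d)) => //.
  + exact: subspace_range.
  + move=> y _; split=> [[x _ Sx]|[x _ <-]]; last by exists (rval x).
    have [|v vx] := @rval_ex _ _ T d x.
      by apply: (shift_preim_ran l0); rewrite Sx; exact: rval_ran.
    by exists v => //; apply: rval_inj; rewrite rS vx.
  + by move=> x _; have [y /rval_ex[v <-] xy] := ran_mod_range_shift T l0 d x; exists v.
Qed.

                                                

Section Chains.
Context (R : realType) (X : completeNormedModType R[i]).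
Implicit Types (T : boundedOp X) (n m d q : nat).

Lemma alpha_geW T n n' m : (n <= n')%N -> alpha_ge T n' m -> alpha_ge T n m.
Proof. by move=> nn; apply: dim_ge_sub => // x [/(ranW nn)]. Qed.

Lemma beta_ge_step T n m : beta_ge T n.+1 m -> beta_ge T n m.
Proof.
apply: (dim_ge_preimage (f := T)); first exact: linearP.
- exact: subspace_ran.
- exact: subspace_ran.
- move=> _ [u _ <-]; exists (iter n T u); first exact: ran_iter.
  by rewrite subrr; exact: (subspace_ran T _).1.
- by move=> x _ /ranS.
Qed.

Lemma beta_geW T n n' m : (n <= n')%N -> beta_ge T n' m -> beta_ge T n m.
Proof.
move=> /subnKC <-; elim: (n' - n)%N => [|k IH]; first by rewrite addn0.
by rewrite addnS => /beta_ge_step.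
Qed.

Lemma not_alpha_ge1 T n : ~ alpha_ge T n 1 <-> forall x, ran T n x -> T x = 0 -> x = 0.
Proof.
rewrite /alpha_ge not_dim_ge1; last exact: subspace_set0.
by split=> [h x rx Tx|h x [rx Tx]]; apply: h.
Qed.

Lemma not_beta_ge1 T n : ~ beta_ge T n 1 <-> ran T n = ran T n.+1.
Proof.
rewrite /beta_ge not_dim_ge1; last exact: subspace_ran.
by split=> [h|->//]; apply/seteqP; split=> //; exact: ranW.
Qed.

Lemma null_quot_beta T n m :
  dim_ge (ran T n `&` null_space T) (ran T n.+1 `&` null_space T) m -> beta_ge T n m.
Proof.
apply: (dim_ge_image (f := id)) => //; first exact: subspace_ran_null.
- by move=> x [].
- by move=> x [_ nx] rx.
Qed.

Lemma null_quot_alpha T n m :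
  dim_ge (ran T n `&` null_space T) (ran T n.+1 `&` null_space T) m -> alpha_ge T n m.
Proof.
by apply: dim_ge_sub => // _ ->; exact: (subspace_ran_null T _).1.
Qed.

                                                                              
                                                                                 
                                
Lemma null_chain_stable T q (D : nat -> nat -> Prop) m : ~ D q m ->
  (forall n n' k, (n <= n')%N -> D n' k -> D n k) -> (forall n, D n 0) ->
  (forall n x k, ran T n x -> T x = 0 -> ~ ran T n.+1 x -> D n.+1 k -> D n k.+1) ->
  exists2 d, (q <= d)%N & forall n, (d <= n)%N -> ran T n `&` null_space T `<=` ran T n.+1.
Proof.
move=> nD DW D0 Dj; apply: contrapT => h; apply: nD.
suff : forall k d, (q <= d)%N -> D d k by move=> /(_ m q (leqnn q)).
elim=> [//|k IH] d qd.
have [j dj [x [rx nx] nrx]] : exists2 j, (d <= j)%N &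
    exists2 x, (ran T j `&` null_space T) x & ~ ran T j.+1 x.
  apply: contrapT => h'; apply: h; exists d => // n dn x hx; apply: contrapT => nx; apply: h'.
  by exists n => //; exists x.
apply: (DW d j) => //; apply: (Dj _ x) => //; apply: IH.
exact: leq_trans qd (leq_trans dj (leqnSn j)).
Qed.

Lemma null_chain_stable_alpha T q m : ~ alpha_ge T q m ->
  exists2 d, (q <= d)%N & forall n, (d <= n)%N -> ran T n `&` null_space T `<=` ran T n.+1.
Proof.
move=> h; apply: (null_chain_stable h).
- by move=> n n' k; exact: alpha_geW.
- by move=> n; exact: dim_ge0.
- move=> n x k rx nx nrx.
  apply: (dim_ge_cons (B := ran T n.+1 `&` null_space T) (x := x)) => //.
  + exact: subspace_ran_null.
  + by move=> _ ->; exact: (subspace_ran_null T _).1.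
  + by move=> y [/(ranW (leqnSn n))].
  + by case.
Qed.

Lemma null_chain_stable_beta T q m : ~ beta_ge T q m ->
  exists2 d, (q <= d)%N & forall n, (d <= n)%N -> ran T n `&` null_space T `<=` ran T n.+1.
Proof.
move=> h; apply: (null_chain_stable h).
- by move=> n n' k; exact: beta_geW.
- by move=> n; exact: dim_ge0.
- move=> n x k rx nx nrx hb.
  pose B := sum_set (ran T n.+1) (ran T n `&` null_space T).
  have sB : linsub B by apply: subspace_sum_set; [exact: subspace_ran|exact: subspace_ran_null].
  rewrite -addn1; apply: (@dim_ge_cat _ _ _ B) => //.
  + move=> y [a ra [yr _]]; rewrite -(subrK a y).
    by apply: subspaceD => //; [exact: subspace_ran|exact: ranW ra].
  + by move=> y ry; exists y => //; rewrite subrr; exact: (subspace_ran_null T _).1.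
  + move: hb; apply: (dim_ge_preimage (f := T)); first exact: linearP.
    * exact: subspace_ran.
    * exact: subspace_ran.
    * move=> _ [u _ <-]; exists (iter n T u); first exact: ran_iter.
      by rewrite subrr; exact: (subspace_ran T _).1.
    * move=> y _ [a /ranS ra [_ /= nya]]; suff -> : T y = T a by [].
      by apply/subr0_eq; rewrite -linearB.
  + apply: (@dim_ge1 _ _ _ _ x) => //; first exact: subspace_ran.
    by exists 0; [exact: (subspace_ran T _).1|rewrite subr0].
Qed.

                                                                                  
                                                                                
                                                                                    
                                            
Lemma index_step T j M :
  ~ dim_ge (ran T j `&` null_space T) (ran T j.+1 `&` null_space T) M ->
  exists k, forall m, (alpha_ge T j (m + k) <-> alpha_ge T j.+1 m) /\
                      (beta_ge T j (m + k) <-> beta_ge T j.+1 m).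
Proof.
have sA i := subspace_ran_null T i; have sR := subspace_ran T.
have AA : ran T j.+1 `&` null_space T `<=` ran T j `&` null_space T.
  by move=> x [/(ranW (leqnSn j))].
move=> /(not_dim_ge_basis (sA _))[k _ [hk hk']].
have [v [Av vB vs]] := dim_ge_basis (sA _) hk hk'.
have spA : spanned (ran T j `&` null_space T) (ran T j.+1 `&` null_space T) k by exists v.
pose B := sum_set (ran T j.+1) (ran T j `&` null_space T).
have sB : linsub B by apply: subspace_sum_set.
have BR : B `<=` ran T j.
  move=> y [a ra [yr _]]; rewrite -(subrK a y).
  by apply: subspaceD => //; exact: ranW ra.
have RB : ran T j.+1 `<=` B.
  by move=> y ry; exists y => //; rewrite subrr; exact: (sA _).1.
exists k => m; split; split.
- by move=> h; apply: dim_ge_subl h spA => //; exact: subspace_set0.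
- move=> h; rewrite /alpha_ge addnC.
  apply: (@dim_ge_cat _ _ _ (ran T j.+1 `&` null_space T)) => //.
  by move=> _ ->; exact: (sA _).1.
- move=> h; have : dim_ge (ran T j) B m.
    apply: dim_ge_subr h _ => //; exists v => x [a ra hx]; have [c [hc _]] := vs _ hx.
    exists c; rewrite -(subrK a x) addrAC; exact: subspaceD.
  apply: (dim_ge_image (f := T)) => //; first exact: linearP.
  + by move=> x /ranS.
  + move=> x rx /ranS_inv[u ru Tu]; exists u => //; split.
      by apply: subspaceB => //; exact: ranW ru.
    by rewrite /null_space/= linearB Tu subrr.
- move=> h; apply: (@dim_ge_cat _ _ _ B) => //.
  + move: h; apply: (dim_ge_preimage (f := T)) => //; first exact: linearP.
    * move=> _ [u _ <-]; exists (iter j T u); first exact: ran_iter.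
      by rewrite subrr; exact: (sR _).1.
    * move=> y _ [a /ranS ra [_ /= nya]]; suff -> : T y = T a by [].
      by apply/subr0_eq; rewrite -linearB.
  + move: hk; apply: (dim_ge_image (f := id)) => //.
    * by move=> x hx; exists 0; [exact: (sR _).1|rewrite subr0].
    * by move=> x [_ nx] rx.
Qed.

Lemma index_le T n d M : (n <= d)%N ->
  (forall j, (n <= j)%N ->
     ~ dim_ge (ran T j `&` null_space T) (ran T j.+1 `&` null_space T) M) ->
  ((forall m, alpha_ge T n m -> beta_ge T n m) -> forall m, alpha_ge T d m -> beta_ge T d m) /\
  ((forall m, beta_ge T n m -> alpha_ge T n m) -> forall m, beta_ge T d m -> alpha_ge T d m).
Proof.
move=> /subnKC <- hk; elim: (d - n)%N => [|j [IH1 IH2]]; first by rewrite addn0.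
rewrite addnS; have [k h] := index_step (hk _ (leq_addr j n)).
split=> [/IH1 hle|/IH2 hle] m; have [h1 h2] := h m.
- by move=> /h1/hle/h2.
- by move=> /h2/hle/h1.
Qed.

Definition quasi_fredholm_from T d :=
  (forall n, (d <= n)%N -> ran T n `&` null_space T `<=` ran T n.+1) /\
  (forall n, (d < n)%N -> closed (ran T n)).

Lemma quasi_fredholm_fromW T d d' : (d <= d')%N ->
  quasi_fredholm_from T d -> quasi_fredholm_from T d'.
Proof.
move=> dd [h1 h2]; split=> n dn; [apply: h1|apply: h2]; first exact: leq_trans dn.
exact: leq_ltn_trans dn.
Qed.

Lemma closed_ran_above T q : closed (ran T q.+1) ->
  (forall n, (q <= n)%N -> exists m,
     ~ dim_ge (ran T n `&` null_space T) (ran T n.+1 `&` null_space T) m) ->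
  forall n, (q < n)%N -> closed (ran T n).
Proof.
move=> cq hk n /subnKC <-; elim: (n - q.+1)%N => [|j IH]; first by rewrite addn0.
rewrite addnS addSn; have [m hm] := hk (q + j)%N (leq_addr _ _).
by apply: (closed_ranS _ hm); rewrite -addSn.
Qed.

Lemma quasi_fredholmP T : quasi_fredholm T <-> exists d, quasi_fredholm_from T d.
Proof.
split=> [[d [hk cd]]|[d [hk cd]]]; exists d; last first.
  by split; [move=> n /hk/k_dim_eq0|exact: cd].
have hk' n : (d <= n)%N -> ran T n `&` null_space T `<=` ran T n.+1.
  by move=> /hk/k_dim_eq0.
split=> //; apply: closed_ran_above => // n dn; exists 1%N.
apply/not_dim_ge1; first exact: subspace_ran_null.
by move=> x hx; split; [exact: hk' hx|case: hx].
Qed.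

                                                                        
                                                               
Lemma quasi_fredholm_from_alpha T q m : closed (ran T q.+1) -> ~ alpha_ge T q m ->
  exists2 d, (q <= d)%N & quasi_fredholm_from T d.
Proof.
move=> cq ha; have [d qd hd] := null_chain_stable_alpha ha; exists d => //; split=> // n dn.
apply: (closed_ran_above cq); last exact: leq_ltn_trans dn.
by move=> j qj; exists m => /null_quot_alpha/(alpha_geW qj).
Qed.

Lemma range_closed_of_closed T d (A : set X) : closed A -> range_closed T d A.
Proof.
move=> cA y ry nA; have [e e0 he] := closed_dist_gt0 cA nA.
have [c c0 hc] := rval_nrm_bound T d.
exists (e / c); first by rewrite divr_gt0.
move=> z rz zy Az; have := he z Az; apply/negP; rewrite -ltNge nrmB.
have [v vE] := rval_ex (subspaceB (subspace_ran T d) rz ry).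
have := hc v; rewrite vE => /le_lt_trans; apply.
by rewrite mulrC -ltr_pdivlMr.
Qed.

Lemma quasi_fredholm_from_uniform_descent T d :
  quasi_fredholm_from T d -> uniform_descent_from T d.
Proof.
move=> [h1 h2] n dn; split; first exact/k_dim_eq0/h1.
have [dltn|] := ltnP d n; first exact/range_closed_of_closed/h2.
by move=> nd y ry []; apply: ranW ry.
Qed.

Lemma closed_preim_range_closed T d n : range_closed T d (ran T n) ->
  closed (opow T d @^-1` ran T n).
Proof.
move=> h; apply/closed_adherentP => x hx; apply: contrapT => nx.
have [e e0 he] := h _ (ran_iter T d x) nx.
have [a /= ra xa] := hx e e0; apply: (he _ (ran_iter T d a) _ ra).
by rewrite -iterB_lin (le_lt_trans (range_norm_le _ _ _))// nrmB.
Qed.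

                                                                        
                         
Lemma finite_ran_ker T d m : ~ alpha_ge T d m -> forall j, exists p,
  ~ dim_ge (ran T d `&` ker T j) [set 0] p.
Proof.
move=> hm; elim=> [|j [p hp]].
  exists 1%N; apply/not_dim_ge1; first exact: subspace_set0.
  by move=> x [_].
have sA i : linsub (ran T d `&` ker T i).
  by apply: subspaceI; [exact: subspace_ran|exact: subspace_ker].
have [q _ sp1] := not_dim_ge_spanned (@subspace_set0 _ X) hp.
have : ~ dim_ge (ran T d `&` ker T j.+1) (ran T d `&` ker T j) m.
  move=> h; apply: hm; apply: (alpha_geW (leq_addl j d)); move: h.
  apply: (dim_ge_image (iter_linear T j)); first exact: sA.
  - by move=> x [rx kx]; split; [exact: iter_ran|exact: kx].
  - by move=> x [rx _] kx; split.
move=> /(not_dim_ge_spanned (sA _))[r _ sp2]; exists (r + q).+1 => h.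
have := dim_ge_spanned (@subspace_set0 _ X) h (spanned_cat (@subspace_set0 _ X) sp2 sp1).
by rewrite ltnn.
Qed.

                                                                                 
                                                                           
Lemma uniform_descent_closed_ran T d m : uniform_descent_from T d -> ~ alpha_ge T d m ->
  closed (ran T d) /\ closed (ran T d.+1).
Proof.
move=> h hm; have cd : closed (ran T d).
  apply: (@closed_range_of_sum _ _ (opow T d) (ker T d)).
  - exact: subspace_ker.
  - exact: (closed_null (f := opow T d)).
  - suff -> : sum_set (range (opow T d)) (ker T d) = opow T d @^-1` ran T (d + d).
      by apply: closed_preim_range_closed; exact: (h _ (leq_addr _ _)).2.
    apply/seteqP; split=> [x [_ [u _ <-] hk]|x [u _ xu]].
      exists u => //; rewrite iterD; apply/esym/subr0_eq.
      by rewrite -(linearB (opow T d)).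
    exists (iter d T u); first exact: ran_iter.
    by rewrite /ker /null_space /= iterB_lin -iterD xu subrr.
  - have [p hp] := finite_ran_ker hm d; apply: closed_findim hp.
    by apply: subspaceI; [exact: subspace_ran|exact: subspace_ker].
split=> //; apply: (@closed_of_preimage _ _ (opow T d)) => //; first exact: ranW.
by apply: closed_preim_range_closed; exact: (h _ (leqnSn _)).2.
Qed.

End Chains.

Section Restriction.
Context (R : realType) (X : completeNormedModType R[i]) (T : boundedOp X) (n : nat).
Variable cl : closed (ran T n).

Local Notation P := (restr cl).
Local Notation Z := (csub (range_subspace cl)).

Lemma csub_val_linear : linear (@csub_val _ _ (range_subspace cl)). Proof. by []. Qed.

Lemma csub_ran (x : Z) : ran T n (csub_val x).
Proof. exact/set_mem/(csub_valP x). Qed.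

Lemma csub_ex y : ran T n y -> exists x : Z, csub_val x = y.
Proof. by move=> /mem_set h; exists (@CSub _ _ (range_subspace cl) y h). Qed.

Lemma csub_inj : injective (@csub_val _ _ (range_subspace cl)). Proof. exact: val_inj. Qed.

Lemma csub_val_restr x : csub_val (P x) = T (csub_val x). Proof. by []. Qed.

Lemma restr_ran m (x : Z) : ran P m x <-> ran T (n + m) (csub_val x).
Proof. exact: embed_ran csub_inj csub_val_restr csub_ran csub_ex m x. Qed.

Lemma restr_null (x : Z) : null_space P x <-> null_space T (csub_val x).
Proof. exact: embed_null csub_val_linear csub_inj csub_val_restr x. Qed.

Lemma restr_alpha_ge m : alpha_ge P m = alpha_ge T (n + m).
Proof. exact: embed_alpha_ge csub_val_linear csub_inj csub_val_restr csub_ran csub_ex m. Qed.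

Lemma restr_beta_ge m : beta_ge P m = beta_ge T (n + m).
Proof. exact: embed_beta_ge csub_val_linear csub_inj csub_val_restr csub_ran csub_ex m. Qed.

Lemma restr_closed_ran m : closed (ran P m) <-> closed (ran T (n + m)).
Proof.
rewrite !closed_adherentP; split=> h x hx.
- have [y yx] : exists y : Z, csub_val y = x.
    apply: csub_ex; move/closed_adherentP : cl; apply => e /hx[a ra xa]; exists a => //.
    exact: ranW (leq_addr _ _) _ ra.
  rewrite -yx; apply/restr_ran/h => e /hx[a ra xa].
  have [b ba] := csub_ex (ranW (leq_addr m n) ra); exists b.
    by apply/restr_ran; rewrite ba.
  by move: xa; rewrite -yx -ba.
- by apply/restr_ran/h => e /hx[a /restr_ran ra xa]; exists (csub_val a).
Qed.

Lemma restr_quasi_fredholm_from d : quasi_fredholm_from P d -> quasi_fredholm_from T (n + d).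
Proof.
move=> [h1 h2]; split=> k dk; have nk : (n <= k)%N by lia.
- move=> y [ry ny]; have [x xy] := csub_ex (ranW nk ry).
  rewrite -xy -(subnKC nk) -addnS; apply/restr_ran/h1; first by lia.
  by split; [apply/restr_ran; rewrite xy subnKC|apply/restr_null; rewrite xy].
- by rewrite -(subnKC nk); apply/restr_closed_ran/h2; lia.
Qed.

End Restriction.

Section QfromBeta.
Context (R : realType) (X : completeNormedModType R[i]) (T : boundedOp X).

                                                                              
                                                                                 
                                          
Lemma uniform_descent_beta q m : ~ beta_ge T q m ->
  exists2 d, (q <= d)%N & uniform_descent_from T d.
Proof.
move=> hb; have [d qd hd] := null_chain_stable_beta hb; exists d => // n dn.
split; first exact/k_dim_eq0/hd.
have -> : n = (d + (n - d))%N by rewrite subnKC.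
apply/rop_closed_ran; set Q := rop T d.
have NQ k : ran Q k `&` null_space Q `<=` ran Q k.+1.
  move=> x [/rop_ran rx /rop_null nx]; apply/rop_ran; rewrite addnS.
  by apply: hd; [exact: leq_addr|split].
case: (n - d)%N => [|k]; first by rewrite ran0; exact: closedT.
apply: (@closed_ran_above _ _ Q 0) => //; last first.
  move=> j _; exists 1%N; apply/not_dim_ge1; first exact: subspace_ran_null.
  by move=> x hx; split; [exact: NQ|case: hx].
apply: (@closed_range_findef _ _ Q m) => h; apply: hb; apply: (beta_geW qd).
by move: h; rewrite -beta_ge0E rop_beta_ge addn0.
Qed.

Lemma quasi_fredholm_from_beta q m : closed (ran T q) -> ~ beta_ge T q m ->
  exists2 d, (q <= d)%N & quasi_fredholm_from T d.
Proof.
move=> cq hb; have [d qd hd] := null_chain_stable_beta hb; exists d => //; split=> // n dn.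
have cq1 : closed (ran T q.+1).
  rewrite -addn1; apply/(restr_closed_ran cq); apply: (@closed_range_findef _ _ _ m).
  by rewrite -beta_ge0E restr_beta_ge addn0.
apply: (closed_ran_above cq1); last exact: leq_ltn_trans dn.
by move=> j qj; exists m => /null_quot_beta/(beta_geW qj).
Qed.

End QfromBeta.

                                  

Section InfNat.
Context (R : realType).
Implicit Types (A : set nat).

Lemma infn_min A n : A n -> (forall m, A m -> (n <= m)%N) -> infn R A = n%:R%:E.
Proof.
move=> An h; apply/eqP; rewrite eq_le; apply/andP; split.
  by apply: ereal_inf_lbound; exists n.
by apply: le_ereal_inf_tmp => _ [m /h nm <-]; rewrite lee_fin ler_nat.
Qed.

Lemma infnP A : infn R A = +oo%E /\ A = set0 \/ exists2 n, A n & infn R A = n%:R%:E.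
Proof.
have [[n0 An0]|h] := pselect (exists n, A n); last first.
  have A0 : A = set0 by apply/seteqP; split=> // n An; apply: h; exists n.
  by left; split=> //; rewrite A0 /infn image_set0 ereal_inf0.
have ex : exists n, `[< A n >] by exists n0; exact/asboolP.
right; case: (ex_minnP ex) => n /asboolP An hn; exists n => //.
by apply: infn_min => // m Am; apply: hn; exact/asboolP.
Qed.

Lemma infn_lty A : (infn R A < +oo)%E <-> exists n, A n.
Proof.
have [[-> ->]|[n An ->]] := infnP A; first by rewrite ltxx; split=> // -[].
by rewrite ltry; split=> // _; exists n.
Qed.

Lemma infn_eq A n : infn R A = n%:R%:E -> A n.
Proof. by have [[-> _]//|[m Am ->]] := infnP A => -[/eqP]; rewrite eqr_nat => /eqP <-. Qed.

Lemma infn0 A : A 0 -> infn R A = 0%:R%:E.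
Proof. by move=> A0; exact: infn_min. Qed.

End InfNat.

Section Numbers.
Context (R : realType) (Y : completeNormedModType R[i]).
Implicit Types (S : boundedOp Y) (n m : nat).

Lemma ker_quot_dim S n m : dim_ge (ker S n.+1) (ker S n) m <-> alpha_ge S n m.
Proof.
apply: (dim_ge_iso (iter_linear S n)).
- exact: subspace_ker.
- exact: subspace_set0.
- by move=> x kx; split; [exact: ran_iter|exact: kx].
- by move=> x _; split.
- by move=> _ [[x _ <-] nx]; exists x => //; rewrite /= subrr.
Qed.

Lemma ker_eqP S n : ker S n = ker S n.+1 <-> ~ alpha_ge S n 1.
Proof.
rewrite -ker_quot_dim not_dim_ge1; last exact: subspace_ker.
by split=> [->//|h]; apply/seteqP; split=> //; exact: kerW.
Qed.

Lemma nullity_lty S : (nullity S < +oo)%E <-> exists m, ~ alpha_ge S 0 m.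
Proof. by rewrite alpha_ge0E; apply: quot_dim_lty; exact: subspace_set0. Qed.

Lemma deficiency_lty S : (deficiency S < +oo)%E <-> exists m, ~ beta_ge S 0 m.
Proof. by rewrite beta_ge0E; apply: quot_dim_lty; exact: subspace_range. Qed.

Lemma ascent_lty S : (ascent S < +oo)%E <-> exists n, ~ alpha_ge S n 1.
Proof. by rewrite infn_lty; split=> -[n /ker_eqP hn]; exists n. Qed.

Lemma descent_lty S : (descent S < +oo)%E <-> exists n, ~ beta_ge S n 1.
Proof. by rewrite infn_lty; split=> -[n /not_beta_ge1 hn]; exists n. Qed.

Lemma ess_ascent_set S n :
  (quot_dim (null_space (iter n.+1 S)) (null_space (iter n S)) < +oo)%E <->
  exists m, ~ alpha_ge S n m.
Proof.
rewrite quot_dim_lty; last exact: subspace_ker.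
by split=> -[m hm]; exists m => h; apply: hm; apply/ker_quot_dim.
Qed.

Lemma ess_descent_set S n :
  (quot_dim (range (iter n S)) (range (iter n.+1 S)) < +oo)%E <->
  exists m, ~ beta_ge S n m.
Proof. by rewrite quot_dim_lty; last exact: subspace_ran. Qed.

Lemma ess_descent_lty S : (ess_descent S < +oo)%E <-> exists n m, ~ beta_ge S n m.
Proof. by rewrite infn_lty; split=> -[n /ess_descent_set hn]; exists n. Qed.

Lemma ascent_eq S n : ascent S = n%:R%:E -> ~ alpha_ge S n 1.
Proof. by move=> /infn_eq /ker_eqP. Qed.
Lemma descent_eq S n : descent S = n%:R%:E -> ~ beta_ge S n 1.
Proof. by move=> /infn_eq /not_beta_ge1. Qed.
Lemma ess_ascent_eq S n : ess_ascent S = n%:R%:E -> exists m, ~ alpha_ge S n m.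
Proof. by move=> /infn_eq /ess_ascent_set. Qed.
Lemma ess_descent_eq S n : ess_descent S = n%:R%:E -> exists m, ~ beta_ge S n m.
Proof. by move=> /infn_eq /ess_descent_set. Qed.
Lemma ascent0 S : ~ alpha_ge S 0 1 -> ascent S = 0%:R%:E.
Proof. by move=> /ker_eqP h; exact: infn0. Qed.
Lemma descent0 S : ~ beta_ge S 0 1 -> descent S = 0%:R%:E.
Proof. by move=> /not_beta_ge1 h; exact: infn0. Qed.
Lemma ess_ascent0 S m : ~ alpha_ge S 0 m -> ess_ascent S = 0%:R%:E.
Proof. by move=> h; apply: infn0; apply/ess_ascent_set; exists m. Qed.
Lemma ess_descent0 S m : ~ beta_ge S 0 m -> ess_descent S = 0%:R%:E.
Proof. by move=> h; apply: infn0; apply/ess_descent_set; exists m. Qed.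

Lemma index_le0 S : (nullity S < +oo)%E -> (fredholm_index S <= 0)%E <->
  forall m, alpha_ge S 0 m -> beta_ge S 0 m.
Proof.
move=> h; rewrite alpha_ge0E beta_ge0E; apply: quot_dim_sub_le0 => //.
  exact: subspace_set0.
exact: subspace_range.
Qed.

Lemma index_ge0 S : (deficiency S < +oo)%E -> (0 <= fredholm_index S)%E <->
  forall m, beta_ge S 0 m -> alpha_ge S 0 m.
Proof.
move=> h; rewrite alpha_ge0E beta_ge0E; apply: quot_dim_sub_ge0 => //.
  exact: subspace_set0.
exact: subspace_range.
Qed.

Lemma ontoP S : @onto R Y S <-> ~ beta_ge S 0 1.
Proof. by rewrite not_beta_ge1 ran0 /onto; split=> h; exact: esym h. Qed.

Lemma bounded_belowP S : @bounded_below R Y S <-> ~ alpha_ge S 0 1 /\ closed (range S).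
Proof.
rewrite not_alpha_ge1; split=> [[c c0 h]|[h cS]].
- have h' x : c * nrm x <= nrm (S x) by rewrite -lecR rmorphM/= !nrmE; exact: h.
  split=> [x _ Sx|].
    apply: nrm_eq0; apply/eqP; rewrite eq_le nrm_ge0 andbT -(pmulr_rle0 _ c0).
    by have := h' x; rewrite Sx nrm0.
  by apply: (lift_closed_range (c := c^-1)) => x; exists x => //; rewrite ler_pdivlMl.
- have [c c0 hc] := closed_range_lift cS; exists c^-1; first by rewrite invr_gt0.
  move=> x; rewrite -!nrmE -rmorphM/= lecR ler_pdivrMl//.
  have [|y Sy] := hc (S x); first by exists x.
  suff -> : y = x by [].
  by apply/subr0_eq/h; [rewrite ran0|rewrite linearB Sy subrr].
Qed.

Lemma invertibleP S : @invertible R Y S <-> ~ alpha_ge S 0 1 /\ ~ beta_ge S 0 1.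
Proof.
rewrite -ontoP not_alpha_ge1; split=> [[S' [SK S'K]]|[hi hs]].
  split=> [x _ Sx|]; first by rewrite -(SK x) Sx linear0.
  by apply/seteqP; split=> // y _; exists (S' y).
have [|c c0 hc] := @closed_range_lift _ _ S; first by rewrite hs; exact: closedT.
have /choice[g hg] : forall y, exists x, S x = y /\ nrm x <= c * nrm y.
  move=> y; have [|x ? ?] := hc y; last by exists x.
  by rewrite hs.
have inj x y : S x = S y -> x = y.
  by move=> e; apply/subr0_eq/hi; [rewrite ran0|rewrite linearB e subrr].
have glin : linear g.
  by move=> a x y; apply: inj; rewrite linearP !(hg _).1.
pose gL := GRing.isLinear.Build _ _ _ _ g glin.
pose G : {linear Y -> Y} := HB.pack g gL.
have Gb : exists c : R, forall x, `|G x| <= c%:C * `|x|.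
  by exists c => x; rewrite -!nrmE -rmorphM/= lecR; exact: (hg x).2.
exists (BoundedOp Gb); split=> x /=; last exact: (hg x).1.
by apply: inj; rewrite (hg _).1.
Qed.

End Numbers.

Lemma boundedOp_ext (R : realType) (Y : completeNormedModType R[i]) (S S' : boundedOp Y) :
  (forall x, S x = S' x) -> S = S'.
Proof.
case: S S' => [f hf] [g hg] /= /funext e.
have {e} e : f = g.
  move: f g {hf hg} e => [f [[f1] [f2]]] [g [[g1] [g2]]] /= e.
  by subst g; rewrite (Prop_irrelevance f1 g1) (Prop_irrelevance f2 g2).
by subst g; rewrite (Prop_irrelevance hf hg).
Qed.

Lemma op_shift0 (R : realType) (Y : completeNormedModType R[i]) (T : boundedOp Y) :
  op_shift T 0 = T.
Proof. by apply: boundedOp_ext => x; rewrite /= /shift_fun scale0r subr0. Qed.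

Lemma op_shiftD (R : realType) (Y : completeNormedModType R[i]) (T : boundedOp Y) l m :
  op_shift (op_shift T l) m = op_shift T (l + m).
Proof.
by apply: boundedOp_ext => x; rewrite /= /shift_fun /= /shift_fun scalerDl; abelian_group.
Qed.

                                     

Section ComplexTopology.
Context (R : realType).
Implicit Types (z : R[i]) (A : set R[i]).

Lemma nbhs_cabsP z A : nbhs z A <-> exists2 e : R, 0 < e & forall y, cabs (y - z) < e -> A y.
Proof.
split=> [/(@nbhs_ballP _ (R[i]^o))[e e0 h]|[e e0 h]].
  have er : (complex.Re e)%:C = e by rewrite RRe_real// realE ltW.
  exists (complex.Re e) => [|y yz]; first by rewrite -ltcR er.
  by apply: h; rewrite -ball_normE /ball_/= -cabsE -er ltcR -cabsN opprB.
apply/(@nbhs_ballP _ (R[i]^o)); exists e%:C; first by rewrite /= ltcR.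
by move=> y; rewrite -ball_normE /ball_/= -cabsE ltcR -cabsN opprB => /h.
Qed.

                                                                                
                                               
Lemma countable_isolated_complex A : countable (isolated A).
Proof.
have ex z : exists q : rat * rat * nat, isolated A z ->
    cabs (z - (ratr q.1.1 +i* ratr q.1.2)) < q.2.+1%:R^-1 /\ forall w, isolated A w ->
    cabs (w - (ratr q.1.1 +i* ratr q.1.2)) < q.2.+1%:R^-1 -> w = z.
  have [iz|] := pselect (isolated A z); last by exists (0, 0, 0%N).
  have [_ [V /nbhs_cabsP[e e0 hV] VA]] := iz.
  pose n := Num.truncn (2 / e).
  have n0 : 0 < n.+1%:R :> R by rewrite ltr0n.
  have ne : 2 * n.+1%:R^-1 < e.
    by rewrite ltr_pdivrMr// mulrC -ltr_pdivrMr//; exact: truncnS_gt.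
  have r0 : 0 < n.+1%:R^-1 / 2 :> R by rewrite divr_gt0// invr_gt0.
  have approx (x a : R) : 0 < a -> exists q : rat, `|x - ratr q| < a.
    move=> a0; have [|q] := @rat_in_itvoo _ (x - a) (x + a); first by rewrite ltrD2l gtrN.
    by rewrite in_itv/= => /andP[h1 h2]; exists q; rewrite ltr_norml; apply/andP; split; lra.
  have [p hp] := approx (complex.Re z) _ r0; have [q hq] := approx (complex.Im z) _ r0.
  have zq : cabs (z - (ratr p +i* ratr q)) < n.+1%:R^-1.
    apply: le_lt_trans (cabs_le_ReIm _) _; rewrite [ltRHS]splitr.
    by case: (z) hp hq => a b /= hp hq; exact: ltrD.
  exists (p, q, n) => _; split=> //= w iw wq.
  suff : (V `&` A) w by rewrite VA.
  split; last exact: isolatedS iw.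
  apply: hV; apply: le_lt_trans ne.
  have -> : w - z = (w - (ratr p +i* ratr q)) - (z - (ratr p +i* ratr q)) by ring.
  rewrite (le_trans (cabsD _ _))// cabsN mulr_natl mulr2n lerD// ltW//.
have /choice[f hf] := ex.
apply/countable_injP; exists (pickle \o f) => z w /set_mem iz /set_mem iw /=.
move=> /(pcan_inj (@pickleK _)) fzw.
have [_ h] := hf w iw; apply: h => //; rewrite -fzw; exact: (hf z iz).1.
Qed.

End ComplexTopology.

                                                            

                                                                                   
Definition dim_cond := (nat -> Prop) -> (nat -> Prop) -> Prop.

Section Classes.
Context (R : realType).
Implicit Types (C : opclass R) (D : dim_cond).

                                                                                
Definition char_on_semiregular C D := forall (Y : completeNormedModType R[i]) (S : boundedOp Y),
  closed (range S) -> (forall n, null_space S `<=` ran S n) ->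
  C Y S <-> D (alpha_ge S 0) (beta_ge S 0).

                                                                              
              
Definition char_eventually C D := forall (Y : completeNormedModType R[i]) (S : boundedOp Y),
  C Y S -> exists d, quasi_fredholm_from S d /\ D (alpha_ge S d) (beta_ge S d).

Section Semiregular.
Context (Y : completeNormedModType R[i]) (S : boundedOp Y).
Hypothesis NS : forall n, null_space S `<=` ran S n.

Lemma semireg_alpha n : alpha_ge S n = alpha_ge S 0.
Proof.
rewrite alpha_ge0E /alpha_ge; congr (dim_ge _ _).
by apply/seteqP; split=> [x []//|x nx]; split=> //; exact: NS.
Qed.

                                                                                 
                        
Lemma semireg_ker n : ker S n `<=` range S.
Proof.
elim: n => [|n IH] x kx; first by rewrite (kx : x = 0); exact: (subspace_range S).1.
have [u _ xu] : ran S n.+1 (iter n S x) by apply: NS; exact: kx.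
rewrite -(subrK (S u) x); apply: (subspaceD (subspace_range S)); last by exists u.
by apply: IH; rewrite /ker /null_space /= iterB_lin -iterSr xu subrr.
Qed.

Lemma semireg_beta n : beta_ge S n = beta_ge S 0.
Proof.
apply/funext => m; apply/propext; split; first exact: beta_geW.
rewrite beta_ge0E; apply: (dim_ge_image (iter_linear S n)) => //.
- by move=> x _; exact: ran_iter.
- move=> x _ [u _ xu]; rewrite -(subrK (S u) x).
  apply: (subspaceD (subspace_range S)); last by exists u.
  by apply: (@semireg_ker n); rewrite /ker /null_space /= iterB_lin -iterSr xu subrr.
Qed.

End Semiregular.

Lemma quasi_fredholm_from_of_descent (Y : completeNormedModType R[i]) (S : boundedOp Y) p :
  closed (ran S p) -> ~ beta_ge S p 1 ->
  exists d, quasi_fredholm_from S d /\ ~ beta_ge S d 1.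
Proof.
move=> cp hp; have [d pd qd] := quasi_fredholm_from_beta cp hp.
by exists d; split=> // /(beta_geW pd).
Qed.

Lemma quasi_fredholm_from_of_ascent (Y : completeNormedModType R[i]) (S : boundedOp Y) p :
  closed (ran S p.+1) -> ~ alpha_ge S p 1 ->
  exists d, quasi_fredholm_from S d /\ ~ alpha_ge S d 1.
Proof.
move=> cp hp; have [d pd qd] := quasi_fredholm_from_alpha cp hp.
by exists d; split=> // /(alpha_geW pd).
Qed.

Definition finite_dim (f : nat -> Prop) := exists m, ~ f m.

Lemma finite_dim1 (f : nat -> Prop) : ~ f 1%N -> finite_dim f. Proof. by exists 1%N. Qed.

Definition cond_beta0 : dim_cond := fun a b => ~ b 1%N.
Definition cond_beta : dim_cond := fun a b => finite_dim b.
Definition cond_lower_weyl : dim_cond := fun a b => finite_dim b /\ forall m, b m -> a m.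
Definition cond_alpha0 : dim_cond := fun a b => ~ a 1%N.
Definition cond_alpha : dim_cond := fun a b => finite_dim a.
Definition cond_upper_weyl : dim_cond := fun a b => finite_dim a /\ forall m, a m -> b m.
Definition cond_weyl : dim_cond := fun a b =>
  [/\ finite_dim a, finite_dim b & forall m, a m <-> b m].
Definition cond_fredholm : dim_cond := fun a b => finite_dim a /\ finite_dim b.
Definition cond_invertible : dim_cond := fun a b => ~ a 1%N /\ ~ b 1%N.

Lemma weylP (Y : completeNormedModType R[i]) (S : boundedOp Y) : @weyl R Y S <->
  closed (range S) /\ cond_weyl (alpha_ge S 0) (beta_ge S 0).
Proof.
split=> [[[[/[dup] fn /nullity_lty ha cS] /[dup] fd /deficiency_lty hb] i0]|[cS [ha hb hab]]].
  split=> //; split=> // m; split.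
    by apply: (index_le0 fn).1; rewrite i0.
  by apply: (index_ge0 fd).1; rewrite i0.
have fn : (nullity S < +oo)%E by exact/nullity_lty.
have fd : (deficiency S < +oo)%E by exact/deficiency_lty.
split=> //; apply/eqP; rewrite eq_le; apply/andP; split.
  by apply/index_le0 => // m /hab.
by apply/index_ge0 => // m /hab.
Qed.

Lemma closed_ran0 (Y : completeNormedModType R[i]) (S : boundedOp Y) : closed (ran S 0).
Proof. by rewrite ran0; exact: closedT. Qed.

                                                                               
                                                                      
Lemma onto_semireg : char_on_semiregular (@onto R) cond_beta0.
Proof. by move=> Y S _ _; exact: ontoP. Qed.

Lemma lower_browder_semireg : char_on_semiregular (@lower_browder R) cond_beta0.
Proof.
move=> Y S cS NS; split=> [[_ /descent_lty[n]]|h]; first by rewrite semireg_beta.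
by split; [apply/deficiency_lty; exact: finite_dim1|apply/descent_lty; exists 0%N].
Qed.

Lemma right_drazin_semireg : char_on_semiregular (@right_drazin R) cond_beta0.
Proof.
move=> Y S cS NS; split=> [[n /descent_eq]|h]; first by rewrite semireg_beta.
by exists 0%N; [exact: descent0|exact: closed_ran0].
Qed.

Lemma lower_fredholm_semireg : char_on_semiregular (@lower_fredholm R) cond_beta.
Proof. by move=> Y S _ _; exact: deficiency_lty. Qed.

Lemma ess_right_drazin_semireg : char_on_semiregular (@ess_right_drazin R) cond_beta.
Proof.
move=> Y S cS NS; split=> [[n /ess_descent_eq]|[m h]]; first by rewrite semireg_beta.
by exists 0%N; [exact: ess_descent0 h|exact: closed_ran0].
Qed.

Lemma lower_weyl_semireg : char_on_semiregular (@lower_weyl R) cond_lower_weyl.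
Proof.
move=> Y S _ _; split=> [[/[dup] fd /deficiency_lty hb /(index_ge0 fd)]//|[hb h]].
have fd : (deficiency S < +oo)%E by exact/deficiency_lty.
by split=> //; exact/index_ge0.
Qed.

Lemma bounded_below_semireg : char_on_semiregular (@bounded_below R) cond_alpha0.
Proof. by move=> Y S cS _; rewrite bounded_belowP; split=> [[]|]. Qed.

Lemma upper_browder_semireg : char_on_semiregular (@upper_browder R) cond_alpha0.
Proof.
move=> Y S cS NS; split=> [[_ /ascent_lty[n]]|h]; first by rewrite semireg_alpha.
split; last by apply/ascent_lty; exists 0%N.
by split=> //; apply/nullity_lty; exact: finite_dim1.
Qed.

Lemma left_drazin_semireg : char_on_semiregular (@left_drazin R) cond_alpha0.
Proof.
move=> Y S cS NS; split=> [[n /ascent_eq]|h]; first by rewrite semireg_alpha.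
by exists 0%N; [exact: ascent0|].
Qed.

Lemma upper_fredholm_semireg : char_on_semiregular (@upper_fredholm R) cond_alpha.
Proof.
by move=> Y S cS _; split=> [[/nullity_lty]|] // h; split=> //; exact/nullity_lty.
Qed.

Lemma ess_left_drazin_semireg : char_on_semiregular (@ess_left_drazin R) cond_alpha.
Proof.
move=> Y S cS NS; split=> [[n /ess_ascent_eq]|[m h]]; first by rewrite semireg_alpha.
by exists 0%N; [exact: ess_ascent0 h|].
Qed.

Lemma finite_descent_semireg : char_on_semiregular (@finite_descent R) cond_beta0.
Proof.
move=> Y S cS NS; rewrite /finite_descent descent_lty; split=> [[n]|h]; last by exists 0%N.
by rewrite semireg_beta.
Qed.

Lemma finite_ess_descent_semireg : char_on_semiregular (@finite_ess_descent R) cond_beta.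
Proof.
move=> Y S cS NS; rewrite /finite_ess_descent ess_descent_lty.
by split=> [[n]|h]; [rewrite semireg_beta|exists 0%N].
Qed.

Lemma upper_weyl_semireg : char_on_semiregular (@upper_weyl R) cond_upper_weyl.
Proof.
move=> Y S cS _; split=> [[[/[dup] fn /nullity_lty ha _] /(index_le0 fn)]//|[ha h]].
have fn : (nullity S < +oo)%E by exact/nullity_lty.
by split=> //; exact/index_le0.
Qed.

Lemma weyl_semireg : char_on_semiregular (@weyl R) cond_weyl.
Proof. by move=> Y S cS _; rewrite weylP; split=> [[]|]. Qed.

Lemma fredholm_semireg : char_on_semiregular (@fredholm R) cond_fredholm.
Proof.
move=> Y S cS NS; rewrite /fredholm (upper_fredholm_semireg cS NS).
by rewrite (lower_fredholm_semireg cS NS).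
Qed.

Lemma browder_semireg : char_on_semiregular (@browder R) cond_invertible.
Proof.
move=> Y S cS NS; rewrite /browder (upper_browder_semireg cS NS).
by rewrite (lower_browder_semireg cS NS).
Qed.

Lemma invertible_semireg : char_on_semiregular (@invertible R) cond_invertible.
Proof. by move=> Y S _ _; exact: invertibleP. Qed.

                                                                                 
                                                                              
                                                                        
Lemma onto_eventually : char_eventually (@onto R) cond_beta0.
Proof. by move=> Y S /ontoP; apply: quasi_fredholm_from_of_descent; exact: closed_ran0. Qed.

Lemma lower_fredholm_eventually : char_eventually (@lower_fredholm R) cond_beta.
Proof.
move=> Y S /deficiency_lty[m hm].
have [|d _ qd] := quasi_fredholm_from_beta _ hm; first by rewrite ran0; exact: closedT.
by exists d; split=> //; exists m => /(beta_geW (leq0n d)).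
Qed.

Lemma lower_browder_eventually : char_eventually (@lower_browder R) cond_beta0.
Proof.
move=> Y S [/lower_fredholm_eventually[d [qd _]] /descent_lty[p hp]].
exists (maxn d p); split; first exact: quasi_fredholm_fromW (leq_maxl _ _) qd.
by move=> /(beta_geW (leq_maxr d p)).
Qed.

Lemma right_drazin_eventually : char_eventually (@right_drazin R) cond_beta0.
Proof. by move=> Y S [p /descent_eq hp cp]; exact: quasi_fredholm_from_of_descent hp. Qed.

Lemma ess_right_drazin_eventually : char_eventually (@ess_right_drazin R) cond_beta.
Proof.
move=> Y S [p /ess_descent_eq[m hm] cp]; have [d pd qd] := quasi_fredholm_from_beta cp hm.
by exists d; split=> //; exists m => /(beta_geW pd).
Qed.

Lemma lower_weyl_eventually : char_eventually (@lower_weyl R) cond_lower_weyl.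
Proof.
move=> Y S [/[dup] fd /deficiency_lty[m hm] /(index_ge0 fd) ba].
have [|d _ qd] := quasi_fredholm_from_beta _ hm; first by rewrite ran0; exact: closedT.
exists d; split=> //; split; first by exists m => /(beta_geW (leq0n d)).
apply: (index_le (leq0n d) (M := m) _).2 ba => j _ /null_quot_beta/(beta_geW (leq0n j)).
exact: hm.
Qed.

Lemma bounded_below_eventually : char_eventually (@bounded_below R) cond_alpha0.
Proof. by move=> Y S /bounded_belowP[ha cS]; exact: quasi_fredholm_from_of_ascent ha. Qed.

Lemma upper_fredholm_eventually : char_eventually (@upper_fredholm R) cond_alpha.
Proof.
move=> Y S [/nullity_lty[m hm] cS]; have [d _ qd] := quasi_fredholm_from_alpha (q := 0) cS hm.
by exists d; split=> //; exists m => /(alpha_geW (leq0n d)).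
Qed.

Lemma upper_browder_eventually : char_eventually (@upper_browder R) cond_alpha0.
Proof.
move=> Y S [/upper_fredholm_eventually[d [qd _]] /ascent_lty[p hp]].
exists (maxn d p); split; first exact: quasi_fredholm_fromW (leq_maxl _ _) qd.
by move=> /(alpha_geW (leq_maxr d p)).
Qed.

Lemma left_drazin_eventually : char_eventually (@left_drazin R) cond_alpha0.
Proof. by move=> Y S [p /ascent_eq hp cp]; exact: quasi_fredholm_from_of_ascent hp. Qed.

Lemma ess_left_drazin_eventually : char_eventually (@ess_left_drazin R) cond_alpha.
Proof.
move=> Y S [p /ess_ascent_eq[m hm] cp]; have [d pd qd] := quasi_fredholm_from_alpha cp hm.
by exists d; split=> //; exists m => /(alpha_geW pd).
Qed.

Lemma upper_weyl_eventually : char_eventually (@upper_weyl R) cond_upper_weyl.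
Proof.
move=> Y S [[/[dup] fn /nullity_lty[m hm] cS] /(index_le0 fn) ab].
have [d _ qd] := quasi_fredholm_from_alpha (q := 0) cS hm.
exists d; split=> //; split; first by exists m => /(alpha_geW (leq0n d)).
apply: (index_le (leq0n d) (M := m) _).1 ab => j _ /null_quot_alpha/(alpha_geW (leq0n j)).
exact: hm.
Qed.

Lemma weyl_eventually : char_eventually (@weyl R) cond_weyl.
Proof.
move=> Y S /weylP[cS [[m hm] [k hk] ab]].
have [d _ qd] := quasi_fredholm_from_alpha (q := 0) cS hm.
have hj j : (0 <= j)%N -> ~ dim_ge (ran S j `&` null_space S) (ran S j.+1 `&` null_space S) m.
  by move=> _ /null_quot_alpha/(alpha_geW (leq0n j)).
have [h1 h2] := index_le (leq0n d) hj.
exists d; split=> //; split.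
- by exists m => /(alpha_geW (leq0n d)).
- by exists k => /(beta_geW (leq0n d)).
- by move=> i; split; [apply: h1|apply: h2] => p /ab.
Qed.

Lemma fredholm_eventually : char_eventually (@fredholm R) cond_fredholm.
Proof.
move=> Y S [/upper_fredholm_eventually[d [qd ha]] /deficiency_lty[m hm]].
by exists d; split=> //; split=> //; exists m => /(beta_geW (leq0n d)).
Qed.

Lemma browder_eventually : char_eventually (@browder R) cond_invertible.
Proof.
move=> Y S [/upper_browder_eventually[d [qd ha]] [_ /descent_lty[p hp]]].
exists (maxn d p); split; first exact: quasi_fredholm_fromW (leq_maxl _ _) qd.
by split; [move=> /(alpha_geW (leq_maxl d p))|move=> /(beta_geW (leq_maxr d p))].
Qed.

Lemma invertible_eventually : char_eventually (@invertible R) cond_invertible.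
Proof.
move=> Y S /invertibleP[ha hb].
have [|d _ qd] := quasi_fredholm_from_beta _ hb; first by rewrite ran0; exact: closedT.
exists d; split=> //.
by split; [move=> /(alpha_geW (leq0n d))|move=> /(beta_geW (leq0n d))].
Qed.

End Classes.

                                    

Section BClasses.
Context (R : realType) (C : opclass R) (D : dim_cond).
Hypothesis HS : char_on_semiregular C D.

Lemma restr_Bclass (X : completeNormedModType R[i]) (T : boundedOp X) d :
  closed (ran T d) -> closed (ran T d.+1) ->
  (forall n, (d <= n)%N -> ran T d `&` null_space T `<=` ran T n) ->
  D (alpha_ge T d) (beta_ge T d) -> Bclass C T.
Proof.
move=> cd cd1 hN hD; exists d, cd; apply/HS.
- by apply/(restr_closed_ran cd 1); rewrite addn1.
- move=> n x /restr_null nx; apply/restr_ran; apply: (hN _ (leq_addr n d)).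
  by split=> //; exact: csub_ran.
- by rewrite restr_alpha_ge restr_beta_ge addn0.
Qed.

Lemma alpha_ge_const (X : completeNormedModType R[i]) (T : boundedOp X) d :
  ran T d `&` null_space T `<=` ran T d.+1 -> alpha_ge T d.+1 = alpha_ge T d.
Proof.
move=> h; rewrite /alpha_ge; congr (dim_ge _ _).
apply/seteqP; split=> x [rx nx]; split=> //; first exact: ranW rx.
exact: h.
Qed.

Lemma beta_ge_const (X : completeNormedModType R[i]) (T : boundedOp X) d :
  ran T d `&` null_space T `<=` ran T d.+1 -> beta_ge T d.+1 = beta_ge T d.
Proof.
move=> h; apply/funext => m; apply/propext; split; first exact: beta_ge_step.
apply: (dim_ge_image (f := T)); first exact: linearP.
- exact: subspace_ran.
- by move=> x /ranS.
- move=> x rx /ranS_inv[u ru Tu]; rewrite -(subrK u x).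
  apply: (subspaceD (subspace_ran T d.+1)) => //; apply: h; split.
    by apply: (subspaceB (subspace_ran T d)) => //; exact: ranW ru.
  by rewrite /null_space/= linearB Tu subrr.
Qed.

Lemma Bclass_eventually (X : completeNormedModType R[i]) (T : boundedOp X) :
  char_eventually C D -> Bclass C T ->
  exists d, quasi_fredholm_from T d /\ D (alpha_ge T d) (beta_ge T d).
Proof.
move=> HD [n [cl /HD[d [qd]]]]; rewrite restr_alpha_ge restr_beta_ge => hD.
by exists (n + d)%N; split=> //; exact: restr_quasi_fredholm_from qd.
Qed.

                                                                                   
                                                                 
Lemma Bclass_quasi_fredholm_fromP (X : completeNormedModType R[i]) (T : boundedOp X) :
  char_eventually C D -> Bclass C T <->
  exists d, quasi_fredholm_from T d /\ D (alpha_ge T d) (beta_ge T d).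
Proof.
move=> HD; split=> [|[d [qd]]]; first exact: Bclass_eventually.
have h := qd.1 _ (leqnn d); rewrite -(alpha_ge_const h) -(beta_ge_const h).
apply: restr_Bclass.
- exact: qd.2.
- by apply: qd.2; exact: ltnW.
- move=> n _; apply: uniform_descent_null; apply: quasi_fredholm_from_uniform_descent.
  exact: quasi_fredholm_fromW qd.
Qed.

                                                                                  
                                         
Lemma Bclass_uniform_descentP (X : completeNormedModType R[i]) (T : boundedOp X) :
  char_eventually C D -> (forall a b, D a b -> finite_dim a) ->
  Bclass C T <-> exists d, uniform_descent_from T d /\ D (alpha_ge T d) (beta_ge T d).
Proof.
move=> HD Da; split=> [/(Bclass_eventually HD)[d [qd hd]]|[d [ud hd]]].
  by exists d; split=> //; exact: quasi_fredholm_from_uniform_descent.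
have [m hm] := Da _ _ hd; have [cd cd1] := uniform_descent_closed_ran ud hm.
by apply: restr_Bclass cd cd1 _ hd => n _; exact: uniform_descent_null.
Qed.

End BClasses.

                                                                             
                                                                
Lemma Bclass_finite_descentP (R : realType) (X : completeNormedModType R[i])
    (T : boundedOp X) :
  Bclass (@finite_descent R) T <->
  exists d, uniform_descent_from T d /\ cond_beta0 (alpha_ge T d) (beta_ge T d).
Proof.
split=> [[n [cl /descent_lty[p]]]|[d [_ hd]]].
  rewrite restr_beta_ge => hp; have [d pd ud] := uniform_descent_beta hp.
  by exists d; split=> // /(beta_geW pd).
by exists 0%N, (@closed_ran0 _ _ T); apply/descent_lty; exists d; rewrite restr_beta_ge.
Qed.

Lemma Bclass_finite_ess_descentP (R : realType) (X : completeNormedModType R[i])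
    (T : boundedOp X) :
  Bclass (@finite_ess_descent R) T <->
  exists d, uniform_descent_from T d /\ cond_beta (alpha_ge T d) (beta_ge T d).
Proof.
split=> [[n [cl /ess_descent_lty[p [m]]]]|[d [_ [m hd]]]].
  rewrite restr_beta_ge => hp; have [d pd ud] := uniform_descent_beta hp.
  by exists d; split=> //; exists m => /(beta_geW pd).
by exists 0%N, (@closed_ran0 _ _ T); apply/ess_descent_lty; exists d, m; rewrite restr_beta_ge.
Qed.

                                 

Section Equivalence.
Context (R : realType) (C : opclass R) (D : dim_cond).
Variable Q : forall X : completeNormedModType R[i], boundedOp X -> nat -> Prop.
Hypotheses (HS : char_on_semiregular C D)
  (HQ : forall X (T : boundedOp X) d, Q T d -> uniform_descent_from T d)
  (HC : forall X (T : boundedOp X), @C X T ->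
     exists d, Q T d /\ D (alpha_ge T d) (beta_ge T d))
  (HB : forall X (T : boundedOp X), Bclass C T <->
     exists d, Q T d /\ D (alpha_ge T d) (beta_ge T d)).

Lemma class_Bclass X (T : boundedOp X) : @C X T -> Bclass C T.
Proof. by move=> /HC h; exact/HB. Qed.

Lemma punctured_class X (T : boundedOp X) d : Q T d -> exists2 e : R, 0 < e &
  forall l, l != 0 -> cabs l < e -> @C X (op_shift T l) <-> D (alpha_ge T d) (beta_ge T d).
Proof.
move=> /HQ/punctured_neighbourhood[e e0 he]; exists e => // l l0 le.
have [cS NS aE bE] := he l l0 (ltW le); rewrite (HS cS NS).
have -> : alpha_ge T d = alpha_ge (op_shift T l) 0 by apply/funext => m; exact/propext/aE.
by have -> : beta_ge T d = beta_ge (op_shift T l) 0 by apply/funext => m; exact/propext/bE.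
Qed.

Lemma Bclass_punctured X (T : boundedOp X) : Bclass C T -> exists2 e : R, 0 < e &
  forall l, l != 0 -> cabs l < e -> @C X (op_shift T l).
Proof.
move=> /HB[d [qd hD]]; have [e e0 he] := punctured_class qd; exists e => // l l0 le.
exact/he.
Qed.

Lemma small_complex (e : R) : 0 < e -> exists2 l : R[i], l != 0 & cabs l < e.
Proof.
move=> e0; exists (e / 2)%:C.
  by rewrite (inj_eq (@complexI _) _ 0) gt_eqF// divr_gt0.
by rewrite cabs_real ?divr_ge0 ?ltW// ltr_pdivrMr// mulr_natr mulr2n ltrDl.
Qed.

Lemma not_limit_not_interior (A : set R[i]) : ~ limit_point A 0 -> ~ interior A 0.
Proof.
move=> h /nbhs_cabsP[e e0 he]; apply: h => U /nbhs_cabsP[r r0 hr].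
have [|l l0] := @small_complex (Num.min e r); first by rewrite lt_min e0.
rewrite lt_min => /andP[le lr]; exists l; split=> //.
  by apply: he; rewrite subr0.
by apply: hr; rewrite subr0.
Qed.

                                                                                  
                                                                                 
                                                               
Theorem class_equivalence X (T : boundedOp X) :
  [<-> Bclass C T;
       (exists d, Q T d) /\ ~ limit_point (class_spectrum C T) 0;
       (exists d, Q T d) /\ ~ interior (class_spectrum C T) 0].
Proof.
tfae.
- move=> hB; have [d [qd _]] := (HB T).1 hB; split; first by exists d.
  have [e e0 he] := Bclass_punctured hB.
  move=> /(_ [set y | cabs (y - 0) < e]); case; first by apply/nbhs_cabsP; exists e.
  by move=> y [y0 /= nC]; rewrite subr0 => /(he y y0).
- by move=> [qT hl]; split=> //; exact: not_limit_not_interior.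
- move=> [[d qd] hi]; have [e e0 he] := punctured_class qd.
  have [hD|nD] := pselect (D (alpha_ge T d) (beta_ge T d)).
    by apply/HB; exists d.
  apply: class_Bclass; apply: contrapT => nC; apply: hi.
  apply/nbhs_cabsP; exists e => // l; rewrite subr0 => le.
  have [->|l0] := eqVneq l 0; first by rewrite /class_spectrum/= op_shift0.
  by move=> /(he l l0 le).
Qed.

Theorem class_spectra X (T : boundedOp X) :
  [/\ interior (class_spectrum C T) = interior (class_spectrum (Bclass C) T),
      boundary (class_spectrum (Bclass C) T) `<=` boundary (class_spectrum C T),
      class_spectrum C T `\` class_spectrum (Bclass C) T `<=` isolated (class_spectrum C T)
    & countable (class_spectrum C T `\` class_spectrum (Bclass C) T)].
Proof.
have sub : class_spectrum (Bclass C) T `<=` class_spectrum C T.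
  by move=> l nB hC; apply: nB; exact: class_Bclass.
have punct l : ~ class_spectrum (Bclass C) T l -> exists2 e : R, 0 < e &
    forall m, m != l -> cabs (m - l) < e -> @C X (op_shift T m).
  move=> /contrapT/Bclass_punctured[e e0 he]; exists e => // m ml me.
  by have := he (m - l); rewrite op_shiftD subrKC subr_eq0; exact.
have intE : interior (class_spectrum C T) = interior (class_spectrum (Bclass C) T).
  apply/seteqP; split; last exact: interiorS.
  rewrite -open_subsetE; last exact: open_interior.
  move=> l /nbhs_cabsP[e e0 he]; apply: contrapT => /punct[r r0 hr].
  have [|m m0] := @small_complex (Num.min e r); first by rewrite lt_min e0.
  rewrite lt_min => /andP[me mr].
  have := he (l + m); rewrite addrAC subrr add0r => /(_ me); apply.
  apply: hr; last by rewrite addrAC subrr add0r.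
  by rewrite -subr_eq0 addrAC subrr add0r.
have iso : class_spectrum C T `\` class_spectrum (Bclass C) T `<=`
    isolated (class_spectrum C T).
  move=> l [hl /punct[e e0 he]]; split; first exact/mem_set.
  exists [set m | cabs (m - l) < e]; first by apply/nbhs_cabsP; exists e.
  apply/seteqP; split=> [m [/= me hm]|m /= ->]; last first.
    by split=> //=; rewrite subrr cabs0.
  by apply/eqP/negPn/negP => ml; apply: hm; exact: he.
split=> //.
- move=> l [cl ni]; split; first exact: closure_subset cl.
  by rewrite intE.
- apply: sub_countable (countable_isolated_complex (class_spectrum C T)).
  exact: subset_card_le.
Qed.

End Equivalence.

Section Instances.
Context (R : realType).

Lemma quasi_fredholm_from_equivalence (C : opclass R) D
    (X : completeNormedModType R[i]) (T : boundedOp X) :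
  char_on_semiregular C D -> char_eventually C D ->
  [<-> Bclass C T;
       quasi_fredholm T /\ ~ limit_point (class_spectrum C T) 0;
       quasi_fredholm T /\ ~ interior (class_spectrum C T) 0].
Proof.
move=> HS HD; rewrite (propext (quasi_fredholmP T)).
apply: (class_equivalence (D := D) (Q := fun X T d => quasi_fredholm_from T d)) => //.
- by move=> Y S d; exact: quasi_fredholm_from_uniform_descent.
- by move=> Y S; exact: Bclass_quasi_fredholm_fromP.
Qed.

Lemma uniform_descent_equivalence (C : opclass R) D
    (X : completeNormedModType R[i]) (T : boundedOp X) :
  char_on_semiregular C D -> char_eventually C D -> (forall a b, D a b -> finite_dim a) ->
  [<-> Bclass C T;
       TUD T /\ ~ limit_point (class_spectrum C T) 0;
       TUD T /\ ~ interior (class_spectrum C T) 0].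
Proof.
move=> HS HD Da.
apply: (class_equivalence (D := D) (Q := fun X T d => uniform_descent_from T d)) => //.
- move=> Y S /HD[d [qd hd]]; exists d; split=> //; exact: quasi_fredholm_from_uniform_descent.
- by move=> Y S; exact: Bclass_uniform_descentP.
Qed.

Lemma finite_descent_equivalence (X : completeNormedModType R[i]) (T : boundedOp X)
    (C := @finite_descent R) :
  [<-> Bclass C T;
       TUD T /\ ~ limit_point (class_spectrum C T) 0;
       TUD T /\ ~ interior (class_spectrum C T) 0].
Proof.
apply: (class_equivalence (D := cond_beta0) (Q := fun X T d => uniform_descent_from T d)) => //.
- exact: finite_descent_semireg.
- move=> Y S /descent_lty[p hp]; have [d pd ud] := uniform_descent_beta hp.
  by exists d; split=> // /(beta_geW pd).
- by move=> Y S; exact: Bclass_finite_descentP.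
Qed.

Lemma finite_ess_descent_equivalence (X : completeNormedModType R[i]) (T : boundedOp X)
    (C := @finite_ess_descent R) :
  [<-> Bclass C T;
       TUD T /\ ~ limit_point (class_spectrum C T) 0;
       TUD T /\ ~ interior (class_spectrum C T) 0].
Proof.
apply: (class_equivalence (D := cond_beta) (Q := fun X T d => uniform_descent_from T d)) => //.
- exact: finite_ess_descent_semireg.
- move=> Y S /ess_descent_lty[p [m hp]]; have [d pd ud] := uniform_descent_beta hp.
  by exists d; split=> //; exists m => /(beta_geW pd).
- by move=> Y S; exact: Bclass_finite_ess_descentP.
Qed.

Lemma quasi_fredholm_from_spectra (C : opclass R) D
    (X : completeNormedModType R[i]) (T : boundedOp X) :
  char_on_semiregular C D -> char_eventually C D ->
  [/\ interior (class_spectrum C T) = interior (class_spectrum (Bclass C) T),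
      boundary (class_spectrum (Bclass C) T) `<=` boundary (class_spectrum C T),
      class_spectrum C T `\` class_spectrum (Bclass C) T `<=` isolated (class_spectrum C T)
    & countable (class_spectrum C T `\` class_spectrum (Bclass C) T)].
Proof.
move=> HS HD; apply: (class_spectra (D := D) (Q := fun X T d => quasi_fredholm_from T d)) => //.
- by move=> Y S d; exact: quasi_fredholm_from_uniform_descent.
- by move=> Y S; exact: Bclass_quasi_fredholm_fromP.
Qed.

End Instances.

Theorem theorem2p19 (R : realType) (X : completeNormedModType R[i])
    (X_infinite : subspace_dim [set: X] = +oo%E) (T : boundedOp X) :
  [/\ forall C : opclass R,
        List.In C [:: @onto R; @lower_browder R; @right_drazin R;
             @lower_fredholm R; @ess_right_drazin R; @lower_weyl R] ->
        [<-> Bclass C T;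
             quasi_fredholm T /\ ~ limit_point (class_spectrum C T) 0;
             quasi_fredholm T /\ ~ interior (class_spectrum C T) 0],
      forall C : opclass R,
        List.In C [:: @bounded_below R; @upper_browder R; @left_drazin R;
             @upper_fredholm R; @ess_left_drazin R; @finite_descent R;
             @finite_ess_descent R; @upper_weyl R; @weyl R; @fredholm R;
             @browder R; @invertible R] ->
        [<-> Bclass C T;
             TUD T /\ ~ limit_point (class_spectrum C T) 0;
             TUD T /\ ~ interior (class_spectrum C T) 0]
    & forall C : opclass R,
        List.In C [:: @onto R; @lower_browder R; @lower_fredholm R;
             @bounded_below R; @upper_browder R; @upper_fredholm R; @upper_weyl R;
             @lower_weyl R; @weyl R; @fredholm R; @browder R;
             @invertible R] ->
        [/\ interior (class_spectrum C T) = interior (class_spectrum (Bclass C) T),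
            boundary (class_spectrum (Bclass C) T) `<=` boundary (class_spectrum C T),
            class_spectrum C T `\` class_spectrum (Bclass C) T
              `<=` isolated (class_spectrum C T)
          & countable (class_spectrum C T `\` class_spectrum (Bclass C) T)]].
Proof.
split=> C /=.
- case=> [<-|[<-|[<-|[<-|[<-|[<-|//]]]]]].
  + exact: quasi_fredholm_from_equivalence (@onto_semireg R) (@onto_eventually R).
  + exact: quasi_fredholm_from_equivalence (@lower_browder_semireg R)
      (@lower_browder_eventually R).
  + exact: quasi_fredholm_from_equivalence (@right_drazin_semireg R)
      (@right_drazin_eventually R).
  + exact: quasi_fredholm_from_equivalence (@lower_fredholm_semireg R)
      (@lower_fredholm_eventually R).
  + exact: quasi_fredholm_from_equivalence (@ess_right_drazin_semireg R)
      (@ess_right_drazin_eventually R).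
  + exact: quasi_fredholm_from_equivalence (@lower_weyl_semireg R)
      (@lower_weyl_eventually R).
- case=> [<-|[<-|[<-|[<-|[<-|[<-|[<-|[<-|[<-|[<-|[<-|[<-|//]]]]]]]]]]]].
  + apply: uniform_descent_equivalence (@bounded_below_semireg R)
      (@bounded_below_eventually R) _.
    by move=> a b /finite_dim1.
  + apply: uniform_descent_equivalence (@upper_browder_semireg R)
      (@upper_browder_eventually R) _.
    by move=> a b /finite_dim1.
  + apply: uniform_descent_equivalence (@left_drazin_semireg R)
      (@left_drazin_eventually R) _.
    by move=> a b /finite_dim1.
  + exact: uniform_descent_equivalence (@upper_fredholm_semireg R)
      (@upper_fredholm_eventually R) _.
  + exact: uniform_descent_equivalence (@ess_left_drazin_semireg R)
      (@ess_left_drazin_eventually R) _.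
  + exact: finite_descent_equivalence.
  + exact: finite_ess_descent_equivalence.
  + apply: uniform_descent_equivalence (@upper_weyl_semireg R)
      (@upper_weyl_eventually R) _.
    by move=> a b [].
  + apply: uniform_descent_equivalence (@weyl_semireg R) (@weyl_eventually R) _.
    by move=> a b [].
  + apply: uniform_descent_equivalence (@fredholm_semireg R) (@fredholm_eventually R) _.
    by move=> a b [].
  + apply: uniform_descent_equivalence (@browder_semireg R) (@browder_eventually R) _.
    by move=> a b [/finite_dim1].
  + apply: uniform_descent_equivalence (@invertible_semireg R)
      (@invertible_eventually R) _.
    by move=> a b [/finite_dim1].
- case=> [<-|[<-|[<-|[<-|[<-|[<-|[<-|[<-|[<-|[<-|[<-|[<-|//]]]]]]]]]]]].
  + exact: quasi_fredholm_from_spectra (@onto_semireg R) (@onto_eventually R).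
  + exact: quasi_fredholm_from_spectra (@lower_browder_semireg R)
      (@lower_browder_eventually R).
  + exact: quasi_fredholm_from_spectra (@lower_fredholm_semireg R)
      (@lower_fredholm_eventually R).
  + exact: quasi_fredholm_from_spectra (@bounded_below_semireg R)
      (@bounded_below_eventually R).
  + exact: quasi_fredholm_from_spectra (@upper_browder_semireg R)
      (@upper_browder_eventually R).
  + exact: quasi_fredholm_from_spectra (@upper_fredholm_semireg R)
      (@upper_fredholm_eventually R).
  + exact: quasi_fredholm_from_spectra (@upper_weyl_semireg R)
      (@upper_weyl_eventually R).
  + exact: quasi_fredholm_from_spectra (@lower_weyl_semireg R)
      (@lower_weyl_eventually R).
  + exact: quasi_fredholm_from_spectra (@weyl_semireg R) (@weyl_eventually R).
  + exact: quasi_fredholm_from_spectra (@fredholm_semireg R) (@fredholm_eventually R).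
  + exact: quasi_fredholm_from_spectra (@browder_semireg R) (@browder_eventually R).
  + exact: quasi_fredholm_from_spectra (@invertible_semireg R)
      (@invertible_eventually R).
Qed.
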